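(* Let $n\in\{1,2,3\}$ and let $q\in(1,\infty)$. Then the sequence $\{S_{\mathbf k}\}_{\mathbf k\in\mathbb N^n}$ is a Schauder basis in the real Lebesgue space $L_q((0,1)^n)$ (in the Pringsheim sense): for every $f\in L_q((0,1)^n)$ there exists a unique family of real scalars $\{\alpha_{\mathbf k}\}_{\mathbf k\in\mathbb N^n}$ such that \[ \lim_{\min\{m_1,\dots,m_n\}\to\infty}\Big\|f-\sum_{\mathbf k\le\mathbf m}\alpha_{\mathbf k}S_{\mathbf k}\Big\|_{L_q((0,1)^n)}=0 . \]
   Context: Let $S(t)=2t$ for $0\le t\le \frac12$ and $S(t)=2(1-t)$ for $\frac12<t\le 1$, and extend $S$ to $\mathbb R$ by $S(t)=(-1)^{\lfloor t\rfloor}S(t-\lfloor t\rfloor)$ (so $S$ is odd and $2$-periodic). Let $\mathbb N=\{1,2,\dots\}$. For $\mathbf k=(k_1,\dots,k_n)\in\mathbb N^n$ put $S_{\mathbf k}(x)=S(k_1x_1)\cdots S(k_nx_n)$, $x\in\mathbb R^n$. For $\mathbf k,\mathbf m\in\mathbb N^n$, $\mathbf k\le\mathbf m$ means $k_i\le m_i$ for all $i$. *)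

(* Defs.v *)
From HB Require Import structures.
From mathcomp Require Import all_boot all_order all_algebra.
From mathcomp Require Import all_classical all_reals all_analysis.

Set Implicit Arguments.
Unset Strict Implicit.
Unset Printing Implicit Defensive.
Import Order.TTheory GRing.Theory Num.Theory.
Import numFieldNormedType.Exports.
Local Open Scope classical_set_scope.
Local Open Scope ring_scope.

(* [measurableTypeR R] is [R] with the sigma-algebra [lebesgue_measure] is
   declared on; tuples carry the product sigma-algebra. *)
Notation euclid R n := (n.-tuple (measurableTypeR R)).

Section lebesgue_measure_succ.
Context {R : realType} (n : nat).
Variable mu : {sigma_finite_measure set (euclid R n) -> \bar R}.
Local Open Scope ereal_scope.

Definition tcons (x : measurableTypeR R * euclid R n) : euclid R n.+1 :=
  [tuple of x.1 :: x.2].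

Definition tuncons (x : euclid R n.+1) : measurableTypeR R * euclid R n :=
  (thead x, [tuple of behead x]).

Lemma measurable_tcons : measurable_fun [set: measurableTypeR R * euclid R n] tcons.
Proof. exact: measurable_cons. Qed.

Lemma measurable_tuncons : measurable_fun [set: euclid R n.+1] tuncons.
Proof.
apply/measurable_fun_pair; first exact: measurable_tnth.
exact: measurable_behead.
Qed.

Lemma tconsK : cancel tcons tuncons.
Proof.
by move=> [a t]; congr pair; apply/val_inj.
Qed.

Lemma tunconsK : cancel tuncons tcons.
Proof. by move=> x; rewrite /tcons/= -tuple_eta. Qed.

Definition lebesgue_measure_succ : set (euclid R n.+1) -> \bar R :=
  pushforward (lebesgue_measure \x mu) tcons.

Let succ_measure : {measure set (euclid R n.+1) -> \bar R}.
Proof.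
unshelve refine [the measure _ _ of pushforward (lebesgue_measure \x mu) tcons].
exact: measurable_tcons.
Defined.

HB.instance Definition _ := Measure.copy lebesgue_measure_succ succ_measure.

Let succ_sigma_finite : sigma_finite setT lebesgue_measure_succ.
Proof.
have /sigma_finiteP[F [TF ndF Foo]] :=
  sigma_finiteT (@lebesgue_measure R : {sigma_finite_measure set _ -> \bar R}).
have /sigma_finiteP[G [TG ndG Goo]] := sigma_finiteT mu.
have mFG k : measurable (F k `*` G k).
  by apply: measurableX; [case: (Foo k)|case: (Goo k)].
exists (fun k => tuncons @^-1` (F k `*` G k)) => [|k].
  apply/seteqP; split=> // x _.
  have : [set: measurableTypeR R] (tuncons x).1 by [].
  have : [set: euclid R n] (tuncons x).2 by [].
  rewrite TF TG => -[j _ Gj] [i _ Fi]; exists (maxn i j) => //; split.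
    by move: Fi; apply/subsetPset/ndF/leq_maxl.
  by move: Gj; apply/subsetPset/ndG/leq_maxr.
split; first by rewrite -[X in measurable X]setTI; exact: measurable_tuncons.
rewrite /lebesgue_measure_succ /pushforward -comp_preimage.
rewrite (_ : tuncons \o tcons = id); last by apply/funext; exact: tconsK.
rewrite preimage_id.
have [mF Fk] := Foo k; have [mG Gk] := Goo k.
by rewrite product_measure1E// lte_mul_pinfty// ge0_fin_numE.
Qed.

HB.instance Definition _ := Measure_isSigmaFinite.Build _ _ _
  lebesgue_measure_succ succ_sigma_finite.

End lebesgue_measure_succ.

Fixpoint lebesgue_measure_tuple {R : realType} (n : nat) :
    {sigma_finite_measure set (euclid R n) -> \bar R} :=
  match n with
  | 0 => \d_([tuple] : euclid R 0)
  | n'.+1 => lebesgue_measure_succ (lebesgue_measure_tuple n')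
  end.

Section cube.
Context {R : realType}.

Lemma measurable_tuple_box n (A : 'I_n -> set (measurableTypeR R)) :
  (forall i, measurable (A i)) ->
  measurable [set x : euclid R n | forall i, A i (tnth x i)].
Proof.
move=> mA; rewrite (_ : [set x | _] =
    \bigcap_(i in [set: 'I_n]) (fun x : euclid R n => tnth x i) @^-1` (A i)).
  apply: fin_bigcap_measurable => // i _; rewrite -[X in measurable X]setTI.
  exact: measurable_tnth.
by apply/seteqP; split => x /= h i => [_|]; [exact: h|exact: (h i I)].
Qed.

Lemma lebesgue_measure_tuple_box n (A : 'I_n -> set (measurableTypeR R)) :
  (forall i, measurable (A i)) ->
  lebesgue_measure_tuple n [set x | forall i, A i (tnth x i)] =
  (\prod_(i < n) lebesgue_measure (A i))%E.
Proof.
elim: n A => [|n ih] A mA.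
  rewrite big_ord0 (_ : [set x | _] = setT) /= ?diracT//.
  by apply/seteqP; split => // x _ [].
rewrite big_ord_recl -ih//= /lebesgue_measure_succ /pushforward.
rewrite -product_measure1E//; last first.
  exact: (@measurable_tuple_box n (fun i => A (lift ord0 i))).
congr (product_measure1 _ _ _).
apply/seteqP; split => -[a t] /= => [h|[h0 h] i].
  by split => [|i]; [exact: (h ord0)|have := h (lift ord0 i); rewrite tnthS].
by case: (unliftP ord0 i) => [j ->|->//]; rewrite tnthS; exact: h.
Qed.

Definition ocube (n : nat) : set (euclid R n) :=
  [set x | forall i, tnth x i \in `]0, 1[].

Arguments ocube : clear implicits.

Lemma measurable_ocube (n : nat) : measurable (ocube n).
Proof.
pose A (i : 'I_n) : set (measurableTypeR R) := `]0, 1[%classic.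
have mA i : measurable (A i) by exact: measurable_itv.
exact: (measurable_tuple_box mA).
Qed.

(* Lebesgue measure on the open unit cube: A |-> |A `&` (0, 1)^n|, so that
   [Lfun (lebesgue_ocube n) q%:E] is L_q((0, 1)^n). *)
Definition lebesgue_ocube (n : nat) : {measure set (euclid R n) -> \bar R} :=
  mrestr (lebesgue_measure_tuple n) (@measurable_ocube n).

End cube.
Arguments ocube {R} n.
Arguments lebesgue_ocube {R} n.

(* N^n with N = {1, 2, ...} *)
Notation mindex n := (n.-tuple {k : nat | (0 < k)%N}).

Definition mindex_le n (k m : mindex n) : Prop :=
  forall i, (val (tnth k i) <= val (tnth m i))%N.

(* The sums over [set k | mindex_le k m] below are finite-support sums, which
   are 0 by convention on infinite supports; this rules that case out. *)
Lemma finite_mindex_le n (m : mindex n) : finite_set [set k | mindex_le k m].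
Proof.
pose M := (\max_(i < n) val (tnth m i)).+1.
pose one : {k : nat | (0 < k)%N} := exist _ 1%N isT.
pose g (t : n.-tuple 'I_M) : mindex n :=
  [tuple insubd one (val (tnth t i)) | i < n].
apply: (@sub_finite_set _ _ (g @` setT)); last exact/finite_image/finite_finset.
move=> k /= km; have kM i : (val (tnth k i) < M)%N.
  by rewrite ltnS (leq_trans (km i))// leq_bigmax.
exists [tuple Ordinal (kM i) | i < n] => //.
apply: eq_from_tnth => i; rewrite !tnth_mktuple /=.
by apply/val_inj; rewrite val_insubd /= (valP (tnth k i)).
Qed.

(* min {m_1, ..., m_n} -> oo *)
Definition pringsheim (n : nat) : set_system (mindex n) :=
  filter_from [set: nat]
    (fun N => [set m | forall i, (N <= val (tnth m i))%N]).

Global Instance pringsheim_filter n : ProperFilter (@pringsheim n).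
Proof.
apply: filter_from_proper => [|N _].
  apply: filter_from_filter => [|N P _ _]; first by exists 0%N.
  exists (maxn N P) => // m NPm; split=> i;
    by rewrite (leq_trans _ (NPm i))// (leq_maxl, leq_maxr).
by exists [tuple exist _ N.+1 isT | i < n] => i /=; rewrite tnth_mktuple /=.
Qed.
Arguments pringsheim : clear implicits.

Section basis.
Context d {T : measurableType d} {R : realType}.
Variables (mu : {measure set T -> \bar R}) (q : R) (n : nat).
Variable e : mindex n -> T -> R.

Definition partial_sum (a : mindex n -> R) (m : mindex n) : T -> R :=
  fun x => \sum_(k \in [set k | mindex_le k m]) a k * e k x.

Definition pringsheim_expansion (f : T -> R) (a : mindex n -> R) : Prop :=
  ('N[mu]_(q%:E) [EFin \o (f \- partial_sum a m)%R]
    @[m --> pringsheim n] --> 0)%E.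

Definition pringsheim_schauder_basis : Prop :=
  (forall k, e k \in Lfun mu q%:E) /\
  (forall f, f \in Lfun mu q%:E -> exists! a, pringsheim_expansion f a).

End basis.

Section triangle.
Context {R : realType}.

Definition tent (t : R) : R := if t <= 2^-1 then 2 * t else 2 * (1 - t).

Definition triangle_wave (t : R) : R :=
  (-1) ^ Num.floor t * tent (t - (Num.floor t)%:~R).

Definition triangle_wave_prod n (k : mindex n) (x : euclid R n) : R :=
  \prod_(i < n) triangle_wave ((val (tnth k i))%:R * tnth x i).

End triangle.

(* Main.v *)
(* The triangle wave has the sine series S(x) = sum_i c_i sin(i pi x) with
   c_i = 8 sin(i pi / 2) / (i pi)^2, and c_1 exceeds sum_(i >= 2) |c_i|. Hence c
   has an absolutely summable Dirichlet inverse d: sin(l pi x) lies in the closed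
   span of the functions S_k(x) = S(k x), and the functions
   g_k = sum_(i j = k) 2 d_j sin(i pi x) are biorthogonal to the S_k. The partial
   sum operators are
     P_m f (x) = sum_(j <= m) d_j sum_i c_i (s_[m/j] f) (i j x),
   where s_N f is the N-th partial sum of the sine series of f. Dilations
   h |-> h(k x) preserve the L_q norm of odd 2-periodic functions, so the P_m are
   uniformly bounded as soon as the s_N are, which is M. Riesz's theorem; it is
   proved for 1 < q <= 2 by Stein's subharmonicity argument and for q > 2 by
   duality. In dimension n the operators P_m are tensor products, so their
   boundedness follows from the one-dimensional case by Fubini's theorem. A
   biorthogonal system with dense span and uniformly bounded rectangular
   projections is a basis in the Pringsheim sense. *)
Require Import Defs.
From mathcomp Require Import all_boot all_order all_algebra.
From mathcomp Require Import all_classical all_reals all_analysis.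
From mathcomp Require Import measurable_realfun.
From mathcomp Require Import ring lra zify.
Set Implicit Arguments.
Unset Strict Implicit.
Unset Printing Implicit Defensive.
Import Order.TTheory GRing.Theory Num.Theory.
Import numFieldNormedType.Exports.
Local Open Scope classical_set_scope.
Local Open Scope ring_scope.

(** * Stein's inequality for trigonometric sums *)

Section calculus_helpers.
Context {R : realType}.
Implicit Types (f g : R -> R) (a b x : R).

(** All estimates are made on finite sums, where integrands are continuous on [0, 1]; they reach L_q
    only at the end, by density, which works because for each fixed m the coefficient functionals of
    P_m are bounded on L_q, however badly. The sine series of S is never summed pointwise: it enters
    through convergence in L_q, deduced from orthogonality in L_2 and a uniform bound. The obstacle
    in M. Riesz's theorem: Stein's inequality compares a sum with its conjugate, for positive
    frequencies and under a boundary condition at both ends of [0, 1], whereas cutting at N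
    separates frequencies on the two sides of N. A shift by the half-integer N + 1/2 followed by a
    reflection keeps all frequencies positive and makes every cosine vanish at 1. That c_1 beats the
    other coefficients follows from |c_i| <= c_1 / i^2 and sum_(i >= 2) 1 / i^2 <= 3/4. The constant
    3/4 serves twice: it makes the Dirichlet inverse summable, and it is the factor by which the
    distance from a sine to the span of the dilates of S contracts in each round. *)

Lemma is_derive_continuous f df :
  (forall x, is_derive x 1 f (df x)) -> continuous f.
Proof.
by move=> fd x; apply: differentiable_continuous; apply/derivable1_diffP;
  have [] := fd x.
Qed.

Lemma continuous_integrable_itv f a b : continuous f ->
  (@lebesgue_measure R).-integrable `[a, b] (EFin \o f).
Proof.
move=> cf; apply: continuous_compact_integrable.
  exact: segment_compact.
exact: continuous_subspaceT.
Qed.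

Lemma Rintegral_derivative_itv f df a b : a < b -> continuous df ->
  (forall x, a <= x <= b -> is_derive x 1 f (df x)) ->
  \int[lebesgue_measure]_(x in `[a, b]) df x = f b - f a.
Proof.
move=> ab cdf fd.
have cf x : a <= x <= b -> {for x, continuous f}.
  by move=> /fd[df1 _]; apply: differentiable_continuous; exact/derivable1_diffP.
have fd' x : x \in `]a, b[ -> is_derive x 1 f (df x).
  by rewrite in_itv => /andP[/ltW ax /ltW xb]; apply: fd; rewrite ax.
rewrite /Rintegral (@continuous_FTC2 _ _ f)//.
- exact: continuous_subspaceT.
- split.
  + by move=> x /fd'[].
  + by apply: cvg_at_right_filter; apply: cf; rewrite lexx ltW.
  + by apply: cvg_at_left_filter; apply: cf; rewrite lexx ltW.
- by move=> x /fd'[_ <-]; rewrite derive1E.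
Qed.

Lemma Rintegral_derivative f df a b : a < b -> continuous df ->
  (forall x, is_derive x 1 f (df x)) ->
  \int[lebesgue_measure]_(x in `[a, b]) df x = f b - f a.
Proof. by move=> ab cdf fd; exact: Rintegral_derivative_itv. Qed.

Lemma Rintegral_contD f g a b : continuous f -> continuous g ->
  \int[lebesgue_measure]_(x in `[a, b]) (f x + g x) =
  \int[lebesgue_measure]_(x in `[a, b]) f x +
  \int[lebesgue_measure]_(x in `[a, b]) g x.
Proof. by move=> cf cg; apply: RintegralD => //; exact: continuous_integrable_itv. Qed.

Lemma Rintegral_contB f g a b : continuous f -> continuous g ->
  \int[lebesgue_measure]_(x in `[a, b]) (f x - g x) =
  \int[lebesgue_measure]_(x in `[a, b]) f x -
  \int[lebesgue_measure]_(x in `[a, b]) g x.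
Proof. by move=> cf cg; apply: RintegralB => //; exact: continuous_integrable_itv. Qed.

Lemma Rintegral_contZ f k a b : continuous f ->
  \int[lebesgue_measure]_(x in `[a, b]) (k * f x) =
  k * \int[lebesgue_measure]_(x in `[a, b]) f x.
Proof. by move=> cf; apply: RintegralZl => //; exact: continuous_integrable_itv. Qed.

Lemma le_Rintegral_cont f g a b : continuous f -> continuous g ->
  (forall x, a <= x <= b -> f x <= g x) ->
  \int[lebesgue_measure]_(x in `[a, b]) f x <=
  \int[lebesgue_measure]_(x in `[a, b]) g x.
Proof.
by move=> cf cg fg; apply: le_Rintegral => //; exact: continuous_integrable_itv.
Qed.

Lemma is_derive_powR f x df a : 0 < f x -> is_derive x 1 f df ->
  is_derive x 1 (fun y => f y `^ a) (a * f x `^ (a - 1) * df).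
Proof.
by move=> fx0 fd; exact: (is_derive1_comp (is_derive1_powR a fx0) fd).
Qed.

Lemma continuous_powR f a : (forall x, 0 < f x) -> continuous f ->
  continuous (fun x => f x `^ a).
Proof.
move=> f0 cf x.
apply: (@continuous_comp _ _ _ f (@powR R ^~ a)); first exact: cf.
by apply: differentiable_continuous; apply/derivable1_diffP;
  have [] := is_derive1_powR a (f0 x).
Qed.

End calculus_helpers.

Section continuous_combinators.
Context {R : realType}.
Implicit Types f g : R -> R.

Lemma continuous_funM f g : continuous f -> continuous g ->
  continuous (fun x => f x * g x).
Proof. by move=> cf cg x; exact: (@continuousM _ _ f g x (cf x) (cg x)). Qed.

Lemma continuous_funD f g : continuous f -> continuous g ->
  continuous (fun x => f x + g x).
Proof. by move=> cf cg x; exact: (@continuousD _ _ _ f g x (cf x) (cg x)). Qed.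

Lemma continuous_funN f : continuous f -> continuous (fun x => - f x).
Proof. by move=> cf x; exact: (@continuousN _ _ _ f x (cf x)). Qed.

Lemma continuous_funX f n : continuous f -> continuous (fun x => f x ^+ n).
Proof.
move=> cf; elim: n => [|n IHn]; first by move=> x; exact: cvg_cst.
have -> : (fun x => f x ^+ n.+1) = (fun x => f x * f x ^+ n).
  by apply/funext => x; rewrite exprS.
exact: continuous_funM.
Qed.

Lemma continuous_fun_cst (a : R) : continuous (fun _ : R => a).
Proof. by move=> x; exact: cvg_cst. Qed.

End continuous_combinators.

Lemma ler_powRN {R : realType} (a x y : R) :
  a <= 0 -> 0 < x -> x <= y -> y `^ a <= x `^ a.
Proof.
move=> a0 x0 xy; have y0 := lt_le_trans x0 xy.
rewrite -[a]opprK powRN [x `^ _]powRN lef_pV2 ?posrE ?powR_gt0//.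
by rewrite ge0_ler_powR ?oppr_ge0// nnegrE ltW.
Qed.

(** Exponentials of positive rate are bounded on such a half-line; ending it at 1 rather than 0
    leaves a neighbourhood of [t = 0], the point where the inequality is finally read off. *)
Definition bounded_before {R : realType} (f : R -> R -> R) :=
  exists K, forall t x : R, t < 1 -> `|f t x| <= K.

Section bounded_before.
Context {R : realType}.
Implicit Types f g : R -> R -> R.

Lemma bounded_beforeM f g : bounded_before f -> bounded_before g ->
  bounded_before (fun t x => f t x * g t x).
Proof.
move=> [K fK] [L gL]; exists (K * L) => t x t1.
by rewrite normrM ler_pM ?fK ?gL.
Qed.

Lemma bounded_beforeD f g : bounded_before f -> bounded_before g ->
  bounded_before (fun t x => f t x + g t x).
Proof.
move=> [K fK] [L gL]; exists (K + L) => t x t1.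
by rewrite (le_trans (ler_normD _ _))// lerD ?fK ?gL.
Qed.

Lemma bounded_beforeN f : bounded_before f ->
  bounded_before (fun t x => - f t x).
Proof. by move=> [K fK]; exists K => t x t1; rewrite normrN fK. Qed.

Lemma bounded_before_cst (a : R) : bounded_before (fun _ _ => a).
Proof. by exists `|a|. Qed.

End bounded_before.

Lemma is_derive_Rintegral_itv {R : realType} (f ft : R -> R -> R) :
  (forall t, continuous (f t)) ->
  (forall t x : R, is_derive t 1 (f^~ x) (ft t x)) ->
  bounded_before ft ->
  forall t : R, t < 1 ->
  is_derive t 1 (fun t : R => \int[lebesgue_measure]_(x in `[0, 1]) f t x)
    (\int[lebesgue_measure]_(x in `[0, 1]) ft t x).
Proof.
move=> cf fd [K ftK] t t1.
have dfE x y : partial1of2 f x y = ft x y.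
  by rewrite partial1of2E; have [] := fd x y.
have K0 : 0 <= K by rewrite (le_trans _ (ftK t 0 t1)).
have I01 : `]t - 1, 1[%classic t by rewrite /= in_itv/= t1 andbT ltrBlDr ltrDl.
have intK : lebesgue_measure.-integrable `[0, 1] (EFin \o cst K : R -> \bar R).
  by apply: continuous_integrable_itv => x; exact: cvg_cst.
have intf (x : R) : `]t - 1, 1[%classic x ->
    lebesgue_measure.-integrable `[0, 1] (EFin \o f x).
  by move=> _; exact: continuous_integrable_itv.
have derf (x y : R) : `]t - 1, 1[%classic x -> `[0%R, 1%R]%classic y ->
    derivable (f^~ y) x 1.
  by move=> _ _; have [] := fd x y.
have ub (x y : R) : `]t - 1, 1[%classic x -> `[0%R, 1%R]%classic y ->
    `|partial1of2 f x y| <= cst K y.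
  by rewrite /= in_itv/= => /andP[_ x1] _; rewrite dfE ftK.
have mI : measurable (`[0%R, 1%R] : set (measurableTypeR R)).
  exact: measurable_itv.
apply: DeriveDef.
  exact: (derivable_under_integral mI I01 intf derf (fun=> K0) intK ub).
rewrite -derive1E.
rewrite (differentiation_under_integral mI I01 intf derf (fun=> K0) intK ub).
by apply: eq_Rintegral => x _; rewrite dfE.
Qed.

Lemma lt_norm_subr {R : realDomainType} (K a b : R) :
  `|a| <= K -> `|b| <= K -> ~ (a - b <= - (2 * K + 1)).
Proof. by rewrite !ler_norml => /andP[? ?] /andP[? ?] ?; lra. Qed.

Section stein.
Context {R : realType}.
Variables (s e : R).
Hypotheses (s_gt : 2^-1 < s) (s_le1 : s <= 1) (e_gt0 : 0 < e).
(** [u1], [v1] and [u2], [v2] are the first and second [t]-derivatives of a holomorphic [u + i v];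
    the hypotheses on the [x]-derivatives are the Cauchy-Riemann equations. *)
Variables u v u1 v1 u2 v2 : R -> R -> R.
Hypothesis ut : forall t x : R, is_derive t 1 (u^~ x) (u1 t x).
Hypothesis vt : forall t x : R, is_derive t 1 (v^~ x) (v1 t x).
Hypothesis u1t : forall t x : R, is_derive t 1 (u1^~ x) (u2 t x).
Hypothesis v1t : forall t x : R, is_derive t 1 (v1^~ x) (v2 t x).
Hypothesis ux : forall t x : R, is_derive x 1 (u t) (- v1 t x).
Hypothesis vx : forall t x : R, is_derive x 1 (v t) (u1 t x).
Hypothesis u1x : forall t x : R, is_derive x 1 (u1 t) (- v2 t x).
Hypothesis v1x : forall t x : R, is_derive x 1 (v1 t) (u2 t x).
Hypothesis cu2 : forall t, continuous (u2 t).
Hypothesis cv2 : forall t, continuous (v2 t).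

Hypothesis bu : bounded_before u.
Hypothesis bv : bounded_before v.
Hypothesis bu1 : bounded_before u1.
Hypothesis bv1 : bounded_before v1.
Hypothesis bu2 : bounded_before u2.
Hypothesis bv2 : bounded_before v2.

Section power.
Variable c : R.
Hypothesis c_ge0 : 0 <= c.

Let Z t x := u t x ^+ 2 + c * v t x ^+ 2 + e.
Let Zt t x := 2 * (u t x * u1 t x + c * (v t x * v1 t x)).
Let Zx t x := 2 * (c * (v t x * u1 t x) - u t x * v1 t x).
Let Ztt t x := 2 * (u1 t x ^+ 2 + u t x * u2 t x
  + c * (v1 t x ^+ 2 + v t x * v2 t x)).
Let Zxx t x := 2 * (v1 t x ^+ 2 - u t x * u2 t x
  + c * (u1 t x ^+ 2 - v t x * v2 t x)).

Let Z_ge t x : e <= Z t x.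
Proof. by rewrite /Z lerDr addr_ge0 ?sqr_ge0 // mulr_ge0 ?sqr_ge0. Qed.

Let Z_gt0 t x : 0 < Z t x. Proof. exact: lt_le_trans (Z_ge t x). Qed.

(** The cases [c = 0] and [c = 1] are the two terms of Stein's function, so one computation serves
    both. The shift by [e] keeps the base away from 0: the power stays smooth where [u] and [v]
    vanish, and its negative powers stay bounded. *)
Definition reg_pow t x := Z t x `^ s.
Definition reg_pow_t t x := s * Z t x `^ (s - 1) * Zt t x.
Definition reg_pow_x t x := s * Z t x `^ (s - 1) * Zx t x.
Definition reg_pow_tt t x :=
  s * ((s - 1) * Z t x `^ (s - 1 - 1) * Zt t x ^+ 2 + Z t x `^ (s - 1) * Ztt t x).
Definition reg_pow_xx t x :=
  s * ((s - 1) * Z t x `^ (s - 1 - 1) * Zx t x ^+ 2 + Z t x `^ (s - 1) * Zxx t x).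

Let dZt (t x : R) : is_derive t 1 (Z^~ x) (Zt t x).
Proof.
have := (ut t x, vt t x) => -[??].
by apply: is_derive_eq; rewrite /Zt /GRing.scale /=; ring.
Qed.

Let dZx (t x : R) : is_derive x 1 (Z t) (Zx t x).
Proof.
have := (ux t x, vx t x) => -[??].
by apply: is_derive_eq; rewrite /Zx /GRing.scale /=; ring.
Qed.

Let dZtt (t x : R) : is_derive t 1 (Zt^~ x) (Ztt t x).
Proof.
have := (ut t x, vt t x, u1t t x, v1t t x) => -[[[????]]].
by apply: is_derive_eq; rewrite /Ztt /GRing.scale /=; ring.
Qed.

Let dZxx (t x : R) : is_derive x 1 (Zx t) (Zxx t x).
Proof.
have := (ux t x, vx t x, u1x t x, v1x t x) => -[[[????]]].
by apply: is_derive_eq; rewrite /Zxx /GRing.scale /=; ring.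
Qed.

Lemma reg_pow_derive_t (t x : R) : is_derive t 1 (reg_pow^~ x) (reg_pow_t t x).
Proof. by have := @is_derive_powR R (Z^~ x) t _ s (Z_gt0 t x) (dZt t x). Qed.

Lemma reg_pow_derive_x (t x : R) : is_derive x 1 (reg_pow t) (reg_pow_x t x).
Proof. by have := @is_derive_powR R (Z t) x _ s (Z_gt0 t x) (dZx t x). Qed.

Lemma reg_pow_derive_tt (t x : R) :
  is_derive t 1 (reg_pow_t^~ x) (reg_pow_tt t x).
Proof.
have := (@is_derive_powR R (Z^~ x) t _ (s - 1) (Z_gt0 t x) (dZt t x), dZtt t x) => -[??].
by apply: is_derive_eq; rewrite /reg_pow_tt /GRing.scale /=; ring.
Qed.

Lemma reg_pow_derive_xx (t x : R) :
  is_derive x 1 (reg_pow_x t) (reg_pow_xx t x).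
Proof.
have := (@is_derive_powR R (Z t) x _ (s - 1) (Z_gt0 t x) (dZx t x), dZxx t x) => -[??].
by apply: is_derive_eq; rewrite /reg_pow_xx /GRing.scale /=; ring.
Qed.

Let cst a := @continuous_fun_cst R a.
Let cu t : continuous (u t). Proof. exact: is_derive_continuous (ux t). Qed.
Let cv t : continuous (v t). Proof. exact: is_derive_continuous (vx t). Qed.
Let cu1 t : continuous (u1 t). Proof. exact: is_derive_continuous (u1x t). Qed.
Let cv1 t : continuous (v1 t). Proof. exact: is_derive_continuous (v1x t). Qed.
Let cZ a t : continuous (fun x => Z t x `^ a).
Proof. exact: continuous_powR (Z_gt0 t) (is_derive_continuous (dZx t)). Qed.
Local Notation cM := continuous_funM.
Local Notation cD := continuous_funD.
Local Notation cN := continuous_funN.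
Local Notation cX := (@continuous_funX R _ 2).

Lemma reg_pow_xx_continuous t : continuous (reg_pow_xx t).
Proof.
apply: cM (@cst _) _; apply: cD.
  apply: cM (cM (@cst _) (@cZ _ t)) (cX (cM (@cst _) _)).
  exact: cD (cM (@cst _) (cM (@cv t) (@cu1 t))) (cN (cM (@cu t) (@cv1 t))).
apply: cM (@cZ _ t) (cM (@cst _) _).
apply: cD (cD (cX (@cv1 t)) (cN (cM (@cu t) (@cu2 t)))) (cM (@cst _) _).
exact: cD (cX (@cu1 t)) (cN (cM (@cv t) (@cv2 t))).
Qed.

Let cZt t : continuous (Zt t).
Proof.
apply: cM (@cst _) (cD (cM (@cu t) (@cu1 t)) _).
exact: cM (@cst _) (cM (@cv t) (@cv1 t)).
Qed.

Lemma reg_pow_continuous t : continuous (reg_pow t).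
Proof. exact: is_derive_continuous (reg_pow_derive_x t). Qed.

Lemma reg_pow_t_continuous t : continuous (reg_pow_t t).
Proof. exact: cM (cM (@cst _) (@cZ _ t)) (@cZt t). Qed.

Lemma reg_pow_tt_continuous t : continuous (reg_pow_tt t).
Proof.
apply: cM (@cst _) (cD (cM (cM (@cst _) (@cZ _ t)) (cX (@cZt t))) (cM (@cZ _ t) (cM (@cst _) _))).
apply: cD (cD (cX (@cu1 t)) (cM (@cu t) (@cu2 t))) (cM (@cst _) _).
exact: cD (cX (@cv1 t)) (cM (@cv t) (@cv2 t)).
Qed.

Let bZ a : a <= 0 -> bounded_before (fun t x => Z t x `^ a).
Proof.
move=> a0; exists (e `^ a) => t x _.
by rewrite ger0_norm ?powR_ge0// ler_powRN.
Qed.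

Let bZt : bounded_before Zt.
Proof.
apply: bounded_beforeM (bounded_before_cst _) _.
apply: bounded_beforeD; first exact: bounded_beforeM.
by apply: bounded_beforeM (bounded_before_cst _) _; exact: bounded_beforeM.
Qed.

Let bZtt : bounded_before Ztt.
Proof.
apply: bounded_beforeM (bounded_before_cst _) _.
apply: bounded_beforeD.
  by apply: bounded_beforeD; exact: bounded_beforeM.
apply: bounded_beforeM (bounded_before_cst _) _.
by apply: bounded_beforeD; exact: bounded_beforeM.
Qed.

Lemma reg_pow_bounded : bounded_before reg_pow.
Proof.
have [K Kuv] : bounded_before Z.
  apply: bounded_beforeD (bounded_before_cst _).
  apply: bounded_beforeD; first exact: bounded_beforeM.
  by apply: bounded_beforeM (bounded_before_cst _) _; exact: bounded_beforeM.
exists (K `^ s) => t x t1; rewrite ger0_norm ?powR_ge0//.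
have /le_trans := ler_norm (Z t x) => /(_ _ (Kuv t x t1)) ZK.
rewrite ge0_ler_powR ?nnegrE ?(ltW (Z_gt0 _ _))//.
  by rewrite (le_trans _ (ltW s_gt)).
by rewrite (le_trans _ ZK) ?ltW.
Qed.

Let s1_le0 : s - 1 <= 0. Proof. by rewrite subr_le0. Qed.

Lemma reg_pow_t_bounded : bounded_before reg_pow_t.
Proof.
apply: bounded_beforeM bZt; apply: bounded_beforeM (bounded_before_cst _) _.
exact: bZ.
Qed.

Lemma reg_pow_tt_bounded : bounded_before reg_pow_tt.
Proof.
apply: bounded_beforeM (bounded_before_cst _) _; apply: bounded_beforeD.
  apply: bounded_beforeM; last exact: bounded_beforeM.
  apply: bounded_beforeM (bounded_before_cst _) _; apply: bZ.
  by rewrite subr_le0 (le_trans s1_le0).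
by apply: bounded_beforeM bZtt; exact: bZ.
Qed.

End power.

Hypothesis boundary : forall t x : R, (x = 0) \/ (x = 1) ->
  u t x * v1 t x = 0 /\ v t x * u1 t x = 0.
Hypothesis decay : forall eta, 0 < eta ->
  exists2 t0 : R, t0 < 0 & forall t x, t <= t0 -> u t x ^+ 2 + v t x ^+ 2 <= eta.

(** The value with [A * (4 * s - 2) = 4], which balances the two Laplacians below. *)
Let A := 2 / (2 * s - 1).

(* Stein's method: [u + i v] is a holomorphic function of [t + i x], and
   [W = A (u^2 + e)^s - (u^2 + v^2 + e)^s] is subharmonic. Since [W_x] vanishes
   at the ends of [0, 1], [M t = \int_0^1 W t x dx] is convex; being bounded
   on the left half-line it is nondecreasing, and [W >= 0] far to the left. *)
Let W t x := A * reg_pow 0 t x - reg_pow 1 t x.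
Let Wt t x := A * reg_pow_t 0 t x - reg_pow_t 1 t x.
Let Wtt t x := A * reg_pow_tt 0 t x - reg_pow_tt 1 t x.
Let Wx t x := A * reg_pow_x 0 t x - reg_pow_x 1 t x.
Let Wxx t x := A * reg_pow_xx 0 t x - reg_pow_xx 1 t x.

Let A_ge2 : 2 <= A.
Proof.
rewrite /A ler_pdivlMr; last by rewrite subr_gt0 mulrC -ltr_pdivrMr ?div1r.
by have := s_le1; lra.
Qed.

Let A_ge0 : 0 <= A. Proof. exact: le_trans A_ge2. Qed.

(** Let D = |F'|^2 for the holomorphic F = u + i v. The Laplacian of [Z1 ^ s] is at most 4 s D
    Z1^(s-1), after dropping the term with factor s - 1 <= 0, hence at most 4 s D Z0^(s-1) because
    Z0 <= Z1. That of [Z0 ^ s] is at least s (4 s - 2) D Z0^(s-1), because u^2 <= Z0. The factor [A]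
    closes the gap. *)
Let laplacian_ge0 t x : 0 <= Wtt t x + Wxx t x.
Proof.
rewrite /Wtt /Wxx /reg_pow_tt /reg_pow_xx.
set Z0 := u t x ^+ 2 + 0 * _ + e; set Z1 := u t x ^+ 2 + 1 * _ + e.
have Z0_gt0 : 0 < Z0 by rewrite /Z0 mul0r addr0 ltr_wpDl ?sqr_ge0.
have Z01 : Z0 <= Z1 by rewrite lerD2r lerD2l mul0r mul1r sqr_ge0.
have Z1_gt0 := lt_le_trans Z0_gt0 Z01.
have QE (z : R) : 0 < z -> z `^ (s - 1) = z * z `^ (s - 1 - 1).
  move=> z0; rewrite -[in RHS](powRr1 (ltW z0)) -powRrM mul1r -powRD.
    by rewrite subrKC.
  by rewrite (gt_eqF z0) implybT.
have Q01 : Z1 * Z1 `^ (s - 1 - 1) <= Z0 * Z0 `^ (s - 1 - 1).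
  by rewrite -!QE// ler_powRN// subr_le0.
rewrite !QE//.
have P0 := powR_ge0 Z0 (s - 1 - 1); have P1 := powR_ge0 Z1 (s - 1 - 1).
move: (Z0 `^ _) (Z1 `^ _) P0 P1 Q01 => P Q P0 Q0 PQ.
set D := u1 t x ^+ 2 + v1 t x ^+ 2.
have D0 : 0 <= D by rewrite addr_ge0 ?sqr_ge0.
have AE : A * (4 * s - 2) = 4.
  by rewrite /A; field; rewrite gt_eqF// subr_gt0 mulrC -ltr_pdivrMr ?div1r.
have s0 : 0 <= s by rewrite (le_trans _ (ltW s_gt)).
rewrite [leRHS](_ : _ = A * (s * (P * D * (4 * (s - 1) * u t x ^+ 2 + 2 * Z0))) -
   s * (Q * D * (4 * (s - 1) * (u t x ^+ 2 + v t x ^+ 2) + 4 * Z1))); last first.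
  by rewrite /D /Z0 /Z1; ring.
rewrite subr_ge0.
apply: (@le_trans _ _ (s * (D * (4 * (Z1 * Q))))).
  rewrite ler_wpM2l// [leLHS](_ : _ = Q * D * 4 * Z1 -
    Q * D * 4 * ((1 - s) * (u t x ^+ 2 + v t x ^+ 2))); last by ring.
  rewrite [leRHS](_ : _ = Q * D * 4 * Z1) ?gerBl; last by ring.
  by rewrite !mulr_ge0// ?subr_ge0// addr_ge0 ?sqr_ge0.
apply: (@le_trans _ _ (s * (D * (4 * (Z0 * P))))).
  by rewrite ler_wpM2l// ler_wpM2l// ler_wpM2l.
rewrite [leRHS]mulrCA ler_wpM2l//.
rewrite -[X in D * (X * _)]AE [leLHS](_ : _ = A * (P * D * ((4 * s - 2) * Z0)));
  last by ring.
rewrite ler_wpM2l// ler_wpM2l ?mulr_ge0//.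
rewrite -subr_ge0 [leRHS](_ : _ = 4 * (1 - s) * (Z0 - u t x ^+ 2)); last by ring.
by rewrite mulr_ge0 ?mulr_ge0 ?subr_ge0// /Z0 mul0r addr0 lerDl ltW.
Qed.

Local Notation "\int01 f" := (\int[lebesgue_measure]_(x in `[0, 1]) f x)
  (at level 10, f at level 9).

Let c01 : (0 <= 0 :> R) * (0 <= 1 :> R). Proof. by []. Qed.

Let lincombW (h : R -> R -> R -> R) t : (forall c, 0 <= c -> continuous (h c t)) ->
  continuous (fun x => A * h 0 t x - h 1 t x).
Proof.
move=> ch; apply: continuous_funD (continuous_funN (ch 1 c01.2)).
exact: continuous_funM (@continuous_fun_cst R A) (ch 0 c01.1).
Qed.

Let boundedW (h : R -> R -> R -> R) : (forall c, 0 <= c -> bounded_before (h c)) ->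
  bounded_before (fun t x => A * h 0 t x - h 1 t x).
Proof.
move=> bh; apply: bounded_beforeD (bounded_beforeN (bh 1 c01.2)).
exact: bounded_beforeM (bounded_before_cst A) (bh 0 c01.1).
Qed.

Let cW t : continuous (W t).
Proof. by apply: lincombW => c c0; exact: reg_pow_continuous. Qed.

Let cWt t : continuous (Wt t).
Proof. by apply: lincombW => c c0; exact: reg_pow_t_continuous. Qed.

Let cWtt t : continuous (Wtt t).
Proof. by apply: lincombW => c c0; exact: reg_pow_tt_continuous. Qed.

Let cWxx t : continuous (Wxx t).
Proof. by apply: lincombW => c c0; exact: reg_pow_xx_continuous. Qed.

Let dWt (t x : R) : is_derive t 1 (W^~ x) (Wt t x).
Proof.
have := (reg_pow_derive_t c01.1 t x, reg_pow_derive_t c01.2 t x) => -[? ?].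
by apply: is_derive_eq; rewrite /Wt /GRing.scale /=; ring.
Qed.

Let dWtt (t x : R) : is_derive t 1 (Wt^~ x) (Wtt t x).
Proof.
have := (reg_pow_derive_tt c01.1 t x, reg_pow_derive_tt c01.2 t x) => -[? ?].
by apply: is_derive_eq; rewrite /Wtt /GRing.scale /=; ring.
Qed.

Let dWxx (t x : R) : is_derive x 1 (Wx t) (Wxx t x).
Proof.
have := (reg_pow_derive_xx c01.1 t x, reg_pow_derive_xx c01.2 t x) => -[? ?].
by apply: is_derive_eq; rewrite /Wxx /GRing.scale /=; ring.
Qed.

Let bWt : bounded_before Wt.
Proof. by apply: boundedW => c c0; exact: reg_pow_t_bounded. Qed.

Let bWtt : bounded_before Wtt.
Proof. by apply: boundedW => c c0; exact: reg_pow_tt_bounded. Qed.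

Let bW : bounded_before W.
Proof. by apply: boundedW => c c0; exact: reg_pow_bounded. Qed.

Let M t := \int01 (W t).
Let N t := \int01 (Wt t).

Let dM (t : R) : t < 1 -> is_derive t 1 M (N t).
Proof. exact: is_derive_Rintegral_itv. Qed.

Let dN (t : R) : t < 1 -> is_derive t 1 N (\int01 (Wtt t)).
Proof. exact: is_derive_Rintegral_itv. Qed.

Let intWxx t : \int01 (Wxx t) = 0.
Proof.
rewrite (Rintegral_derivative ltr01 (@cWxx t) (dWxx t)).
have W0 x : x = 0 \/ x = 1 -> Wx t x = 0.
  move=> /(boundary t)[uv vu].
  by rewrite /Wx /reg_pow_x uv vu !mulr0 subr0 !mulr0 subr0.
by rewrite !W0 ?subr0; [by []|by left|by right].
Qed.

Let intWtt_ge0 t : 0 <= \int01 (Wtt t).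
Proof.
suff -> : \int01 (Wtt t) = \int01 (fun x => Wtt t x + Wxx t x).
  by apply: Rintegral_ge0 => x _; exact: laplacian_ge0.
by rewrite (Rintegral_contD _ _ (@cWtt t) (@cWxx t)) intWxx addr0.
Qed.

Let cM (a b : R) : b < 1 -> {within `[a, b], continuous M}.
Proof.
move=> b1; apply: derivable_within_continuous => x; rewrite in_itv/=.
by move=> /andP[_ /le_lt_trans/(_ b1)] /dM[].
Qed.

Let N_ndecr (a b : R) : a <= b -> b < 1 -> N a <= N b.
Proof.
move=> ab b1.
apply: (@ger0_derive1_ndecr _ N a b) => // [x|x|].
- by rewrite in_itv/= => /andP[_ /lt_trans/(_ b1)] /dN[].
- rewrite in_itv/= => /andP[_ /lt_trans/(_ b1)] /dN[_].
  by rewrite derive1E => ->.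
- apply: derivable_within_continuous => x; rewrite in_itv/=.
  by move=> /andP[_ /le_lt_trans/(_ b1)] /dN[].
Qed.

Let M_bounded : exists K : R, forall t : R, t < 1 -> `|M t| <= K.
Proof.
have [K WK] := bW; exists K => t t1.
rewrite (le_trans (le_normr_Rintegral _ _))//.
  exact: continuous_integrable_itv.
rewrite (@le_trans _ _ (\int[lebesgue_measure]_(x in `[0, 1]) K))//.
  apply: le_Rintegral => //.
  - apply: (@continuous_integrable_itv _ (fun x => `|W t x|)) => x.
    by apply: (@continuous_comp _ _ _ (W t)); [exact: cW|exact: norm_continuous].
  - by apply: continuous_integrable_itv; exact: continuous_fun_cst.
  - by move=> x _; exact: WK.
by rewrite Rintegral_cst//= lebesgue_measure_itv/= lte_fin ltr01 oppr0 adde0 mulr1.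
Qed.

(** [N] is nondecreasing, so a negative value would persist to the left and make [M] unbounded
    there. *)
Let N_ge0 (t : R) : t < 1 -> 0 <= N t.
Proof.
move=> t1; rewrite leNgt; apply/negP => Nt0.
have [K MK] := M_bounded.
have K0 : 0 <= K by rewrite (le_trans _ (MK t t1)).
(* Over this length [M] would drop by at least [2 * K + 1], more than a function bounded by [K]
   can. *)
pose h := (2 * K + 1) / (- N t).
have h0 : 0 < h by rewrite divr_gt0 ?oppr_gt0// ltr_wpDl// mulr_ge0.
have tht : t - h < t by rewrite ltrBlDr ltrDl.
have [c + Mc] : exists2 c, c \in `]t - h, t[ & M t - M (t - h) = N c * (t - (t - h)).
  apply: MVT => // [x|]; last exact: cM.
  by rewrite in_itv/= => /andP[_ /lt_trans/(_ t1)]; exact: dM.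
rewrite in_itv/= => /andP[_ ct].
have : M t - M (t - h) <= N t * h.
  rewrite Mc (_ : t - (t - h) = h); last by ring.
  by apply: ler_wpM2r (ltW h0) _ _ _; apply: N_ndecr => //; exact: ltW.
have -> : N t * h = - (2 * K + 1).
  by rewrite /h invrN mulrN mulrN mulrCA divff ?lt_eqF// mulr1.
by move=> /(lt_norm_subr (MK _ t1) (MK _ (lt_trans tht t1))).
Qed.

(** Far to the left u^2 + v^2 <= e, so the second power is at most (2 e)^s <= 2 e^s, and 2 <= A. *)
Let M_ge0_near : exists2 t0 : R, t0 < 0 & 0 <= M t0.
Proof.
have [t0 t00 ht0] := decay e_gt0; exists t0 => //.
have e0 := ltW e_gt0; have s0 : 0 <= s by rewrite (le_trans _ (ltW s_gt)).
apply: Rintegral_ge0 => x _; rewrite /W subr_ge0 /reg_pow.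
rewrite mul0r addr0 mul1r (@le_trans _ _ ((2 * e) `^ s))//.
  rewrite ge0_ler_powR ?nnegrE ?mulr_ge0 ?addr_ge0 ?sqr_ge0//.
  by rewrite mulr_natl mulr2n lerD2r ht0.
rewrite powRM// ler_pM ?powR_ge0//.
  by rewrite (le_trans _ A_ge2)// -[leRHS]powRr1 // ler_powR// ler1n.
by rewrite ge0_ler_powR ?nnegrE ?addr_ge0 ?sqr_ge0// lerDr sqr_ge0.
Qed.

Lemma stein_regularized :
  \int[lebesgue_measure]_(x in `[0, 1]) (u 0 x ^+ 2 + v 0 x ^+ 2 + e) `^ s <=
  A * \int[lebesgue_measure]_(x in `[0, 1]) (u 0 x ^+ 2 + e) `^ s.
Proof.
have [t0 t00 Mt0] := M_ge0_near.
have : 0 <= M 0.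
  apply: le_trans Mt0 _.
  apply: (@ger0_derive1_ndecr _ M t0 0) => //; last 2 first.
  - exact: cM.
  - exact: ltW.
  - move=> x; rewrite in_itv/= => /andP[_ /lt_trans/(_ ltr01) x1].
    by have [] := dM x1.
  - move=> x; rewrite in_itv/= => /andP[_ /lt_trans/(_ ltr01) x1].
    by rewrite derive1E; have [_ ->] := dM x1; exact: N_ge0.
have creg0 := reg_pow_continuous (t := 0) c01.1.
have creg1 := reg_pow_continuous (t := 0) c01.2.
rewrite /M (Rintegral_contB _ _ (continuous_funM (@continuous_fun_cst _ A) creg0)
  creg1) (Rintegral_contZ _ _ _ creg0).
rewrite subr_ge0 /reg_pow.
under eq_Rintegral do rewrite mul1r.
congr (_ <= A * _); apply: eq_Rintegral => x _.
by rewrite mul0r addr0.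
Qed.

End stein.

Lemma is_derive_sum_fun {R : realType} (n : nat) (h : nat -> R -> R)
    (dh : nat -> R) (x : R) :
  (forall k, is_derive x 1 (h k) (dh k)) ->
  is_derive x 1 (fun y => \sum_(k < n) h k y) (\sum_(k < n) dh k).
Proof.
move=> hd; rewrite (_ : (fun y => _) = \sum_(k < n) h k); last first.
  by apply/funext => y; rewrite fct_sumE.
by apply: is_derive_sum => i.
Qed.

Lemma continuous_normr_powR {R : realType} (f : R -> R) (a : R) : 0 < a ->
  continuous f -> continuous (fun x => `|f x| `^ a).
Proof.
move=> a0 cf x.
have cnf : {for x, continuous (fun x => `|f x|)}.
  by apply: (@continuous_comp _ _ _ f); [exact: cf|exact: norm_continuous].
have [fx0|fx0] := eqVneq (f x) 0; last first.
  apply: (@continuous_comp _ _ _ (fun x => `|f x|) (@powR R ^~ a)) => //.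
  apply: differentiable_continuous; apply/derivable1_diffP.
  by have [] := @is_derive1_powR _ a `|f x| _; rewrite ?normr_gt0.
apply/cvgrPdist_lt => /= e e0; rewrite fx0 normr0 powR0 ?gt_eqF//.
have e1 : 0 < e `^ a^-1 by rewrite powR_gt0.
have /cvgrPdist_lt/(_ _ e1) := cf x.
apply: filterS => y; rewrite fx0 !sub0r !normrN => fy.
rewrite ger0_norm ?powR_ge0// -[ltRHS]powRr1 ?ltW//.
rewrite -(mulVf (lt0r_neq0 a0)) powRrM.
by rewrite gt0_ltr_powR ?nnegrE ?powR_ge0.
Qed.

Lemma normr_powR_sqr {R : realType} (x p : R) : `|x| `^ p = (x ^+ 2) `^ (p / 2).
Proof.
rewrite -(real_normK (num_real x)) -powR_mulrn// -powRrM mulrCA divff ?mulr1//.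
Qed.

Lemma continuous_sqr_powR {R : realType} (f g : R -> R) (a : R) : 0 < a ->
  continuous f -> continuous g -> continuous (fun x => (f x ^+ 2 + g x ^+ 2) `^ a).
Proof.
move=> a0 cf cg.
rewrite (_ : (fun x => _) = fun x => `|f x ^+ 2 + g x ^+ 2| `^ a).
  apply: continuous_normr_powR => //; apply: continuous_funD;
  exact: continuous_funX.
by apply/funext => x; rewrite ger0_norm ?addr_ge0 ?sqr_ge0.
Qed.

Lemma powRD_le {R : realType} (a x y : R) : 0 < a <= 1 -> 0 <= x -> 0 <= y ->
  (x + y) `^ a <= x `^ a + y `^ a.
Proof.
move=> /andP[a0 a1]; rewrite le_eqVlt => /predU1P[<-|x0].
  by rewrite add0r powR0 ?add0r ?gt_eqF.
rewrite le_eqVlt => /predU1P[<-|y0].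
  by rewrite addr0 powR0 ?addr0 ?gt_eqF.
have xy0 : 0 < x + y by rewrite addr_gt0.
(* A ratio r in ]0, 1] satisfies r <= r^a; the ratios for [x] and [y] add up to 1. *)
have h (z : R) : 0 < z -> z <= x + y -> z / (x + y) * (x + y) `^ a <= z `^ a.
  move=> z0 zxy; rewrite -[X in _ <= X `^ a](@divfK _ (x + y)) ?gt_eqF//.
  rewrite powRM ?divr_ge0 ?(ltW xy0) ?(ltW z0)//.
  rewrite ler_wpM2r ?powR_ge0// ger1_powR// divr_gt0//=.
  by rewrite ler_pdivrMr// mul1r.
rewrite (le_trans _ (lerD (h _ x0 _) (h _ y0 _)))//; last 2 first.
- by rewrite lerDl ltW.
- by rewrite lerDr ltW.
by rewrite -mulrDl -mulrDl divff ?mul1r// gt_eqF.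
Qed.

Section trig_sums.
Context {R : realType}.
Variables (n : nat) (c lam : nat -> R) (ph : R).
Hypothesis lam_gt0 : forall k, 0 < lam k.

(** [U j + i V j] is the [j]-th derivative of the holomorphic function sum_k c_k exp(lam_k z + i ph)
    of z = t + i x. *)
Let cosT j k t x := c k * lam k ^+ j * (expR (lam k * t) * cos (lam k * x + ph)).
Let sinT j k t x := c k * lam k ^+ j * (expR (lam k * t) * sin (lam k * x + ph)).
Let U j t x := \sum_(k < n) cosT j k t x.
Let V j t x := \sum_(k < n) sinT j k t x.

Let dlin (a b y : R) : is_derive y 1 (fun y => a * y + b) a.
Proof. by apply: is_derive_eq; rewrite /GRing.scale /=; ring. Qed.

Let dexp (a t : R) : is_derive t 1 (fun t => expR (a * t)) (expR (a * t) * a).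
Proof.
apply: (@is_derive1_comp _ expR (fun t => a * t)).
by apply: is_derive_eq; rewrite /GRing.scale /=; ring.
Qed.

Let dcos (a b x : R) :
  is_derive x 1 (fun x => cos (a * x + b)) (- sin (a * x + b) * a).
Proof. exact: (@is_derive1_comp _ cos (fun x => a * x + b)). Qed.

Let dsin (a b x : R) :
  is_derive x 1 (fun x => sin (a * x + b)) (cos (a * x + b) * a).
Proof. exact: (@is_derive1_comp _ sin (fun x => a * x + b)). Qed.

Let dUt j (t x : R) : is_derive t 1 ((U j)^~ x) (U j.+1 t x).
Proof.
apply: (@is_derive_sum_fun _ n (fun k t => cosT j k t x) (fun k => cosT j.+1 k t x)) => k.
have := dexp (lam k) t => ?.
by apply: is_derive_eq; rewrite /cosT /sinT /GRing.scale /= exprS; ring.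
Qed.

Let dVt j (t x : R) : is_derive t 1 ((V j)^~ x) (V j.+1 t x).
Proof.
apply: (@is_derive_sum_fun _ n (fun k t => sinT j k t x) (fun k => sinT j.+1 k t x)) => k.
have := dexp (lam k) t => ?.
by apply: is_derive_eq; rewrite /cosT /sinT /GRing.scale /= exprS; ring.
Qed.

Let dUx j (t x : R) : is_derive x 1 (U j t) (- V j.+1 t x).
Proof.
rewrite /V -sumrN.
apply: (@is_derive_sum_fun _ n (fun k x => cosT j k t x) (fun k => - (sinT j.+1 k t x))) => k.
have := dcos (lam k) ph x => ?.
by apply: is_derive_eq; rewrite /cosT /sinT /GRing.scale /= exprS; ring.
Qed.

Let dVx j (t x : R) : is_derive x 1 (V j t) (U j.+1 t x).
Proof.
apply: (@is_derive_sum_fun _ n (fun k x => sinT j k t x) (fun k => cosT j.+1 k t x)) => k.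
have := dsin (lam k) ph x => ?.
by apply: is_derive_eq; rewrite /cosT /sinT /GRing.scale /= exprS; ring.
Qed.

Let bounded_sum (f : nat -> R -> R -> R) :
  (forall k, bounded_before (f k)) ->
  bounded_before (fun t x => \sum_(k < n) f k t x).
Proof.
move=> bf; elim: n => [|m [K IH]].
  by exists 0 => t x _; rewrite big_ord0 normr0.
have [L fL] := bf m; exists (K + L) => t x t1.
by rewrite big_ord_recr/= (le_trans (ler_normD _ _))// lerD ?IH ?fL.
Qed.

Let bexp (a : R) : 0 < a -> bounded_before (fun t _ => expR (a * t)).
Proof.
move=> a0; exists (expR a) => t x t1; rewrite ger0_norm ?expR_ge0//.
by rewrite ler_expR -[leRHS]mulr1 ler_pM2l// ltW.
Qed.

Let bU j : bounded_before (U j).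
Proof.
apply: (bounded_sum (f := cosT j)) => k.
apply: bounded_beforeM (bounded_before_cst _) _.
apply: bounded_beforeM; first exact: bexp.
by exists 1 => t x _; rewrite ler_norml cos_geN1 cos_le1.
Qed.

Let bV j : bounded_before (V j).
Proof.
apply: (bounded_sum (f := sinT j)) => k.
apply: bounded_beforeM (bounded_before_cst _) _.
apply: bounded_beforeM; first exact: bexp.
by exists 1 => t x _; rewrite ler_norml sin_geN1 sin_le1.
Qed.

Hypothesis ends : forall x : R, x = 0 \/ x = 1 ->
  (forall k, cos (lam k * x + ph) = 0) \/ (forall k, sin (lam k * x + ph) = 0).

(** Where all cosines vanish so do [U 0] and [U 1]; where all sines vanish so do [V 0] and [V 1].
    Each product has a factor of either kind. *)
Let boundary (t x : R) : x = 0 \/ x = 1 ->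
  U 0 t x * V 1 t x = 0 /\ V 0 t x * U 1 t x = 0.
Proof.
move=> /ends[|] h0.
  by split; [rewrite /U|rewrite [U _ _ _]/U]; rewrite big1 ?(mul0r, mulr0)// => k _;
    rewrite /cosT /sinT h0 !mulr0.
by split; [rewrite [V _ _ _]/V|rewrite /V]; rewrite big1 ?(mul0r, mulr0)// => k _;
  rewrite /cosT /sinT h0 !mulr0.
Qed.

Let decay_sum (f : nat -> R -> R) (eta : R) : 0 < eta ->
  (forall k x, `|f k x| <= 1) ->
  exists2 t0 : R, t0 < 0 & forall t x, t <= t0 ->
    (\sum_(k < n) c k * lam k ^+ 0 * (expR (lam k * t) * f k x)) ^+ 2 <= eta.
Proof.
move=> eta0 f1; set L := \sum_(k < n) `|c k| / lam k.
have L0 : 0 <= L by apply: sumr_ge0 => k _; rewrite divr_ge0// ltW.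
(* From exp(-y) <= 1/y the sum is at most [L / T] to the left of [- T]; since [T >= 1], also T^2 >=
   T >= L^2 / eta. *)
pose T := 1 + L ^+ 2 / eta.
have T1 : 1 <= T by rewrite lerDl divr_ge0 ?sqr_ge0// ltW.
have T0 : 0 < T by rewrite (lt_le_trans ltr01).
exists (- T) => [|t x tT]; first by rewrite oppr_lt0.
apply: (@le_trans _ _ ((L / T) ^+ 2)).
  rewrite -[leLHS]real_normK ?num_real// ler_pXn2r ?nnegrE ?divr_ge0 ?(ltW T0)//.
  rewrite (le_trans (ler_norm_sum _ _ _))// mulr_suml ler_sum// => k _.
  rewrite expr0 mulr1 normrM -mulrA ler_wpM2l// normrM ger0_norm ?expR_ge0//.
  rewrite -[leRHS]mulr1 ler_pM ?expR_ge0 ?f1//.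
  have lt0 : 0 < lam k * - t by rewrite mulr_gt0// oppr_gt0 (le_lt_trans tT) ?oppr_lt0.
  rewrite -invfM -[leLHS]invrK -expRN lef_pV2 ?posrE ?expR_gt0 ?mulr_gt0//.
  rewrite -mulrN (@le_trans _ _ (1 + lam k * - t)) ?expR_ge1Dx//.
  by rewrite ler_wpDl// ler_pM2l// lerNr.
rewrite expr_div_n ler_pdivrMr ?exprn_gt0// mulrC -ler_pdivrMr//.
rewrite (@le_trans _ _ T) ?lerDr// -[leLHS]mulr1 expr2 ler_pM2l//.
Qed.

Let decay (eta : R) : 0 < eta ->
  exists2 t0 : R, t0 < 0 & forall t x, t <= t0 ->
    U 0 t x ^+ 2 + V 0 t x ^+ 2 <= eta.
Proof.
move=> eta0; have e2 : 0 < eta / 2 by rewrite divr_gt0.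
have [k x|t1 t10 h1] := decay_sum e2 (f := fun k x => cos (lam k * x + ph)).
  by rewrite ler_norml cos_geN1 cos_le1.
have [k x|t2 t20 h2] := decay_sum e2 (f := fun k x => sin (lam k * x + ph)).
  by rewrite ler_norml sin_geN1 sin_le1.
exists (Num.min t1 t2) => [|t x]; first by rewrite gt_min t10.
rewrite le_min => /andP[tt1 tt2]; rewrite [leRHS]splitr.
by apply: lerD; [exact: h1|exact: h2].
Qed.

Let C x := \sum_(k < n) c k * cos (lam k * x + ph).
Let D x := \sum_(k < n) c k * sin (lam k * x + ph).

Lemma stein_trig_sum (s : R) : 2^-1 < s -> s <= 1 ->
  \int[lebesgue_measure]_(x in `[0, 1]) (C x ^+ 2 + D x ^+ 2) `^ s <=
  2 / (2 * s - 1) * \int[lebesgue_measure]_(x in `[0, 1]) (C x ^+ 2) `^ s.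
Proof.
move=> s12 s1.
have s0 : 0 < s by rewrite (lt_trans _ s12).
have U0E x : U 0 0 x = C x.
  by apply: eq_bigr => k _; rewrite /cosT /sinT mulr0 expR0 mul1r expr0 mulr1.
have V0E x : V 0 0 x = D x.
  by apply: eq_bigr => k _; rewrite /cosT /sinT mulr0 expR0 mul1r expr0 mulr1.
have cC : continuous C.
  by rewrite -(funext U0E); exact: is_derive_continuous (dUx 0 0).
have cD : continuous D.
  by rewrite -(funext V0E); exact: is_derive_continuous (dVx 0 0).
set A := 2 / _.
have A0 : 0 < A by rewrite divr_gt0// subr_gt0 mulrC -ltr_pdivrMr ?div1r.
have cC2 : continuous (fun x => (C x ^+ 2) `^ s).
  have := continuous_sqr_powR s0 cC (@continuous_fun_cst _ 0).
  by under eq_fun do rewrite expr0n addr0.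
apply/ler_addgt0Pr => d d0.
(* Chosen so that [e ^ s = d / A]: removing the regularization by subadditivity of the power then
   costs exactly [d]. *)
pose e := (d / A) `^ s^-1.
have e0 : 0 < e by apply: powR_gt0; exact: divr_gt0.
have cCe : continuous (fun x => (C x ^+ 2 + e) `^ s).
  have := continuous_sqr_powR s0 cC (@continuous_fun_cst _ (Num.sqrt e)).
  by under eq_fun do rewrite sqr_sqrtr ?ltW//.
have cCDe : continuous (fun x => (C x ^+ 2 + D x ^+ 2 + e) `^ s).
  apply: continuous_powR => [x|]; first by rewrite ltr_wpDl// addr_ge0 ?sqr_ge0.
  apply: continuous_funD (@continuous_fun_cst _ e).
  by apply: continuous_funD; exact: continuous_funX.
apply: (@le_trans _ _ (\int[lebesgue_measure]_(x in `[0, 1])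
    (C x ^+ 2 + D x ^+ 2 + e) `^ s)).
  apply: le_Rintegral_cont => //; first exact: continuous_sqr_powR.
  move=> x _; rewrite ge0_ler_powR ?nnegrE ?addr_ge0 ?sqr_ge0 ?(ltW e0) ?(ltW s0)//.
  by rewrite lerDl ltW.
have := @stein_regularized R s e s12 s1 e0 (U 0) (V 0) (U 1) (V 1) (U 2) (V 2)
  (dUt 0) (dVt 0) (dUt 1) (dVt 1) (dUx 0) (dVx 0) (dUx 1) (dVx 1)
  (fun t => is_derive_continuous (dUx 2 t))
  (fun t => is_derive_continuous (dVx 2 t))
  (bU 0) (bV 0) (bU 1) (bV 1) (bU 2) (bV 2) boundary decay.
under eq_Rintegral do rewrite U0E V0E.
under [X in _ * X]eq_Rintegral do rewrite U0E.
move=> /le_trans; apply; rewrite -/A.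
apply: (@le_trans _ _ (A * \int[lebesgue_measure]_(x in `[0, 1])
    ((C x ^+ 2) `^ s + d / A))).
  rewrite ler_pM2l//; apply: le_Rintegral_cont => //.
    by apply: continuous_funD => //; exact: continuous_fun_cst.
  move=> x _; rewrite (le_trans (powRD_le _ _ _)) ?s0 ?sqr_ge0 ?(ltW e0)//.
  by rewrite lerD2l /e -powRrM mulVf ?gt_eqF// powRr1// divr_ge0 ?ltW.
rewrite (Rintegral_contD _ _ cC2 (@continuous_fun_cst _ _)) mulrDr lerD2l.
rewrite Rintegral_cst//= lebesgue_measure_itv/= lte_fin ltr01 oppr0 adde0 mulr1.
by rewrite mulrC divfK// gt_eqF.
Qed.

End trig_sums.

(** * M. Riesz's theorem for sine sums, 1 < p <= 2 *)

Section riesz_truncation.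
Context {R : realType}.
Variables (s : R).
Hypotheses (s_gt : 2^-1 < s) (s_le1 : s <= 1).
Let A := 2 / (2 * s - 1).

Local Notation "\int01 f" := (\int[lebesgue_measure]_(x in `[0, 1]) f x)
  (at level 10, f at level 9).

Lemma sin_natpi (k : nat) : sin (pi * k%:R) = 0 :> R.
Proof.
elim: k => [|k IHk]; first by rewrite mulr0 sin0.
by rewrite -natr1 mulrDr mulr1 sinD IHk sinpi mul0r mulr0 addr0.
Qed.

Lemma cos_half_natpi (k : nat) : cos (pi * (k%:R + 2^-1)) = 0 :> R.
Proof.
by rewrite mulrDr cosD sin_natpi mul0r subr0 cos_pihalf mulr0.
Qed.

Lemma continuous_sum_fun (n : nat) (h : nat -> R -> R) :
  (forall k, continuous (h k)) -> continuous (fun x => \sum_(k < n) h k x).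
Proof.
move=> ch; elim: n => [|n IHn].
  by under eq_fun do rewrite big_ord0; exact: continuous_fun_cst.
by under eq_fun do rewrite big_ord_recr/=; exact: continuous_funD.
Qed.

Lemma continuous_cosM (a : R) : continuous (fun x => cos (a * x)).
Proof.
move=> x; apply: (@continuous_comp _ _ _ (fun x => a * x)) .
  exact: mulrl_continuous.
exact: continuous_cos.
Qed.

Lemma continuous_sinM (a : R) : continuous (fun x => sin (a * x)).
Proof.
move=> x; apply: (@continuous_comp _ _ _ (fun x => a * x)) .
  exact: mulrl_continuous.
exact: continuous_sin.
Qed.

Definition cos_sum (n : nat) (c lam : nat -> R) (x : R) :=
  \sum_(k < n) c k * cos (lam k * x).
Definition sin_sum (n : nat) (c lam : nat -> R) (x : R) :=
  \sum_(k < n) c k * sin (lam k * x).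

Lemma continuous_cos_sum n c lam : continuous (cos_sum n c lam).
Proof.
apply: (continuous_sum_fun (h := fun k x => c k * cos (lam k * x))) => k.
by apply: continuous_funM; [exact: continuous_fun_cst|exact: continuous_cosM].
Qed.

Lemma continuous_sin_sum n c lam : continuous (sin_sum n c lam).
Proof.
apply: (continuous_sum_fun (h := fun k x => c k * sin (lam k * x))) => k.
by apply: continuous_funM; [exact: continuous_fun_cst|exact: continuous_sinM].
Qed.

Lemma stein_cos_sum n (c lam : nat -> R) : (forall k, 0 < lam k) ->
  (forall k, cos (lam k) = 0) \/ (forall k, sin (lam k) = 0) ->
  \int01 (fun x => (cos_sum n c lam x ^+ 2 + sin_sum n c lam x ^+ 2) `^ s) <=
  A * \int01 (fun x => (cos_sum n c lam x ^+ 2) `^ s).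
Proof.
move=> lam0 ends.
have cE x : cos_sum n c lam x = \sum_(k < n) c k * cos (lam k * x + 0).
  by apply: eq_bigr => k _; rewrite addr0.
have sE x : sin_sum n c lam x = \sum_(k < n) c k * sin (lam k * x + 0).
  by apply: eq_bigr => k _; rewrite addr0.
under eq_Rintegral do rewrite cE sE.
under [X in _ <= _ * X]eq_Rintegral do rewrite cE.
apply: stein_trig_sum => // x [->|->].
  by right => k; rewrite mulr0 addr0 sin0.
by case: ends => h; [left|right] => k; rewrite addr0 mulr1.
Qed.

(** The phase [- (pi / 2)] multiplies the holomorphic sum by -i and so makes the sine sum its real
    part; the two boundary alternatives trade places. *)
Lemma stein_sin_sum n (c lam : nat -> R) : (forall k, 0 < lam k) ->
  (forall k, cos (lam k) = 0) \/ (forall k, sin (lam k) = 0) ->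
  \int01 (fun x => (cos_sum n c lam x ^+ 2 + sin_sum n c lam x ^+ 2) `^ s) <=
  A * \int01 (fun x => (sin_sum n c lam x ^+ 2) `^ s).
Proof.
move=> lam0 ends.
have sB (x : R) : sin (x - pi / 2) = - cos x.
  by rewrite sinB cos_pihalf sin_pihalf mulr0 sub0r mulr1.
have cE x : cos_sum n c lam x ^+ 2 =
    (\sum_(k < n) c k * sin (lam k * x + - (pi / 2))) ^+ 2.
  rewrite -[RHS]sqrrN -sumrN; congr (_ ^+ 2); apply: eq_bigr => k _.
  by rewrite sB mulrN opprK.
have sE x : sin_sum n c lam x = \sum_(k < n) c k * cos (lam k * x + - (pi / 2)).
  by apply: eq_bigr => k _; rewrite cosBpihalf.
under eq_Rintegral do rewrite addrC cE sE.
under [X in _ <= _ * X]eq_Rintegral do rewrite sE.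
apply: stein_trig_sum => // x [->|->].
  by left => k; rewrite cosBpihalf mulr0 sin0.
case: ends => h; [right|left] => k; rewrite mulr1.
  by rewrite sB h oppr0.
by rewrite cosBpihalf.
Qed.

(* Multiplying [G x = \sum_k b_k exp(i pi (k + 1) x)] by [exp(- i beta x)] moves
   the frequencies to half-integers, so no frequency vanishes; reflecting the
   negative ones turns [G] into two analytic sums, both controlled by Stein's
   inequality, whose difference is twice the truncated sum. *)
Variables (M N : nat) (b : nat -> R).
Let freq (k : nat) : R := pi * k.+1%:R.
Let shifted (k : nat) : R := pi * `|k.+1%:R - N%:R - 2^-1|.
Let sigma (k : nat) : R := if (k < N)%N then - 1 else 1.
Let trunc (k : nat) := (k < N)%:R * b k.

Lemma sin_sum_truncation :
  \int01 (fun x => (sin_sum M trunc freq x ^+ 2) `^ s) <=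
  2 * A ^+ 2 * \int01 (fun x => (sin_sum M b freq x ^+ 2) `^ s).
Proof.
have s0 : 0 < s by rewrite (lt_trans _ s_gt).
have A0 : 0 < A by rewrite divr_gt0// subr_gt0 mulrC -ltr_pdivrMr ?div1r.
have freq0 k : 0 < freq k by rewrite mulr_gt0 ?pi_gt0.
have sfreq k : sin (freq k) = 0 by exact: sin_natpi.
pose beta : R := pi * (N%:R + 2^-1).
have shE k : shifted k = sigma k * (freq k - beta) /\
    exists m : nat, shifted k = pi * (m%:R + 2^-1).
  rewrite /shifted /sigma /freq /beta; case: ifPn => kN.
    rewrite ltr0_norm; last first.
      by rewrite -addrA -opprD subr_lt0 ltr_pwDr ?invr_gt0 ?ltr0n// ler_nat.
    split; first by ring.
    by exists (N - k.+1)%N; rewrite natrB//; ring.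
  rewrite -leqNgt in kN.
  rewrite gtr0_norm; last first.
    have : N%:R <= k%:R :> R by rewrite ler_nat.
    by rewrite -natr1; lra.
  split; first by ring.
  by exists (k - N)%N; rewrite natrB// -natr1; field.
have sh0 k : 0 < shifted k.
  have [_ [m ->]] := shE k.
  by rewrite mulr_gt0 ?pi_gt0// ltr_wpDl// invr_gt0.
have csh k : cos (shifted k) = 0.
  by have [_ [m ->]] := shE k; exact: cos_half_natpi.
pose G x := cos_sum M b freq x ^+ 2 + sin_sum M b freq x ^+ 2.
pose sb k := sigma k * b k.
(* Modulating G by exp(- i beta x) gives the real part [C1] and the imaginary part [D2], whence
   [rot]. The signs [sigma] come from the reflection: [C1 + i D1] and [C2 + i D2] have coefficients
   [b k] and [sigma k * b k], so half their difference keeps exactly the terms with [k < N]. *)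
pose C1 := cos_sum M b shifted; pose D1 := sin_sum M b shifted.
pose C2 := cos_sum M sb shifted; pose D2 := sin_sum M sb shifted.
have sh_cos x k : cos (shifted k * x) = cos ((freq k - beta) * x).
  have [-> _] := shE k; rewrite /sigma; case: ifP => _; last by rewrite mul1r.
  by rewrite mulN1r mulNr cosN.
have sh_sin x k : sigma k * sin (shifted k * x) = sin ((freq k - beta) * x).
  have [-> _] := shE k; rewrite /sigma; case: ifP => _; last by rewrite !mul1r.
  by rewrite !mulN1r mulNr sinN opprK.
have C1E x : C1 x = cos (beta * x) * cos_sum M b freq x
    + sin (beta * x) * sin_sum M b freq x.
  rewrite /C1 /cos_sum /sin_sum !mulr_sumr -big_split/=; apply: eq_bigr => k _.
  by rewrite sh_cos mulrBl cosB; ring.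
have D2E x : D2 x = cos (beta * x) * sin_sum M b freq x
    - sin (beta * x) * cos_sum M b freq x.
  rewrite /D2 /cos_sum /sin_sum !mulr_sumr -sumrB/=; apply: eq_bigr => k _.
  by rewrite /sb mulrAC sh_sin mulrBl sinB; ring.
have rot x : C1 x ^+ 2 + D2 x ^+ 2 = G x.
  rewrite C1E D2E /G.
  have := cos2Dsin2 (beta * x); move: (cos _) (sin _) => cb sb' cs1.
  rewrite -[RHS]mul1r -cs1; ring.
have truncE x : sin_sum M trunc freq x =
    sin (beta * x) * ((C1 x - C2 x) / 2) - cos (beta * x) * ((D1 x - D2 x) / 2).
  rewrite /C1 /C2 /D1 /D2 /cos_sum /sin_sum -!sumrB !mulr_suml !mulr_sumr -sumrB.
  apply: eq_bigr => k _; rewrite /trunc /sb.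
  have -> : freq k * x = beta * x - (beta - freq k) * x by ring.
  rewrite sinB; have [shk _] := shE k; move: shk; rewrite /sigma.
  case: ifP => _ ->; last by rewrite !mul1r !subrr !mul0r !mulr0 subrr.
  by rewrite mulN1r opprB !mulN1r !mulNr !opprK mul1r; field.
have trunc_le x : sin_sum M trunc freq x ^+ 2 <=
    (C1 x ^+ 2 + D1 x ^+ 2) + (C2 x ^+ 2 + D2 x ^+ 2).
  rewrite truncE; have := cos2Dsin2 (beta * x); move: (cos _) (sin _) => cb sb' cs1.
  set P := (_ / 2); set Q := (D1 x - _) / 2.
  apply: (@le_trans _ _ (P ^+ 2 + Q ^+ 2)).
    rewrite -subr_ge0 [leRHS](_ : _ = (cb * P + sb' * Q) ^+ 2) ?sqr_ge0//.
    by rewrite -[P ^+ 2]mul1r -[Q ^+ 2]mul1r -cs1; ring.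
  rewrite -subr_ge0 [leRHS](_ : _ = ((C1 x + C2 x) / 2) ^+ 2 +
    ((D1 x + D2 x) / 2) ^+ 2 + 2^-1 * (C1 x ^+ 2 + D1 x ^+ 2 + C2 x ^+ 2 + D2 x ^+ 2)).
    apply: addr_ge0; first by apply: addr_ge0; exact: sqr_ge0.
    by apply: mulr_ge0; rewrite ?invr_ge0// !addr_ge0 ?sqr_ge0.
  by rewrite /P /Q; field.
have cC n c lam := @continuous_cos_sum n c lam.
have cS n c lam := @continuous_sin_sum n c lam.
have c0 := @continuous_fun_cst R 0.
have cP (f g : R -> R) : continuous f -> continuous g ->
    continuous (fun x => (f x ^+ 2 + g x ^+ 2) `^ s).
  exact: continuous_sqr_powR.
have cP1 (f : R -> R) : continuous f -> continuous (fun x => (f x ^+ 2) `^ s).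
  by move=> cf; have := cP _ _ cf c0; under eq_fun do rewrite expr0n addr0.
have cX1 := cP _ _ (cC M b shifted) (cS M b shifted).
have cX2 := cP _ _ (cC M sb shifted) (cS M sb shifted).
apply: (@le_trans _ _ (\int01 (fun x => (C1 x ^+ 2 + D1 x ^+ 2) `^ s) +
    \int01 (fun x => (C2 x ^+ 2 + D2 x ^+ 2) `^ s))).
  rewrite -(Rintegral_contD _ _ cX1 cX2).
  apply: le_Rintegral_cont => [||x _]; first by apply: cP1; exact: cS.
    by apply: continuous_funD; [exact: cX1|exact: cX2].
  rewrite (le_trans _ (powRD_le _ _ _)) ?s0 ?addr_ge0 ?sqr_ge0//.
  by rewrite ge0_ler_powR ?nnegrE ?addr_ge0 ?sqr_ge0 ?(ltW s0).
(* Stein's inequality is used at two levels: half-integer frequencies, where the cosines vanish at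
   1, and integer ones, where the sines do. This gives [A ^+ 2]; the factor 2 counts the two
   analytic sums. *)
have le1 : \int01 (fun x => (C1 x ^+ 2 + D1 x ^+ 2) `^ s) <=
    A * \int01 (fun x => (C1 x ^+ 2) `^ s).
  by apply: stein_cos_sum => //; left.
have le2 : \int01 (fun x => (C2 x ^+ 2 + D2 x ^+ 2) `^ s) <=
    A * \int01 (fun x => (D2 x ^+ 2) `^ s).
  by apply: stein_sin_sum => //; left.
have le3 : \int01 (fun x => G x `^ s) <=
    A * \int01 (fun x => (sin_sum M b freq x ^+ 2) `^ s).
  by apply: stein_sin_sum => //; right.
have le4 (f : R -> R) : continuous f -> (forall x, f x ^+ 2 <= G x) ->
    \int01 (fun x => (f x ^+ 2) `^ s) <= \int01 (fun x => G x `^ s).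
  move=> cf fG; apply: le_Rintegral_cont;
    [exact: cP1|by apply: cP; [exact: cC|exact: cS]|move=> x _].
  by rewrite ge0_ler_powR ?nnegrE ?addr_ge0 ?sqr_ge0 ?(ltW s0)//; exact: fG.
have C1G x : C1 x ^+ 2 <= G x by rewrite -rot lerDl sqr_ge0.
have D2G x : D2 x ^+ 2 <= G x by rewrite -rot lerDr sqr_ge0.
have := le4 _ (cC _ _ _) C1G; have := le4 _ (cS _ _ _) D2G.
move: le1 le2 le3; rewrite -/A.
move: (Rintegral _ _ _) (Rintegral _ _ _) (Rintegral _ _ _) (Rintegral _ _ _)
  (Rintegral _ _ _) (Rintegral _ _ _) => f g d2 x2 c1 x1 xc1 xd2 gf d2g c1g.
have gA : A * g <= A * (A * f) by rewrite ler_pM2l.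
have c1A : A * c1 <= A * g by rewrite ler_pM2l.
have d2A : A * d2 <= A * g by rewrite ler_pM2l.
rewrite (_ : 2 * A ^+ 2 * f = A * (A * f) + A * (A * f)); last by ring.
by apply: lerD; [exact: le_trans (le_trans c1A gA)|exact: le_trans (le_trans d2A gA)].
Qed.

End riesz_truncation.

Definition natfreq {R : realType} (k : nat) : R := pi * k.+1%:R.

Lemma riesz_sine_sum {R : realType} (p : R) (M N : nat) (b : nat -> R) :
  1 < p -> p <= 2 ->
  \int[lebesgue_measure]_(x in `[0, 1])
    `|sin_sum M (fun k => (k < N)%:R * b k) natfreq x| `^ p <=
  2 * (2 / (p - 1)) ^+ 2 *
  \int[lebesgue_measure]_(x in `[0, 1]) `|sin_sum M b natfreq x| `^ p.
Proof.
move=> p1 p2.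
have := @sin_sum_truncation R (p / 2) _ _ M N b.
rewrite (mulrC 2 (p / 2)) divfK// ltr_pdivlMr// mulVf// ler_pdivrMr// mul1r.
move=> /(_ p1 p2).
under eq_Rintegral do rewrite -normr_powR_sqr.
by under [X in _ <= _ * X]eq_Rintegral do rewrite -normr_powR_sqr.
Qed.

(** * Approximation in L_q of a probability measure *)

Section Lq_tools.
Context d {T : measurableType d} {R : realType}.
Variables (mu : {measure set T -> \bar R}) (q : R).
Hypothesis mu1 : mu [set: T] = 1%E.
Hypothesis q1 : 1 < q.
Implicit Types f g : T -> R.
Local Notation N f := (Lnorm mu q%:E (EFin \o f%R)).

Lemma LnormEpow f : N f = ((\int[mu]_x (`|f x| `^ q)%:E) `^ q^-1)%E.
Proof.
by rewrite unlock; congr (_ `^ _)%E; apply: eq_integral => x _.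
Qed.

Lemma measurable_normr_powR f : measurable_fun setT f ->
  measurable_fun setT (fun x => `|f x| `^ q).
Proof.
move=> mf; apply: (@measurableT_comp _ _ _ _ _ _ (@powR R ^~ q)) => //.
exact: measurableT_comp.
Qed.

Lemma le_Lnorm f g : measurable_fun setT f -> measurable_fun setT g ->
  (forall x, `|f x| <= `|g x|) -> (N f <= N g)%E.
Proof.
move=> mf mg fg; rewrite !LnormEpow; apply: gt0_ler_poweR.
- by rewrite invr_ge0 (le_trans _ (ltW q1)).
- by rewrite in_itv/= leey integral_ge0// => x _; rewrite lee_fin powR_ge0.
- by rewrite in_itv/= leey integral_ge0// => x _; rewrite lee_fin powR_ge0.
apply: ge0_le_integral => //.
- by apply/measurable_EFinP; exact: measurable_normr_powR.
- by apply/measurable_EFinP; exact: measurable_normr_powR.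
- move=> x _; rewrite lee_fin ge0_ler_powR ?nnegrE//.
  by rewrite (le_trans _ (ltW q1)).
Qed.

Lemma Lnorm_scale f (k : R) : measurable_fun setT f ->
  (N (fun x => k * f x) = `|k|%:E * N f)%E.
Proof.
have q0 : 0 < q by rewrite (lt_trans _ q1).
move=> mf; rewrite !LnormEpow.
under eq_integral do rewrite normrM powRM// EFinM.
rewrite ge0_integralZl_EFin ?powR_ge0//; last first.
  by apply/measurable_EFinP; exact: measurable_normr_powR.
rewrite poweRM ?lee_fin ?powR_ge0//; last exact: integral_ge0.
by rewrite poweR_EFin -powRrM divff ?gt_eqF// powRr1.
Qed.

Lemma Lnorm_cst (k : R) : (N (cst k) = `|k|%:E)%E.
Proof.
have q0 : 0 < q by rewrite (lt_trans _ q1).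
rewrite LnormEpow (integral_cst mu measurableT (`|k| `^ q)%:E).
rewrite mu1 mule1 poweR_EFin.
by rewrite -powRrM divff ?gt_eqF// powRr1.
Qed.

Lemma Lnorm_le_sup f (K : R) : measurable_fun setT f ->
  (forall x, `|f x| <= K) -> (N f <= K%:E)%E.
Proof.
move=> mf fK; apply: (@le_trans _ _ (N (cst K))).
  apply: le_Lnorm => // x; rewrite (le_trans (fK x))//; exact: ler_norm.
have [K0|] := leP 0 K; first by rewrite Lnorm_cst ger0_norm.
(* A negative [K] would make the space empty, against its mass 1. *)
move=> K0; rewrite (_ : cst K = fun x : T => K * 1); last first.
  by apply/funext => x; rewrite mulr1.
have mu0 : forall x : T, False.
  by move=> x; have := le_lt_trans (fK x) K0; rewrite normr_lt0.
have : mu [set: T] = 0%E.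
  by rewrite (_ : setT = set0) ?measure0//; apply/seteqP; split => // x; case: (mu0 x).
by rewrite mu1 => /eqP; rewrite onee_eq0.
Qed.

Lemma Lnorm_sum I (s : seq I) (F : I -> T -> R) :
  (forall i, measurable_fun setT (F i)) ->
  (N (fun x => \sum_(i <- s) F i x)%R <= \sum_(i <- s) N (F i))%E.
Proof.
move=> mF; elim: s => [|i s IH].
  rewrite big_nil (_ : (fun x => _) = cst 0); last first.
    by apply/funext => x; rewrite big_nil.
  by rewrite Lnorm_cst normr0.
rewrite big_cons (_ : (fun x => _) = (F i \+ (fun x => \sum_(i <- s) F i x))%R).
  apply: le_trans (leeD2l _ IH); apply: minkowski_EFin => //.
    by apply: measurable_sum => ?.
  exact: ltW.
by apply/funext => x; rewrite big_cons.
Qed.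

Lemma Lnorm_sub f g : measurable_fun setT f -> measurable_fun setT g ->
  (N (f \- g) <= N f + N g)%E.
Proof.
move=> mf mg; have -> : (f \- g)%R = (f \+ (fun x => -1 * g x))%R.
  by apply/funext => x /=; rewrite mulN1r.
have mg' : measurable_fun setT (fun x => -1 * g x) by exact: measurable_funM.
apply: le_trans (minkowski_EFin mu mf mg' (ltW q1)) _.
by rewrite Lnorm_scale// normrN1 mul1e.
Qed.

Lemma Lnorm_subC f g : N (f \- g) = N (g \- f).
Proof.
by rewrite -oppe_Lnorm; apply: eq_Lnorm => x /=; rewrite opprB.
Qed.

Lemma Lnorm_dist f g h : measurable_fun setT f -> measurable_fun setT g ->
  measurable_fun setT h -> (N (f \- h) <= N (f \- g) + N (g \- h))%E.
Proof.
move=> mf mg mh.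
rewrite (_ : (f \- h)%R = ((f \- g) \+ (g \- h))%R).
  by apply: minkowski_EFin; [exact: measurable_funB|exact: measurable_funB|exact: ltW].
by apply/funext => x /=; rewrite addrA subrK.
Qed.

Lemma Lnorm1_le f : measurable_fun setT f ->
  (\int[mu]_x `|f x|%:E <= N f)%E.
Proof.
move=> mf; have q0 : 0 < q by rewrite (lt_trans _ q1).
have := @hoelder _ _ _ mu f (cst 1) q (q / (q - 1)) mf.
rewrite Lnorm1; under eq_integral do rewrite /= mulr1.
rewrite (_ : EFin \o cst 1 = cst 1%E)// Lnorm_cst1 mu1 poweR1r mule1; apply => //.
  by rewrite divr_gt0// subr_gt0.
by rewrite invf_div mulrBl divff ?gt_eqF// mul1r subrKC.
Qed.

Lemma LfunP2 f : (f \in Lfun mu q%:E) <->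
  measurable_fun setT f /\ (N f < +oo)%E.
Proof.
rewrite inE; split; first by move=> /andP[/[!inE] mf Nf]; split.
by move=> [mf Nf]; apply/andP; split; rewrite inE.
Qed.

Lemma Lfun_integrable1 f : measurable_fun setT f -> (N f < +oo)%E ->
  mu.-integrable setT (EFin \o f).
Proof.
move=> mf Nf; apply/integrableP; split; first exact/measurable_EFinP.
by rewrite (le_lt_trans _ Nf)//; exact: Lnorm1_le.
Qed.

Lemma integrable_mul_bounded f g (K : R) : measurable_fun setT f ->
  (N f < +oo)%E -> measurable_fun setT g -> (forall x, `|g x| <= K) ->
  mu.-integrable setT (EFin \o (fun x => f x * g x)).
Proof.
move=> mf Nf mg gK.
have iK : mu.-integrable setT (EFin \o (fun x => K * f x)).
  have := integrableZl measurableT K (Lfun_integrable1 mf Nf).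
  by apply: eq_integrable => // x _.
apply: (le_integrable measurableT _ _ iK).
  by apply/measurable_EFinP; exact: measurable_funM.
move=> x _ /=; rewrite lee_fin !normrM mulrC ler_wpM2r//.
by rewrite (le_trans (gK x))// ler_norm.
Qed.

Lemma Lnorm_pairing f g (K : R) : 0 <= K -> measurable_fun setT f ->
  (N f < +oo)%E -> measurable_fun setT g -> (forall x, `|g x| <= K) ->
  (`|\int[mu]_x (f x * g x)|%:E <= K%:E * N f)%E.
Proof.
move=> K0 mf Nf mg gK.
have ifg := integrable_mul_bounded mf Nf mg gK.
rewrite EFin_normr_Rintegral//.
apply: le_trans (le_abse_integral mu measurableT _) _.
  by apply/measurable_EFinP; exact: measurable_funM.
apply: (@le_trans _ _ (\int[mu]_x (K%:E * `|f x|%:E))%E).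
  apply: ge0_le_integral => //.
  - by apply: measurableT_comp => //; apply/measurable_EFinP; exact: measurable_funM.
  - by apply: measurable_funeM; apply/measurable_EFinP; exact: measurableT_comp.
  - by move=> x _; rewrite lee_fin normrM mulrC ler_wpM2r.
rewrite ge0_integralZl_EFin//; last first.
  by apply/measurable_EFinP; exact: measurableT_comp.
by rewrite lee_wpmul2l// Lnorm1_le.
Qed.

(** Dominated convergence for |f - F_n|^q. One good index is all that an approximation argument
    needs. *)
Lemma Lnorm_dominated_cvg (f : T -> R) (F : (T -> R)^nat) (g : T -> R) :
  measurable_fun setT f -> (forall n, measurable_fun setT (F n)) ->
  measurable_fun setT g -> (N g < +oo)%E ->
  (forall n x, `|f x - F n x| <= `|g x|) ->
  {ae mu, forall x, F n x @[n --> \oo] --> f x} ->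
  forall eps : R, 0 < eps -> exists n, (N (f \- F n) <= eps%:E)%E.
Proof.
have q0 : 0 < q by rewrite (lt_trans _ q1).
move=> mf mF mg Ng dom cvgF eps eps0.
pose h n x := (`|f x - F n x| `^ q)%:E.
have mh n : measurable_fun setT (h n).
  by apply/measurable_EFinP/measurable_normr_powR; exact: measurable_funB.
have ig : mu.-integrable setT (fun x => (`|g x| `^ q)%:E).
  by apply: Lfun_integrable; [exact: ltW|exact/LfunP2].
have cvgh : {ae mu, forall x, setT x -> h ^~ x @ \oo --> (cst 0%E) x}.
  move: cvgF; apply: filterS => x cF _.
  rewrite /h; apply/fine_cvgP; split; first exact: nearW.
  rewrite (_ : _ \o _ = fun n => `|f x - F n x| `^ q)//.
  have cf0 : f x - F n x @[n --> \oo] --> 0.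
    by rewrite -[X in _ --> X](subrr (f x)); apply: cvgB => //; exact: cvg_cst.
  have := @continuous_normr_powR R id q q0 (fun x => @cvg_id _ _ ) 0.
  rewrite /continuous_at normr0 powR0 ?gt_eqF// => c0.
  exact: (cvg_comp _ _ cf0 c0).
have domh : {ae mu, forall x n, setT x -> (`|h n x| <= (`|g x| `^ q)%:E)%E}.
  apply: aeW => x n _; rewrite /h lee_fin ger0_norm ?powR_ge0//.
  by rewrite ge0_ler_powR ?nnegrE// ltW.
have [_ + _] := dominated_convergence measurableT mh (measurable_cst _) cvgh ig domh.
have e0 : 0 < eps `^ q by rewrite powR_gt0.
move=> /fine_cvgP[fin /cvgrPdist_lt/(_ _ e0) near1].
have [n [finn n1]] : exists n, ((\int[mu]_x `|h n x - cst 0 x|)%E \is a fin_num /\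
   `|0 - (fine \o [sequence (\int[mu]_x `|h n x - cst 0 x|)%E]_n) n| < eps `^ q).
  have [n _ nP] := filterI fin near1.
  by exists n; have [] := nP n (leqnn n).
exists n; rewrite LnormEpow.
have E : (\int[mu]_x `|h n x - cst 0 x| = \int[mu]_x (`|(f \- F n) x| `^ q)%:E)%E.
  by apply: eq_integral => x _; rewrite sube0 /h /= ger0_norm ?powR_ge0.
move: finn n1; rewrite /= E sub0r normrN => finn n1.
rewrite -(fineK finn) poweR_EFin lee_fin.
rewrite -[leRHS](powRr1 (ltW eps0)) -(divff (lt0r_neq0 q0)) powRrM.
rewrite ge0_ler_powR ?nnegrE ?powR_ge0 ?invr_ge0 ?(ltW q0)//.
  by rewrite fine_ge0// integral_ge0// => x _; rewrite lee_fin powR_ge0.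
by rewrite (le_trans _ (ltW n1))// ler_norm.
Qed.

End Lq_tools.

Import HBNNSimple.

Section approximation.
Context d {T : measurableType d} {R : realType} {K : Type}.
Variables (mu : {measure set T -> \bar R}) (q : R).
Hypothesis mu1 : mu [set: T] = 1%E.
Hypothesis q1 : 1 < q.
Variable e : K -> T -> R.
Hypothesis me : forall k, measurable_fun setT (e k).
Local Notation N f := (Lnorm mu q%:E (EFin \o f%R)).
Implicit Types f g : T -> R.

Definition lincomb (s : seq (K * R)) (x : T) := \sum_(p <- s) p.2 * e p.1 x.

Definition approximable (f : T -> R) :=
  forall eps : R, 0 < eps -> exists s, (N (f \- lincomb s) <= eps%:E)%E.

Lemma measurable_lincomb s : measurable_fun setT (lincomb s).
Proof. by apply: measurable_sum => p; exact: measurable_funM. Qed.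

Lemma approximable_lincomb s : approximable (lincomb s).
Proof.
move=> eps eps0; exists s; apply: Lnorm_le_sup => // [|x].
  by apply: measurable_funB; exact: measurable_lincomb.
by rewrite /= subrr normr0 ltW.
Qed.

Lemma approximable_limit f : measurable_fun setT f ->
  (forall eps : R, 0 < eps -> exists g,
    [/\ measurable_fun setT g, approximable g & (N (f \- g) <= eps%:E)%E]) ->
  approximable f.
Proof.
move=> mf fg eps eps0; have eps2 : 0 < eps / 2 by rewrite divr_gt0.
have [g [mg ag Nfg]] := fg _ eps2; have [s Ns] := ag _ eps2.
exists s; rewrite (le_trans (Lnorm_dist mu q1 mf mg (measurable_lincomb s)))//.
by rewrite [eps in leRHS]splitr EFinD leeD.
Qed.

(** The L_q distance from [f] to the span of [e] is at most [r]. Positive [r] serves the contraction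
    argument that brings the sines into the span of the dilates. *)
Definition within (r : R) (f : T -> R) :=
  forall eps : R, 0 < eps -> exists s, (N (f \- lincomb s) <= (r + eps)%:E)%E.

Lemma within0 f : within 0 f <-> approximable f.
Proof. by split=> wf eps /wf; rewrite add0r. Qed.

Lemma withinD r r' f g : measurable_fun setT f -> measurable_fun setT g ->
  within r f -> within r' g -> within (r + r') (fun x => f x + g x).
Proof.
move=> mf mg wf wg eps eps0; have eps2 : 0 < eps / 2 by rewrite divr_gt0.
have [s Ns] := wf _ eps2; have [t Nt] := wg _ eps2; exists (s ++ t).
rewrite (_ : _ \- _ = (f \- lincomb s) \+ (g \- lincomb t)); last first.
  by apply/funext => x; rewrite /= /lincomb big_cat /=; ring.
apply: le_trans (minkowski_EFin _ _ _ (ltW q1)) _.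
- exact: measurable_funB (measurable_lincomb s).
- exact: measurable_funB (measurable_lincomb t).
by apply: le_trans (leeD Ns Nt) _; rewrite -EFinD lee_fin; lra.
Qed.

Lemma withinZ r f (k : R) : measurable_fun setT f ->
  within r f -> within (`|k| * r) (fun x => k * f x).
Proof.
move=> mf wf eps eps0; have k0 : 0 < `|k| + 1 by rewrite ltr_wpDl.
have [s Ns] := wf _ (divr_gt0 eps0 k0).
exists [seq (p.1, k * p.2) | p <- s].
rewrite (_ : _ \- _ = fun x => k * (f \- lincomb s) x); last first.
  apply/funext => x; rewrite /lincomb /= big_map mulrBr mulr_sumr; congr (_ - _).
  by apply: eq_bigr => p _; rewrite mulrA.
rewrite Lnorm_scale//; last exact: measurable_funB (measurable_lincomb s).
have k0' : (0 <= `|k|%:E)%E by rewrite lee_fin.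
apply: (le_trans (lee_wpmul2l k0' Ns)); rewrite -EFinM lee_fin mulrDr lerD2l.
by rewrite mulrCA ger_pMr// ler_pdivrMr// mul1r lerDl.
Qed.

Lemma approximableD f g : measurable_fun setT f -> measurable_fun setT g ->
  approximable f -> approximable g -> approximable (fun x => f x + g x).
Proof.
by move=> mf mg /within0 wf /within0 wg; apply/within0; rewrite -[0]addr0; exact: withinD.
Qed.

Lemma approximableZ f (k : R) : measurable_fun setT f ->
  approximable f -> approximable (fun x => k * f x).
Proof.
by move=> mf /within0 wf; apply/within0; rewrite -(mulr0 `|k|); exact: withinZ.
Qed.

Lemma approximable_sum I (s : seq I) (F : I -> T -> R) :
  (forall i, measurable_fun setT (F i)) -> (forall i, approximable (F i)) ->
  approximable (fun x => \sum_(i <- s) F i x).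
Proof.
move=> mF aF; elim: s => [|i s IH].
  rewrite (_ : (fun x => _) = lincomb [::]); first exact: approximable_lincomb.
  by apply/funext => x; rewrite /lincomb !big_nil.
rewrite (_ : (fun x => _) = fun x => F i x + \sum_(i <- s) F i x).
  by apply: approximableD => //; apply: measurable_sum => ?.
by apply/funext => x; rewrite big_cons.
Qed.

Lemma approximable_dominated (F : (T -> R)^nat) (f g : T -> R) : measurable_fun setT f ->
  (forall n, measurable_fun setT (F n)) -> (forall n, approximable (F n)) ->
  measurable_fun setT g -> (N g < +oo)%E ->
  (forall n x, `|f x - F n x| <= `|g x|) ->
  {ae mu, forall x, F n x @[n --> \oo] --> f x} -> approximable f.
Proof.
move=> mf mF aF mg Ng dom cF; apply: approximable_limit => // eps eps0.
by have [n Nn] := Lnorm_dominated_cvg q1 mf mF mg Ng dom cF eps0; exists (F n).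
Qed.

Lemma approximable_bounded_cvg (F : (T -> R)^nat) (f : T -> R) (C : R) :
  measurable_fun setT f ->
  (forall n, measurable_fun setT (F n)) -> (forall n, approximable (F n)) ->
  (forall x, `|f x| <= C) -> (forall n x, `|F n x| <= C) ->
  {ae mu, forall x, F n x @[n --> \oo] --> f x} -> approximable f.
Proof.
move=> mf mF aF fC FC; apply: (approximable_dominated mf mF aF (g := cst (C + C))) => //.
  by rewrite Lnorm_cst// ltry.
move=> n x; rewrite (le_trans _ (ler_norm _))// (le_trans (ler_normB _ _))//.
exact: lerD.
Qed.

Section density.
(** The weight replaces the constant 1 in systems where 1 is not readily approximated: it is sin(pi
    x) for the sines, and 1 for products. *)
Variables (w : T -> R) (W : R) (G : set (set T)).
Hypothesis mw : measurable_fun setT w.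
Hypothesis wW : forall x, `|w x| <= W.
Hypothesis w0 : {ae mu, forall x, 0 < w x}.
Hypothesis GI : setI_closed G.
Hypothesis mG : @measurable _ T = <<s G>>.
Hypothesis aw : approximable w.
Hypothesis awG : forall A, G A -> approximable (fun x => w x * \1_A x).

Let mwI A : measurable A -> measurable_fun setT (fun x => w x * \1_A x : R).
Proof. by move=> mA; apply: measurable_funM => //; exact: measurable_indic. Qed.

(** Dynkin's argument: the sets in [H] form a lambda-system, the whole space because [w] is
    approximable and increasing unions by bounded convergence, and [H] contains the pi-system
    [G]. *)
Let approximable_indic A : measurable A -> approximable (fun x => w x * \1_A x).
Proof.
pose H := [set A : set T | measurable A /\ approximable (fun x => w x * \1_A x)].
suff HA : @measurable _ T `<=` H by move=> /HA[].
rewrite [X in X `<=` _]mG; apply: lambda_system_subset => //.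
- split => //.
  + split=> //; rewrite (_ : (fun x => _) = w)//.
    by apply/funext => x; rewrite indicT mulr1.
  + move=> A' B BA [mA aA] [mB aB]; split; first exact: measurableD.
    rewrite (_ : (fun x => _) =
      fun x => w x * \1_A' x + -1 * (w x * \1_B x)).
      apply: approximableD => //; [exact: mwI| |exact: approximableZ (mwI mB) aB].
      by apply: measurable_funM => //; exact: mwI.
    apply/funext => x; rewrite mulN1r -mulrBr; congr (_ * _).
    rewrite !indicE in_setD; have [xB|xB] := boolP (x \in B).
      by rewrite (mem_set (BA _ (set_mem xB)))/= subrr.
    by rewrite andbT subr0.
  + move=> F ndF HF; have mF n : measurable (F n) by case: (HF n).
    have mU : measurable (\bigcup_n F n) by exact: bigcupT_measurable.
    split => //.
    have bd (E : set T) x : `|w x * \1_E x| <= W.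
      rewrite normrM (le_trans _ (wW x))// ler_piMr// indicE.
      by case: (_ \in _); rewrite ?normr1 ?normr0.
    apply: (approximable_bounded_cvg (mwI mU) (fun n => mwI (mF n))) => //.
      by move=> n; case: (HF n).
    apply: aeW => x; apply: cvgM; first exact: cvg_cst.
    have [[n _ Fnx]|nF] := pselect ((\bigcup_n F n) x).
      apply: cvg_near_cst; exists n => // m /= nm.
      rewrite !indicE (mem_set (subsetPset _ _ (ndF _ _ nm) _ Fnx)).
      by rewrite mem_set//; exists n.
    apply: cvg_near_cst; apply: nearW => n; rewrite !indicE !memNset//.
    by move=> Fnx; apply: nF; exists n.
- by move=> E GE; split; [rewrite mG; exact: sub_sigma_algebra|exact: awG].
Qed.

Let approximable_ge0 (phi : T -> R) (C : R) : measurable_fun setT phi ->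
  (forall x, 0 <= phi x <= C) -> approximable (fun x => w x * phi x).
Proof.
move=> mphi phiC.
have mphiE : measurable_fun setT (EFin \o phi) by exact/measurable_EFinP.
pose a := nnsfun_approx measurableT mphiE.
have phi0 x : setT x -> (0 <= (EFin \o phi) x)%E.
  by move=> _; rewrite lee_fin; case/andP: (phiC x).
have cva x : (a n x)%:E @[n --> \oo] --> (phi x)%:E.
  exact: (cvg_nnsfun_approx measurableT mphiE phi0 (x := x)).
have ca x : a n x @[n --> \oo] --> phi x.
  by have /fine_cvgP[_] := cva x.
have ale n x : a n x <= phi x.
  have nd : nondecreasing_seq (fun n => a n x).
    by move=> i j ij; have /lefP := nd_nnsfun_approx measurableT mphiE ij; exact.
  rewrite -(cvg_lim (@Rhausdorff R) (ca x)).
  by apply: nondecreasing_cvgn_le => //; apply/cvg_ex; exists (phi x); exact: ca.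
have ma n : measurable_fun setT (fun x => w x * a n x) by exact: measurable_funM.
apply: (@approximable_bounded_cvg (fun n x => w x * a n x) _ (W * C)) => //.
- exact: measurable_funM.
- move=> n.
  rewrite (_ : (fun x => _) = fun x => \sum_(y <- finmap.enum_fset (fset_set (range (a n))))
      y * (w x * \1_(a n @^-1` [set y]) x)); last first.
    apply/funext => x; rewrite {1}fimfunE fsbig_finite//= mulr_sumr.
    by apply: eq_bigr => y _; rewrite mulrCA.
  have mp y : measurable (a n @^-1` [set y]) by [].
  apply: approximable_sum => y.
    by apply: measurable_funM => //; exact: mwI.
  by apply: approximableZ; [exact: mwI|exact: approximable_indic].
- move=> x; rewrite normrM ler_pM//; case/andP: (phiC x) => p0 pC.
  by rewrite ger0_norm.
- move=> n x; rewrite normrM ler_pM// ger0_norm// (le_trans (ale n x))//.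
  by case/andP: (phiC x).
- by apply: aeW => x; apply: cvgM => //; exact: cvg_cst.
Qed.

Let approximable_bounded (phi : T -> R) (C : R) : measurable_fun setT phi ->
  (forall x, `|phi x| <= C) -> approximable (fun x => w x * phi x).
Proof.
move=> mphi phiC.
have a1 : approximable (fun x => w x * (phi x + C)).
  apply: (approximable_ge0 (C := C + C)); first exact: measurable_funD.
  by move=> x; have := phiC x; rewrite ler_norml => /andP[? ?]; apply/andP; split; lra.
rewrite (_ : (fun x => _) = fun x => w x * (phi x + C) + (- C) * w x).
  apply: approximableD => //.
  - by apply: measurable_funM => //; exact: measurable_funD.
  - exact: measurable_funM.
  - exact: approximableZ.
by apply/funext => x; ring.
Qed.

(** Cut [f] down to the set where |f| <= n and w >= 1/(n+1). There f / w is bounded, so the cut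
    function is [w] times a bounded one; the sets exhaust the space almost everywhere and |f|
    dominates. *)
Lemma approximable_Lq f : measurable_fun setT f -> (N f < +oo)%E -> approximable f.
Proof.
move=> mf Nf.
pose B n := (fun x => `|f x|) @^-1` `]-oo, n%:R] `&` w @^-1` `[n.+1%:R^-1, +oo[.
have mB n : measurable (B n).
  apply: measurableI; rewrite -[X in measurable X]setTI.
    have mnf : measurable_fun setT (fun x => `|f x|) by exact: measurableT_comp.
    by apply: mnf => //; exact: measurable_itv.
  by apply: mw => //; exact: measurable_itv.
have BP n x : B n x <-> `|f x| <= n%:R /\ n.+1%:R^-1 <= w x.
  by rewrite /B /= !in_itv/= andbT.
(* The power -1 is measurable on the whole line and agrees with the inverse on [B n], where [w] is
   positive. *)
pose phi n x := f x * (w x `^ (-1)) * \1_(B n) x.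
have mphi n : measurable_fun setT (phi n).
  apply: measurable_funM; last exact: measurable_indic.
  apply: measurable_funM => //.
  exact: (measurableT_comp (measurable_powR _)).
have phiE n x : w x * phi n x = f x * \1_(B n) x.
  rewrite /phi indicE; have [/set_mem/BP[_ wn]|xB] := boolP (x \in B n).
    have wx0 : 0 < w x by rewrite (lt_le_trans _ wn)// invr_gt0.
    by rewrite !mulr1 powR_inv1 ?(ltW wx0)// mulrCA divff ?mulr1// gt_eqF.
  by rewrite !mulr0.
have aphi n : approximable (fun x => w x * phi n x).
  apply: (approximable_bounded (C := n%:R * n.+1%:R)) => // x.
  rewrite /phi indicE; have [/set_mem/BP[fn wn]|xB] := boolP (x \in B n).
    have wx0 : 0 < w x by rewrite (lt_le_trans _ wn)// invr_gt0.
    rewrite mulr1 powR_inv1 ?(ltW wx0)// normrM ler_pM// ger0_norm ?invr_ge0 ?(ltW wx0)//.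
    by rewrite invf_ple ?posrE.
  by rewrite mulr0 normr0 mulr_ge0.
apply: (approximable_dominated mf _ aphi mf Nf) => [n|n x|].
- exact: measurable_funM.
- rewrite phiE -{1}[f x]mulr1 -mulrBr normrM ler_piMr// indicE.
  by case: (_ \in _); rewrite ?subrr ?subr0 ?normr0 ?normr1.
- move: w0; apply: filterS => x wx0.
  pose n0 := maxn (Num.truncn `|f x|).+1 (Num.truncn (w x)^-1).+1.
  apply: cvg_near_cst; exists n0 => // n /= n0n.
  rewrite phiE indicE mem_set ?mulr1//; apply/BP; split.
    rewrite (le_trans (ltW (truncnS_gt _)))// ler_nat.
    by rewrite (leq_trans _ n0n)// leq_maxl.
  rewrite invf_ple ?posrE// (le_trans (ltW (truncnS_gt _)))// ler_nat.
  by rewrite (leq_trans _ (leqW n0n))// leq_maxr.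
Qed.

End density.
End approximation.

(** * Biorthogonal systems and bases *)

Definition mbox n (m : mindex n) : seq (mindex n) :=
  finmap.enum_fset (fset_set [set k | mindex_le k m]).

Lemma mem_mbox n (k m : mindex n) : (k \in mbox m) = `[< mindex_le k m >].
Proof.
rewrite /mbox in_fset_set ?inE//; last exact: finite_mindex_le.
Qed.

Lemma uniq_mbox n (m : mindex n) : uniq (mbox m).
Proof. exact: finmap.fset_uniq. Qed.

Section pairing.
Context d {T : measurableType d} {R : realType} {K : Type}.
Variable mu : {measure set T -> \bar R}.

Definition coef_proj (e g : K -> T -> R) (s : seq K) (f : T -> R) (x : T) :=
  \sum_(k <- s) (\int[mu]_y (f y * g k y)) * e k x.

End pairing.

Definition bounded_measurable {d} {T : measurableType d} {R : realType}
  (f : T -> R) := measurable_fun setT f /\ exists2 C : R, 0 <= C & forall x, `|f x| <= C.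

Section basis_criterion.
Context d {T : measurableType d} {R : realType}.
Variables (mu : {measure set T -> \bar R}) (q : R) (n : nat).
Hypothesis mu1 : mu [set: T] = 1%E.
Hypothesis q1 : 1 < q.
Variables e g : mindex n -> T -> R.
Local Notation N f := (Lnorm mu q%:E (EFin \o f%R)).
Hypothesis be : forall k, bounded_measurable (e k).
Hypothesis bg : forall k, bounded_measurable (g k).
Hypothesis biorth : forall k l, \int[mu]_x (e k x * g l x) = (k == l)%:R.
Hypothesis unif : exists2 C : R, 0 <= C &
  forall m f, measurable_fun setT f -> (N f < +oo)%E ->
    (N (coef_proj mu e g (mbox m) f) <= C%:E * N f)%E.
Hypothesis dense : forall f, measurable_fun setT f -> (N f < +oo)%E ->
  approximable mu q e f.

Let me k : measurable_fun setT (e k). Proof. by case: (be k). Qed.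
Let mg k : measurable_fun setT (g k). Proof. by case: (bg k). Qed.

Let bounded_Lq f : bounded_measurable f -> (N f < +oo)%E.
Proof.
by move=> [mf [C _ fC]]; rewrite (le_lt_trans (Lnorm_le_sup mu1 q1 mf fC))// ltry.
Qed.

Let int_fg f k : measurable_fun setT f -> (N f < +oo)%E ->
  mu.-integrable setT (EFin \o (fun x => f x * g k x)).
Proof.
by move=> mf Nf; have [_ [C _ gC]] := bg k;
  exact: (integrable_mul_bounded mu1 q1 mf Nf (mg k) gC).
Qed.

Lemma partial_sumE (a : mindex n -> R) m x :
  partial_sum e a m x = \sum_(k <- mbox m) a k * e k x.
Proof. by rewrite /partial_sum fsbig_finite//; exact: finite_mindex_le. Qed.

Let mps a m : measurable_fun setT (partial_sum e a m).
Proof.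
rewrite (funext (partial_sumE a m)).
by apply: measurable_sum => k; exact: measurable_funM.
Qed.

Let Nps a m : (N (partial_sum e a m) < +oo)%E.
Proof.
rewrite (funext (partial_sumE a m)).
apply: le_lt_trans (Lnorm_sum mu1 q1 _ _) _ => [k|].
  exact: measurable_funM.
elim: (mbox m) => [|k s IH]; first by rewrite big_nil ltry.
rewrite big_cons lte_add_pinfty// Lnorm_scale//.
by rewrite lte_mul_pinfty// bounded_Lq.
Qed.

(** The map [F] covers both uses: partial sums, with [F] the identity, and the lists of [lincomb],
    where an index may repeat. *)
Let pair_sum (I : Type) (s : seq I) (F : I -> mindex n) (a : I -> R) k :
  \int[mu]_x ((\sum_(i <- s) a i * e (F i) x) * g k x) =
  \sum_(i <- s) a i * (F i == k)%:R.
Proof.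
have mS (t : seq I) : measurable_fun setT (fun x => \sum_(i <- t) a i * e (F i) x).
  by apply: measurable_sum => i; exact: measurable_funM.
have NS (t : seq I) : (N (fun x => \sum_(i <- t) a i * e (F i) x)%R < +oo)%E.
  apply: le_lt_trans (Lnorm_sum mu1 q1 _ _) _ => [i|].
    exact: measurable_funM.
  elim: t => [|i t IH]; first by rewrite big_nil ltry.
  rewrite big_cons lte_add_pinfty// Lnorm_scale//.
  by rewrite lte_mul_pinfty// bounded_Lq.
elim: s => [|i s IH].
  under eq_Rintegral do rewrite big_nil mul0r.
  by rewrite big_nil Rintegral_cst// mul0r.
under eq_Rintegral do rewrite big_cons mulrDl -mulrA.
rewrite big_cons RintegralD//; last 2 first.
- have := integrableZl measurableT (a i) (int_fg k (me (F i)) (bounded_Lq (be (F i)))).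
  by apply: eq_integrable.
- exact: int_fg.
rewrite IH RintegralZl ?biorth//.
exact: int_fg (me _) (bounded_Lq (be _)).
Qed.

Lemma partial_sum_coef a m k : mindex_le k m ->
  \int[mu]_x (partial_sum e a m x * g k x) = a k.
Proof.
move=> km; under eq_Rintegral do rewrite partial_sumE.
rewrite (pair_sum _ id) (bigD1_seq k) ?uniq_mbox//=; last first.
  by rewrite mem_mbox; apply/asboolP.
rewrite eqxx mulr1 big1 ?addr0// => i ik.
by rewrite (negbTE ik) mulr0.
Qed.

(** Uniqueness: pairing with [g k] is continuous on L_q and takes the value [a k] on every partial
    sum whose box contains [k]. *)
Lemma expansion_coef (f : T -> R) a : measurable_fun setT f -> (N f < +oo)%E ->
  pringsheim_expansion mu q e f a ->
  a = fun k => \int[mu]_x (f x * g k x).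
Proof.
move=> mf Nf fa; apply/funext => k.
have [_ [C C0 gC]] := bg k.
apply/eqP; rewrite -subr_eq0 -normr_le0; apply/ler_addgt0Pr => eps eps0; rewrite add0r.
(* The [+ 1] covers [C = 0]. *)
have e1 : 0 < eps / (C + 1) by rewrite divr_gt0// ltr_wpDl.
move: fa => /fine_cvgP[fin /cvgrPdist_lt/(_ _ e1) small].
have big_m : \forall m \near pringsheim n, mindex_le k m.
  exists (\max_(i < n) val (tnth k i)) => // m /= mk i.
  by apply: leq_trans (mk i); exact: leq_bigmax.
have [m [[fm sm] km]] := filter_ex (filterI (filterI fin small) big_m).
have mfs : measurable_fun setT (f \- partial_sum e a m) by exact: measurable_funB.
have Nfs : (N (f \- partial_sum e a m) < +oo)%E.
  by rewrite (le_lt_trans (Lnorm_sub mu q1 mf (mps a m)))// lte_add_pinfty.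
have := Lnorm_pairing mu1 q1 C0 mfs Nfs (mg k) gC.
under eq_Rintegral do rewrite mulrBl.
rewrite RintegralB//; [|exact: int_fg|exact: int_fg].
rewrite partial_sum_coef// distrC => /le_trans => H.
move: sm; rewrite /= sub0r normrN => /(le_lt_trans (ler_norm _)) sm.
rewrite -lee_fin; apply: H.
rewrite -(fineK fm) -EFinM lee_fin.
rewrite (@le_trans _ _ (C * (eps / (C + 1))))// ?ler_wpM2l// ?(ltW sm)//.
by rewrite mulrCA ger_pMr// ler_pdivrMr ?mul1r ?lerDl// ltr_wpDl.
Qed.

Let coef_projE (f : T -> R) m x :
  coef_proj mu e g (mbox m) f x =
  partial_sum e (fun k => \int[mu]_x (f x * g k x)) m x.
Proof. by rewrite partial_sumE. Qed.

Let coef_proj_lincomb (s : seq (mindex n * R)) m :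
  (forall p, p \in s -> mindex_le p.1 m) ->
  coef_proj mu e g (mbox m) (lincomb e s) =1 lincomb e s.
Proof.
move=> sm x; rewrite /coef_proj.
under eq_bigr do rewrite (pair_sum s (fun p => p.1) (fun p => p.2)) mulr_suml.
rewrite exchange_big/= /lincomb; apply: eq_big_seq => p /sm pm.
rewrite (bigD1_seq p.1) ?uniq_mbox//=; last first.
  by rewrite mem_mbox; apply/asboolP.
rewrite eqxx mulr1 big1 ?addr0// => i ip.
by rewrite eq_sym (negbTE ip) mulr0 mul0r.
Qed.

Let coef_projB (f h : T -> R) m x : measurable_fun setT f -> (N f < +oo)%E ->
  measurable_fun setT h -> (N h < +oo)%E ->
  coef_proj mu e g (mbox m) (f \- h) x =
  coef_proj mu e g (mbox m) f x - coef_proj mu e g (mbox m) h x.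
Proof.
move=> mf Nf mh Nh; rewrite /coef_proj -sumrB; apply: eq_bigr => k _.
rewrite -mulrBl; congr (_ * _).
rewrite -RintegralB//; [|exact: int_fg|exact: int_fg].
by apply: eq_Rintegral => y _; rewrite mulrBl.
Qed.

(** The projection of a large box fixes a given linear combination s, so f - P_m f = (f - s) - P_m
    (f - s), of norm at most (1 + C) times that of f - s. *)
Lemma coef_expansion (f : T -> R) : measurable_fun setT f -> (N f < +oo)%E ->
  pringsheim_expansion mu q e f (fun k => \int[mu]_x (f x * g k x)).
Proof.
move=> mf Nf; have [C C0 PC] := unif.
rewrite /pringsheim_expansion.
have small (eps : R) : 0 < eps -> \forall m \near pringsheim n,
    (N (f \- partial_sum e (fun k => \int[mu]_x (f x * g k x)) m) <= eps%:E)%E.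
  move=> eps0; have e1 : 0 < eps / (C + 1) by rewrite divr_gt0// ltr_wpDl.
  have [s Ns] := dense mf Nf e1.
  have ms : measurable_fun setT (lincomb e s) by exact: measurable_lincomb.
  have mfs : measurable_fun setT (f \- lincomb e s) by exact: measurable_funB.
  have Nfs : (N (f \- lincomb e s) < +oo)%E by rewrite (le_lt_trans Ns)// ltry.
  have Nls : (N (lincomb e s) < +oo)%E.
    rewrite (_ : lincomb e s = f \- (f \- lincomb e s)); last first.
      by apply/funext => x /=; rewrite subKr.
    by rewrite (le_lt_trans (Lnorm_sub mu q1 mf mfs))// lte_add_pinfty.
  exists (\max_(p <- s) \max_(i < n) val (tnth p.1 i)) => // m /= sm.
  have sm' p : p \in s -> mindex_le p.1 m.
    move=> ps i; apply: leq_trans (sm i).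
    rewrite (leq_trans (@leq_bigmax _ (fun i => val (tnth p.1 i)) i))//.
    exact: (@leq_bigmax_seq _ s xpredT (fun p => \max_(i < n) val (tnth p.1 i)) p ps).
  rewrite (_ : _ \- _ = (f \- lincomb e s) \- coef_proj mu e g (mbox m) (f \- lincomb e s)).
    have mP : measurable_fun setT (coef_proj mu e g (mbox m) (f \- lincomb e s)).
      by apply: measurable_sum => k; exact: measurable_funM.
    rewrite (le_trans (Lnorm_sub mu q1 mfs mP))//.
    rewrite (le_trans (leeD2l _ (PC m _ mfs Nfs)))//.
    rewrite -[X in (X + _)%E]mul1e -muleDl//; last first.
      rewrite ge0_fin_numE ?Lnorm_ge0//.
    rewrite (@le_trans _ _ ((C + 1)%:E * (eps / (C + 1))%:E)%E)//.
      by rewrite addrC -EFinD lee_wpmul2l ?lee_fin ?addr_ge0.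
    by rewrite -EFinM lee_fin mulrC divfK// gt_eqF// ltr_wpDl.
  apply/funext => x /=; rewrite coef_projB// coef_proj_lincomb// coef_projE.
  by rewrite opprB addrA subrK.
have fin m (eps : R) :
    (N (f \- partial_sum e (fun k => \int[mu]_x (f x * g k x)) m) <= eps%:E)%E ->
    N (f \- partial_sum e (fun k => \int[mu]_x (f x * g k x)) m) \is a fin_num.
  by move=> Nm; rewrite ge0_fin_numE ?Lnorm_ge0// (le_lt_trans Nm)// ltry.
apply/fine_cvgP; split.
  by apply: filterS (small _ ltr01) => m; exact: fin.
apply/cvgrPdist_le => eps eps0; apply: filterS (small _ eps0) => m Nm.
rewrite sub0r normrN ger0_norm ?fine_ge0 ?Lnorm_ge0//=.
by rewrite -lee_fin fineK//; exact: fin Nm.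
Qed.

Lemma basis_criterion : pringsheim_schauder_basis mu q e.
Proof.
split=> [k|f /LfunP2[mf Nf]].
  by apply/LfunP2; split; [exact: me|exact: bounded_Lq].
exists (fun k => \int[mu]_x (f x * g k x)); split; first exact: coef_expansion.
by move=> a /(expansion_coef mf Nf).
Qed.

End basis_criterion.

(** * Tensor products of biorthogonal systems *)

Section pnorm_bounds.
Context d {T : measurableType d} {R : realType}.
Variables (mu : {measure set T -> \bar R}) (q : R).
Hypothesis q1 : 1 < q.
Local Notation N f := (Lnorm mu q%:E (EFin \o f%R)).
Local Notation pint f := (\int[mu]_x (`|f x| `^ q)%:E)%E.

Let q0 : 0 < q. Proof. exact: lt_trans q1. Qed.

Lemma pintE (f : T -> R) : pint f = (N f `^ q)%E.
Proof.
rewrite LnormEpow -poweRrM mulVf ?gt_eqF// poweRe1//.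
by apply: integral_ge0 => x _; rewrite lee_fin powR_ge0.
Qed.

Lemma pint_le_Lnorm (f g : T -> R) (C : R) : 0 <= C ->
  (pint f <= C%:E * pint g)%E -> (N f <= (C `^ q^-1)%:E * N g)%E.
Proof.
move=> C0 fg; have i0 h : (0 <= pint h)%E.
  by apply: integral_ge0 => x _; rewrite lee_fin powR_ge0.
rewrite !LnormEpow -poweR_EFin -poweRM ?lee_fin//.
apply: gt0_ler_poweR => //; first by rewrite invr_ge0 ltW.
- by rewrite in_itv/= leey i0.
- by rewrite in_itv/= leey mule_ge0.
Qed.

(** Meant for sections, whose norm may be infinite. With [C + 1] the factor is positive even if
    [C = 0], so the right-hand side is then infinite rather than 0 times infinity. *)
Lemma Lnorm_le_pint (f g : T -> R) (C : R) : 0 <= C ->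
  ((N g < +oo)%E -> (N f <= C%:E * N g)%E) ->
  (pint f <= ((C + 1) `^ q)%:E * pint g)%E.
Proof.
move=> C0 fg; have C1 : 0 < C + 1 by rewrite ltr_wpDl.
rewrite !pintE.
have [Ng|] := ltP (N g) +oo%E; last first.
  by rewrite leye_eq => /eqP ->; rewrite poweRyr ?gt_eqF// gt0_muley ?leey// lte_fin powR_gt0.
rewrite -poweR_EFin -poweRM ?lee_fin ?(ltW C1) ?Lnorm_ge0//.
apply: gt0_ler_poweR; first exact: ltW.
- by rewrite in_itv/= leey Lnorm_ge0.
- by rewrite in_itv/= leey mule_ge0 ?Lnorm_ge0// lee_fin ltW.
rewrite (le_trans (fg Ng))// lee_wpmul2r ?Lnorm_ge0// lee_fin lerDl//.
Qed.

End pnorm_bounds.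

Section product_integrals.
Context d1 d2 {T1 : measurableType d1} {T2 : measurableType d2} {R : realType}.
Variable m1 : {sigma_finite_measure set T1 -> \bar R}.
Variable m2 : {sigma_finite_measure set T2 -> \bar R}.

(** The inner integral may fail to be finite on a null set of [x]; there [fine] makes it 0, which
    does not change the outer integral. *)
Lemma Rintegral_fubini1 (f : T1 * T2 -> R) :
  (m1 \x m2)%E.-integrable setT (EFin \o f) ->
  [/\ m1.-integrable setT (EFin \o (fun x => \int[m2]_y f (x, y))) &
    \int[(m1 \x m2)%E]_z f z = \int[m1]_x \int[m2]_y f (x, y)].
Proof.
move=> fi; pose F := fubini_F m2 (EFin \o f).
have Fi : m1.-integrable setT F by exact: integrable_fubini_F.
have mF : measurable_fun setT F by case/integrableP: Fi.
have EF : (fun x => \int[m2]_y f (x, y)) = fine \o F by [].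
have mfF : measurable_fun setT (EFin \o (fine \o F)).
  by apply/measurable_EFinP; exact: measurableT_comp.
have fiF : m1.-integrable setT (EFin \o (fine \o F)).
  apply: (le_integrable measurableT mfF _ Fi) => x _ /=.
  by case: (F x) => [r||] /=; rewrite ?normr0 ?leey.
split => //.
rewrite EF /Rintegral; congr fine.
transitivity (\int[m1]_x F x)%E; first by rewrite -integral12_prod_meas1.
apply: ae_eq_integral => //.
have := integrable_ae measurableT Fi; apply: filterS => x /(_ I) Fx _.
by rewrite /= fineK.
Qed.

Lemma Lnorm_tensor (q : R) (F : T1 -> R) (G : T2 -> R) : 1 < q ->
  measurable_fun setT F -> measurable_fun setT G ->
  ('N[m1 \x m2]_(q%:E)[EFin \o (fun z => F z.1 * G z.2)%R] =
   'N[m1]_(q%:E)[EFin \o F] * 'N[m2]_(q%:E)[EFin \o G])%E.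
Proof.
move=> q1 mF mG; have q0 : 0 < q by exact: lt_trans q1.
have m12 : measurable_fun setT (fun z : T1 * T2 => F z.1 * G z.2).
  by apply: measurable_funM; [exact: (measurableT_comp mF)|exact: (measurableT_comp mG)].
rewrite !LnormEpow -poweRM; [|exact: integral_ge0..].
congr (_ `^ _)%E; rewrite fubini_tonelli1//; last first.
  by apply/measurable_EFinP; exact: measurable_normr_powR.
rewrite /fubini_F /=.
under eq_integral => x _.
  under eq_integral do rewrite normrM powRM// EFinM.
  rewrite ge0_integralZl_EFin ?powR_ge0//; last first.
    by apply/measurable_EFinP; exact: measurable_normr_powR.
  over.
rewrite ge0_integralZr//=.
- by apply/measurable_EFinP; exact: measurable_normr_powR.
- exact: integral_ge0.
Qed.

End product_integrals.

Definition uniformly_bounded {d} {T : measurableType d} {R : realType} {K D : Type}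
    (box : D -> seq K) (mu : {measure set T -> \bar R}) (q : R)
    (e g : K -> T -> R) :=
  exists2 C : R, 0 <= C & forall m (f : T -> R), measurable_fun setT f ->
    ('N[mu]_(q%:E)[EFin \o f] < +oo)%E ->
    ('N[mu]_(q%:E)[EFin \o coef_proj mu e g (box m) f]
       <= C%:E * 'N[mu]_(q%:E)[EFin \o f])%E.

(** The hypotheses of the basis criterion, for arbitrary index types and boxes, so that they pass to
    products and survive relabelling. *)
Definition good_system {d} {T : measurableType d} {R : realType} {K : eqType} {D : Type}
    (box : D -> seq K) (mu : {measure set T -> \bar R}) (q : R) (e g : K -> T -> R) :=
  [/\ (forall k, bounded_measurable (e k)) /\ (forall k, bounded_measurable (g k)),
      forall k l, \int[mu]_x (e k x * g l x) = (k == l)%:R,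
      uniformly_bounded box mu q e g &
      forall f, measurable_fun setT f -> ('N[mu]_(q%:E)[EFin \o f] < +oo)%E ->
        approximable mu q e f].

Section product_system.
Context d1 d2 {T1 : measurableType d1} {T2 : measurableType d2} {R : realType}.
Context {K1 K2 : eqType} {D1 D2 : Type}.
Variables (box1 : D1 -> seq K1) (box2 : D2 -> seq K2).
Variable m1 : {sigma_finite_measure set T1 -> \bar R}.
Variable m2 : {sigma_finite_measure set T2 -> \bar R}.
Hypothesis m11 : m1 setT = 1%E.
Hypothesis m21 : m2 setT = 1%E.
Variable q : R.
Hypothesis q1 : 1 < q.
Variables (e1 g1 : K1 -> T1 -> R) (e2 g2 : K2 -> T2 -> R).
Hypothesis good1 : good_system box1 m1 q e1 g1.
Hypothesis good2 : good_system box2 m2 q e2 g2.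

Definition tensor {K L S T : Type} (e : K -> S -> R) (f : L -> T -> R)
  (k : K * L) (z : S * T) : R := e k.1 z.1 * f k.2 z.2.

Definition prod_box (m : D1 * D2) :=
  [seq (k1, k2) | k1 <- box1 m.1, k2 <- box2 m.2].

Local Notation mu := (m1 \x m2)%E.

Lemma product_mass1 : mu setT = 1%E.
Proof. rewrite -setXTT; apply: etrans (product_measure1E m1 m2 measurableT measurableT) _.
by rewrite [X in (X * _)%E]m11 [X in (_ * X)%E]m21 mule1. Qed.

Lemma bounded_measurable_tensor (F : T1 -> R) (G : T2 -> R) :
  bounded_measurable F -> bounded_measurable G ->
  bounded_measurable (fun z => F z.1 * G z.2).
Proof.
move=> [mF [C C0 FC]] [mG [D D0 GD]]; split.
  by apply: measurable_funM; [exact: (measurableT_comp mF)|exact: (measurableT_comp mG)].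
exists (C * D) => [|x]; first by rewrite mulr_ge0.
by rewrite normrM ler_pM.
Qed.

Let bm_Lq d (T : measurableType d) (m : {measure set T -> \bar R}) (f : T -> R) :
  m setT = 1%E -> bounded_measurable f -> ('N[m]_(q%:E)[EFin \o f] < +oo)%E.
Proof.
by move=> mT [mf [C _ fC]]; rewrite (le_lt_trans (Lnorm_le_sup mT q1 mf fC))// ltry.
Qed.

Let bm_integrable d (T : measurableType d) (m : {measure set T -> \bar R}) (f : T -> R) :
  m setT = 1%E -> bounded_measurable f -> m.-integrable setT (EFin \o f).
Proof.
by move=> mT bf; apply: (Lfun_integrable1 mT q1); [case: bf|exact: bm_Lq].
Qed.

Lemma product_biorth k l :
  \int[mu]_z (tensor e1 e2 k z * tensor g1 g2 l z) = (k == l)%:R.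
Proof.
have [[be1 bg1] bi1 _ _] := good1; have [[be2 bg2] bi2 _ _] := good2.
have bmM d (T : measurableType d) (f h : T -> R) : bounded_measurable f ->
    bounded_measurable h -> bounded_measurable (fun x => f x * h x).
  move=> [mf [C C0 fC]] [mh [D D0 hD]]; split; first exact: measurable_funM.
  by exists (C * D) => [|x]; [rewrite mulr_ge0|rewrite normrM ler_pM].
have b1 := bmM _ _ _ _ (be1 k.1) (bg1 l.1).
have b2 := bmM _ _ _ _ (be2 k.2) (bg2 l.2).
rewrite /tensor; under eq_Rintegral do rewrite mulrACA.
rewrite (proj2 (Rintegral_fubini1 (bm_integrable product_mass1
  (bounded_measurable_tensor b1 b2))))/=.
under eq_Rintegral => x _.
  rewrite RintegralZl//; last exact: bm_integrable.
  rewrite bi2; over.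
rewrite RintegralZr ?bi1//; last exact: bm_integrable.
rewrite -natrM mulnb; congr (_%:R); congr nat_of_bool.
Qed.

(** By the density lemma with weight 1 and the pi-system of rectangles, only products of two
    indicators have to be approximated. *)
Lemma product_approximable f : measurable_fun setT f ->
  ('N[mu]_(q%:E)[EFin \o f] < +oo)%E -> approximable mu q (tensor e1 e2) f.
Proof.
have [[be1 _] _ _ dense1] := good1; have [[be2 _] _ _ dense2] := good2.
have me k : measurable_fun setT (tensor e1 e2 k).
  by have [] := bounded_measurable_tensor (be1 k.1) (be2 k.2).
have me1 k : measurable_fun setT (e1 k) by case: (be1 k).
have me2 k : measurable_fun setT (e2 k) by case: (be2 k).
pose G := [set A `*` B | A in @measurable _ T1 & B in @measurable _ T2].
have bI d (T : measurableType d) (A : set T) : measurable A ->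
    bounded_measurable (\1_A : T -> R).
  move=> mA; split; first exact: measurable_indic.
  by exists 1 => // x; rewrite indicE; case: (_ \in _); rewrite ?normr1 ?normr0.
have rect A B : measurable A -> measurable B ->
    approximable mu q (tensor e1 e2) (fun z => \1_A z.1 * \1_B z.2).
  move=> mA mB eps eps0; have e2' : 0 < eps / 2 by rewrite divr_gt0.
  have [mIA _] := bI _ _ _ mA; have [mIB _] := bI _ _ _ mB.
  have NA := bm_Lq m11 (bI _ _ _ mA); have NB := bm_Lq m21 (bI _ _ _ mB).
  have [s Ns] := dense1 _ mIA NA _ e2'.
  have ms := measurable_lincomb me1 s.
  have NsE : ('N[m1]_(q%:E)[EFin \o lincomb e1 s] < +oo)%E.
    rewrite (_ : lincomb e1 s = \1_A \- (\1_A \- lincomb e1 s)); last first.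
      by apply/funext => x /=; rewrite subKr.
    have mAs : measurable_fun setT (\1_A \- lincomb e1 s) by exact: measurable_funB.
    rewrite (le_lt_trans (Lnorm_sub m1 q1 mIA mAs))// lte_add_pinfty//.
    by rewrite (le_lt_trans Ns)// ltry.
  have /fineK NsF : ('N[m1]_(q%:E)[EFin \o lincomb e1 s])%E \is a fin_num.
    by rewrite ge0_fin_numE// Lnorm_ge0.
  set L := fine _ in NsF; have L0 : 0 <= L by rewrite fine_ge0// Lnorm_ge0.
  (* The error is (1_A - s) 1_B + s (1_B - t), so the precision required of [t] depends on the norm
     [L] of the already chosen [s]. *)
  have e3 : 0 < eps / 2 / (L + 1) by rewrite divr_gt0// ltr_wpDl.
  have [t Nt] := dense2 _ mIB NB _ e3.
  have mt := measurable_lincomb me2 t.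
  exists [seq ((p.1, r.1), p.2 * r.2) | p <- s, r <- t].
  rewrite (_ : _ \- _ = (fun z => (\1_A \- lincomb e1 s) z.1 * \1_B z.2) \+
     (fun z => lincomb e1 s z.1 * (\1_B \- lincomb e2 t) z.2)); last first.
    apply/funext => z /=.
    have -> : lincomb (tensor e1 e2) [seq ((p.1, r.1), p.2 * r.2) | p <- s, r <- t] z
        = lincomb e1 s z.1 * lincomb e2 t z.2.
      rewrite /lincomb big_allpairs_dep mulr_suml; apply: eq_bigr => p _.
      by rewrite mulr_sumr; apply: eq_bigr => r _; rewrite /tensor/= mulrACA.
    by ring.
  have mAs : measurable_fun setT (\1_A \- lincomb e1 s) by exact: measurable_funB.
  have mBt : measurable_fun setT (\1_B \- lincomb e2 t) by exact: measurable_funB.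
  have mz (F : T1 -> R) (H : T2 -> R) : measurable_fun setT F ->
      measurable_fun setT H -> measurable_fun setT (fun z : T1 * T2 => F z.1 * H z.2).
    by move=> mF mH; apply: measurable_funM;
      [exact: (measurableT_comp mF)|exact: (measurableT_comp mH)].
  rewrite (le_trans (minkowski_EFin mu (mz _ _ mAs mIB) (mz _ _ ms mBt) (ltW q1)))//.
  rewrite !Lnorm_tensor// [eps in leRHS]splitr EFinD leeD//.
    rewrite -[leRHS]mule1 lee_pmul ?Lnorm_ge0//.
    apply: Lnorm_le_sup => // x; rewrite indicE.
    by case: (_ \in _); rewrite ?normr1 ?normr0.
  have L0' : (0 <= L%:E)%E by rewrite lee_fin.
  rewrite -NsF; apply: (le_trans (lee_wpmul2l L0' Nt)).
  by rewrite -EFinM lee_fin mulrCA ger_pMr// ler_pdivrMr ?mul1r ?lerDl// ltr_wpDl.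
apply: (approximable_Lq product_mass1 q1 me (w := cst 1) (W := 1) (G := G)) => //.
- by move=> x; rewrite normr1.
- by apply: aeW => x /=.
- move=> X Y [A mA [B mB <-]] [A' mA' [B' mB' <-]].
  exists (A `&` A'); first exact: measurableI.
  by exists (B `&` B'); [exact: measurableI|rewrite setXI].
- exact: measurable_prod_measurableType.
- rewrite (_ : cst 1 = fun z : T1 * T2 => \1_[set: T1] z.1 * \1_[set: T2] z.2).
    exact: rect.
  by apply/funext => z; rewrite !indicT mulr1.
- move=> _ [A mA [B mB <-]].
  rewrite (_ : (fun x => _) = fun z : T1 * T2 => \1_A z.1 * \1_B z.2); first exact: rect.
  apply/funext => -[x y] /=; rewrite mul1r !indicE in_setX -natrM mulnb.
  by [].
Qed.

Let msec1 (f : T1 * T2 -> R) x : measurable_fun setT f ->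
  measurable_fun setT (fun y => f (x, y)).
Proof. by move=> mf; exact: (measurableT_comp mf (measurable_pair1 x)). Qed.

Let msec2 (f : T1 * T2 -> R) y : measurable_fun setT f ->
  measurable_fun setT (fun x => f (x, y)).
Proof. by move=> mf; exact: (measurableT_comp mf (measurable_pair2 y)). Qed.

(** The projection acts in [y] and then in [x]: [h] is the second projection applied to the sections
    of [f], and [P] is the first one applied to the sections of [h]. Each one-variable bound, raised
    to the power q, is integrated over the other variable by Tonelli. *)
Lemma product_uniformly_bounded :
  uniformly_bounded prod_box mu q (tensor e1 e2) (tensor g1 g2).
Proof.
have [[be1 bg1] _ [C1 C10 unif1] _] := good1.
have [[be2 bg2] _ [C2 C20 unif2] _] := good2.
pose A1 := (C1 + 1) `^ q; pose A2 := (C2 + 1) `^ q.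
have A10 : 0 <= A1 by exact: powR_ge0.
have A20 : 0 <= A2 by exact: powR_ge0.
exists ((A1 * A2) `^ q^-1) => [|[b1 b2] f mf Nf]; first exact: powR_ge0.
apply: pint_le_Lnorm => //; first exact: mulr_ge0.
have mg1 k : measurable_fun setT (fun z : T1 * T2 => g1 k z.1).
  by have [mk _] := bg1 k; exact: (measurableT_comp mk).
have mg2 k : measurable_fun setT (fun z : T1 * T2 => g2 k z.2).
  by have [mk _] := bg2 k; exact: (measurableT_comp mk).
pose phi k x := \int[m2]_y (f (x, y) * g2 k y).
have ifg2 k : mu.-integrable setT (EFin \o (fun z => f z * g2 k z.2)).
  have [_ [C _ gC]] := bg2 k.
  exact: (integrable_mul_bounded product_mass1 q1 mf Nf (mg2 k) (fun z => gC z.2)).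
have iphi k : m1.-integrable setT (EFin \o phi k).
  by have [] := Rintegral_fubini1 (ifg2 k).
have mphi k : measurable_fun setT (phi k).
  by have /integrableP[/measurable_EFinP] := iphi k.
have iphig k l : m1.-integrable setT (EFin \o (fun x => phi k x * g1 l x)).
  have [ml [C C0 gC]] := bg1 l.
  apply: (le_integrable measurableT _ _ (integrableZl measurableT C (iphi k))).
    by apply/measurable_EFinP; exact: measurable_funM.
  move=> x _ /=; rewrite lee_fin !normrM mulrC ler_wpM2r//.
  by rewrite (le_trans (gC x))// ler_norm.
(* Taking [g1 k x] out of the inner integral needs an integrable section, which exists only for
   almost every [x]. *)
have coefE k l : \int[mu]_z (f z * (g1 k z.1 * g2 l z.2)) =
    \int[m1]_x (phi l x * g1 k x).
  have i12 : mu.-integrable setT (EFin \o (fun z => (f z * g2 l z.2) * g1 k z.1)).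
    have [_ [C C0 gC]] := bg1 k.
    apply: (le_integrable measurableT _ _ (integrableZl measurableT C (ifg2 l))).
      apply/measurable_EFinP; apply: measurable_funM => //.
      exact: measurable_funM.
    move=> x _ /=; rewrite lee_fin normrM [leRHS]normrM mulrC ler_wpM2r//.
    by rewrite (le_trans (gC x.1))// ler_norm.
  under eq_Rintegral do rewrite (mulrC (g1 k _)) mulrA.
  rewrite (proj2 (Rintegral_fubini1 i12)).
  congr fine; apply: ae_eq_integral => //.
  - have [] := Rintegral_fubini1 i12; by move=> /integrableP[].
  - by have /integrableP[] := iphig l k.
  have := ae_integrable1 (ifg2 l); apply: filterS => x ix _ /=.
  by rewrite RintegralZr.
pose P := coef_proj mu (tensor e1 e2) (tensor g1 g2) (prod_box (b1, b2)) f.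
pose h z := \sum_(l <- box2 b2) phi l z.1 * e2 l z.2.
have mh : measurable_fun setT h.
  apply: measurable_sum => l; apply: measurable_funM.
    exact: (measurableT_comp (mphi l)).
  by have [ml _] := be2 l; exact: (measurableT_comp ml).
have PE x y : P (x, y) = coef_proj m1 e1 g1 (box1 b1) (fun x => h (x, y)) x.
  rewrite /P /coef_proj /prod_box big_allpairs_dep; apply: eq_bigr => k _ /=.
  have intsum (s : seq K2) :
      m1.-integrable setT (EFin \o (fun x => (\sum_(l <- s) phi l x * e2 l y) * g1 k x)) /\
      \int[m1]_x ((\sum_(l <- s) phi l x * e2 l y) * g1 k x) =
      \sum_(l <- s) \int[m1]_x (phi l x * g1 k x) * e2 l y.
    elim: s => [|l s [IHi IH]].
      rewrite big_nil; split; last first.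
        under eq_Rintegral do rewrite big_nil mul0r.
        by rewrite Rintegral_cst// mul0r.
      apply: (eq_integrable measurableT (cst 0%E)); last exact: integrable0.
      by move=> x' _ /=; rewrite big_nil mul0r.
    have il : m1.-integrable setT (EFin \o (fun x => (phi l x * g1 k x) * e2 l y)).
      apply: eq_integrable (integrableZl measurableT (e2 l y) (iphig l k)) => //.
      by move=> x' _ /=; rewrite -EFinM mulrC.
    have E x' : (\sum_(l <- l :: s) phi l x' * e2 l y) * g1 k x' =
        (phi l x' * g1 k x') * e2 l y + (\sum_(l <- s) phi l x' * e2 l y) * g1 k x'.
      by rewrite big_cons mulrDl mulrAC.
    split.
      apply: eq_integrable (integrableD measurableT il IHi) => //.
      by move=> x' _ /=; rewrite -EFinD E.
    under eq_Rintegral do rewrite E.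
    by rewrite RintegralD// RintegralZr// big_cons IH.
  rewrite /h /= (proj2 (intsum _)) mulr_suml; apply: eq_bigr => l _.
  by rewrite coefE /tensor /=; ring.
have mP : measurable_fun setT P.
  apply: measurable_sum => k; apply: measurable_funM => //.
  by have [] := bounded_measurable_tensor (be1 k.1) (be2 k.2).
have mpow (F : T1 * T2 -> R) : measurable_fun setT F ->
    measurable_fun setT (fun z => (`|F z| `^ q)%:E).
  by move=> mF; apply/measurable_EFinP; exact: measurable_normr_powR.
have pow0 (F : T1 * T2 -> R) z : (0 <= (`|F z| `^ q)%:E)%E.
  by rewrite lee_fin powR_ge0.
have step1 : (\int[mu]_z (`|P z| `^ q)%:E <= A1%:E * \int[mu]_z (`|h z| `^ q)%:E)%E.
  rewrite fubini_tonelli2 ?[X in (_ <= _ * X)%E]fubini_tonelli2//; try exact: mpow.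
  rewrite /fubini_G -ge0_integralZl_EFin//; last 2 first.
  - by move=> y _; apply: integral_ge0.
  - exact: (measurable_fun_fubini_tonelli_G _ (mpow _ mh) (pow0 h)).
  apply: ge0_le_integral => //.
  - by move=> y _; exact: integral_ge0.
  - exact: (measurable_fun_fubini_tonelli_G _ (mpow _ mP) (pow0 _)).
  - apply: measurable_funeM.
    exact: (measurable_fun_fubini_tonelli_G _ (mpow _ mh) (pow0 h)).
  move=> y _; under eq_integral do rewrite PE.
  apply: Lnorm_le_pint => // Nh; apply: unif1 => //.
  exact: msec2.
have step2 : (\int[mu]_z (`|h z| `^ q)%:E <= A2%:E * \int[mu]_z (`|f z| `^ q)%:E)%E.
  rewrite fubini_tonelli1 ?[X in (_ <= _ * X)%E]fubini_tonelli1//; try exact: mpow.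
  rewrite /fubini_F -ge0_integralZl_EFin//; last 2 first.
  - by move=> y _; apply: integral_ge0.
  - exact: (measurable_fun_fubini_tonelli_F _ (mpow _ mf) (pow0 f)).
  apply: ge0_le_integral => //.
  - by move=> y _; exact: integral_ge0.
  - exact: (measurable_fun_fubini_tonelli_F _ (mpow _ mh) (pow0 _)).
  - apply: measurable_funeM.
    exact: (measurable_fun_fubini_tonelli_F _ (mpow _ mf) (pow0 f)).
  move=> x _.
  apply: (@Lnorm_le_pint _ _ _ m2 q q1 (fun y => h (x, y)) (fun y => f (x, y))) => // Nh.
  by apply: (unif2 b2 (fun y => f (x, y))) => //; exact: msec1.
apply: (le_trans step1); rewrite EFinM -muleA.
by apply: lee_wpmul2l step2; rewrite lee_fin.
Qed.

Lemma product_good_system :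
  good_system prod_box mu q (tensor e1 e2) (tensor g1 g2).
Proof.
have [[be1 bg1] _ _ _] := good1; have [[be2 bg2] _ _ _] := good2.
split.
- by split=> k; exact: bounded_measurable_tensor.
- exact: product_biorth.
- exact: product_uniformly_bounded.
- exact: product_approximable.
Qed.

End product_system.

(** * Transport of a biorthogonal system along a measurable bijection *)

Section transport.
Context d d' {T : measurableType d} {T' : measurableType d'} {R : realType}.
Variables (mu : {measure set T -> \bar R}) (mu' : {measure set T' -> \bar R}).
Variables (phi : T -> T') (psi : T' -> T).
Hypothesis mphi : measurable_fun setT phi.
Hypothesis mpsi : measurable_fun setT psi.
Hypothesis psiK : cancel psi phi.
Hypothesis mu'E : forall A, measurable A -> mu' A = mu (phi @^-1` A).

Lemma integral_transport (f : T' -> \bar R) : measurable_fun setT f ->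
  (\int[mu']_x f x = \int[mu]_x f (phi x))%E.
Proof.
have ge0 (h : T' -> \bar R) : measurable_fun setT h -> (forall x, 0 <= h x)%E ->
    (\int[mu']_x h x = \int[mu]_x h (phi x))%E.
  move=> mh h0.
  have @nu : {measure set T' -> \bar R}.
    by refine [the measure _ _ of pushforward mu phi].
  transitivity (\int[nu]_x h x)%E.
    by apply: eq_measure_integral => A mA _; exact: mu'E.
  by rewrite ge0_integral_pushforward.
move=> mf; rewrite integralE [RHS]integralE.
rewrite ge0//; last exact: measurable_funepos.
rewrite [X in (_ - X)%E = _]ge0//; last exact: measurable_funeneg.
by congr (_ - _)%E; apply: eq_integral => x _; rewrite ?funeposE ?funenegE.
Qed.

Lemma Rintegral_transport (f : T' -> R) : measurable_fun setT f ->
  \int[mu']_x f x = \int[mu]_x f (phi x).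
Proof. by move=> mf; congr fine; apply: integral_transport; exact/measurable_EFinP. Qed.

Lemma Lnorm_transport (q : R) (f : T' -> R) : measurable_fun setT f ->
  ('N[mu']_(q%:E)[EFin \o f] = 'N[mu]_(q%:E)[EFin \o (f \o phi)])%E.
Proof.
move=> mf; rewrite !LnormEpow integral_transport//.
by apply/measurable_EFinP; exact: measurable_normr_powR.
Qed.

Context {K K' : eqType} {D D' : Type}.
Variables (box : D -> seq K) (box' : D' -> seq K').
Variables (i : K' -> K) (j : K -> K') (delta : D' -> D).
Hypothesis iK : cancel i j.
Hypothesis jK : cancel j i.
Hypothesis box_perm : forall m, perm_eq (map i (box' m)) (box (delta m)).
Variables (q : R) (e g : K -> T -> R) (e' g' : K' -> T' -> R).
Hypothesis e'E : forall k x, e' k (phi x) = e (i k) x.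
Hypothesis g'E : forall k x, g' k (phi x) = g (i k) x.

Lemma good_system_transport : good_system box mu q e g ->
  good_system box' mu' q e' g'.
Proof.
move=> [[be bg] bi [C C0 unif] dense].
have bm (k : K') (f' : T' -> R) (f : T -> R) : (forall x, f' (phi x) = f x) ->
    bounded_measurable f -> bounded_measurable f'.
  move=> f'E [mf [B B0 fB]]; have f'psi x : f' x = f (psi x) by rewrite -f'E psiK.
  split; last by exists B => // x; rewrite f'psi.
  by rewrite (funext f'psi); exact: (measurableT_comp mf).
have be' k : bounded_measurable (e' k) by exact: bm (e'E k) (be _).
have bg' k : bounded_measurable (g' k) by exact: bm (g'E k) (bg _).
have me' k : measurable_fun setT (e' k) by case: (be' k).
have mg' k : measurable_fun setT (g' k) by case: (bg' k).
split => //.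
- move=> k l; rewrite Rintegral_transport; last exact: measurable_funM.
  under eq_Rintegral do rewrite e'E g'E.
  by rewrite bi (can_eq iK).
- exists C => // m f mf; rewrite !Lnorm_transport//; last first.
    by apply: measurable_sum => k; exact: measurable_funM.
  move=> Nf; have mfphi : measurable_fun setT (f \o phi) by exact: measurableT_comp.
  rewrite (_ : _ \o phi = coef_proj mu e g (box (delta m)) (f \o phi)).
    exact: unif.
  apply/funext => x; rewrite /coef_proj -(perm_big _ (box_perm m)) big_map /=.
  apply: eq_bigr => k _; rewrite e'E Rintegral_transport; last exact: measurable_funM.
  by under eq_Rintegral do rewrite g'E.
- move=> f mf; rewrite Lnorm_transport// => Nf eps eps0.
  have mfphi : measurable_fun setT (f \o phi) by exact: measurableT_comp.
  have [s Ns] := dense _ mfphi Nf _ eps0.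
  exists [seq (j p.1, p.2) | p <- s].
  rewrite Lnorm_transport; last first.
    by apply: measurable_funB => //; exact: measurable_lincomb.
  rewrite (_ : _ \o phi = (f \o phi) \- lincomb e s)//.
  apply/funext => x /=; congr (_ - _); rewrite /lincomb big_map.
  by apply: eq_bigr => p _ /=; rewrite e'E jK.
Qed.

End transport.

(** * Product systems on the unit cube *)

Section cube_system.
Context {R : realType}.

Lemma lebesgue_ocube_mass1 n : @lebesgue_ocube R n setT = 1%E.
Proof.
rewrite /lebesgue_ocube /= /mrestr setTI.
have := @lebesgue_measure_tuple_box R n (fun=> `]0%R, 1%R[%classic)
  (fun=> measurable_itv _).
rewrite big1 => [|k _]; first by [].
by rewrite lebesgue_measure_itv/= lte_fin ltr01 oppr0 adde0.
Qed.

Let unit_lty : (@lebesgue_measure R `]0%R, 1%R[%classic < +oo)%E.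
Proof. by rewrite lebesgue_measure_itv/= lte_fin ltr01 oppr0 adde0 ltry. Qed.

Let unit_measurable : measurable (`]0%R, 1%R[%classic : set (measurableTypeR R)).
Proof. exact: measurable_itv. Qed.

(** Packaged as a finite measure, since the product construction asks for sigma-finite factors;
    [cube] repackages [lebesgue_ocube] for the same reason. *)
Definition lebesgue_unit : {finite_measure set (measurableTypeR R) -> \bar R} :=
  mfrestr unit_measurable unit_lty.

Lemma lebesgue_unit_mass1 : lebesgue_unit setT = 1%E.
Proof.
rewrite /lebesgue_unit /= /mfrestr /mrestr setTI.
by rewrite lebesgue_measure_itv/= lte_fin ltr01 oppr0 adde0.
Qed.

Let ocube_lty n : (lebesgue_measure_tuple n (@ocube R n) < +oo)%E.
Proof.
have := lebesgue_ocube_mass1 n; rewrite /lebesgue_ocube /= /mrestr setTI => ->.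
exact: ltry.
Qed.

Let cube n : {finite_measure set (euclid R n) -> \bar R} :=
  mfrestr (@measurable_ocube R n) (ocube_lty n).

(** The product measure is determined by its values on rectangles, so the push-forward along
    [tuncons] is compared with it there only. *)
Lemma lebesgue_ocube_succ n (A : set (euclid R n.+1)) : measurable A ->
  lebesgue_ocube n.+1 A = (lebesgue_unit \x cube n)%E ((@tcons R n) @^-1` A).
Proof.
move=> mA.
have @nu : {measure set (measurableTypeR R * euclid R n) -> \bar R}.
  refine [the measure _ _ of pushforward (lebesgue_ocube n.+1) (@tuncons R n)].
  exact: measurable_tuncons.
have mtA : measurable ((@tcons R n) @^-1` A).
  by rewrite -[X in measurable X]setTI; exact: measurable_tcons.
rewrite (@product_measure_unique _ _ _ _ _ lebesgue_unit (cube n) nu _ _ mtA).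
  rewrite /nu /= /pushforward -comp_preimage (_ : @tcons R n \o @tuncons R n = id) ?preimage_id//.
  by apply/funext; exact: tunconsK.
move=> B C mB mC; rewrite /nu /= /pushforward /mrestr /= /lebesgue_measure_succ /pushforward.
rewrite (_ : _ @^-1` _ = (B `&` `]0%R, 1%R[) `*` (C `&` @ocube R n)).
  apply: etrans (product_measure1E _ _ _ _) _ => //; apply: measurableI => //.
  exact: measurable_ocube.
apply/seteqP; split => -[x t] /=.
  rewrite [X in B X](_ : _ = x)// [X in C X](_ : _ = t); last exact: val_inj.
  move=> [[Bx Ct] xt]; split; split => //; first by have := xt ord0.
  by move=> k; have := xt (lift ord0 k); rewrite tnthS.
move=> [[Bx x01] [Ct t01]]; split.
  by split; [exact: Bx|rewrite [X in C X](_ : _ = t)//; exact: val_inj].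
move=> k; case: (unliftP ord0 k) => [l ->|->]; last by [].
by rewrite tnthS; exact: t01.
Qed.

Definition pos_iota (m : nat) : seq {k : nat | (0 < k)%N} :=
  [seq exist _ i.+1 isT | i <- iota 0 m].

Lemma mem_pos_iota m k : (k \in pos_iota m) = (val k <= m)%N.
Proof.
apply/mapP/idP => [[i + ->]|km]; first by rewrite mem_iota.
by exists (val k).-1; [rewrite mem_iota|apply/val_inj]; case: k km => -[].
Qed.

Lemma uniq_pos_iota m : uniq (pos_iota m).
Proof. by rewrite map_inj_uniq ?iota_uniq// => i j []. Qed.

Variable q : R.
Hypothesis q1 : 1 < q.
Variables e g : {k : nat | (0 < k)%N} -> R -> R.

Definition prod_system (e : {k : nat | (0 < k)%N} -> R -> R) n (k : mindex n)
  (x : euclid R n) : R := \prod_(i < n) e (tnth k i) (tnth x i).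

Lemma prod_system_cons (f : {k : nat | (0 < k)%N} -> R -> R) n k0 (k : mindex n) x0 x :
  prod_system f [tuple of k0 :: k] (tcons (x0, x)) = f k0 x0 * prod_system f k x.
Proof.
rewrite /prod_system big_ord_recl; congr (_ * _).
by apply: eq_bigr => i _; rewrite !tnthS.
Qed.

(** Induction from the one-point cube, where every function is a multiple of the empty product 1;
    the step splits off the first coordinate and transports the product system along [tcons]. *)
Lemma cube_good_system n : good_system pos_iota lebesgue_unit q e g ->
  good_system (@mbox n) (lebesgue_ocube n) q (@prod_system e n) (@prod_system g n).
Proof.
move=> good; elim: n => [|n ih].
  have cst1 (f : {k : nat | (0 < k)%N} -> R -> R) (k : mindex 0) : prod_system f k = cst 1.
    by apply/funext => x; rewrite /prod_system big_ord0.
  have fE (f : euclid R 0 -> R) : f = cst (f [tuple]).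
    by apply/funext => x; rewrite (tuple0 x).
  have int0 (f : euclid R 0 -> R) : \int[lebesgue_ocube 0]_x f x = f [tuple].
    rewrite (fE f) Rintegral_cst//; transitivity (f [tuple] * fine 1%E); last exact: mulr1.
    by congr (_ * fine _); exact: lebesgue_ocube_mass1.
  split.
  - split=> k; rewrite cst1; split => //; exists 1 => // x; by rewrite normr1.
  - by move=> k l; rewrite int0 !cst1 mulr1 (tuple0 k) (tuple0 l) eqxx.
  - exists 1 => // m f mf Nf; rewrite mul1e (_ : coef_proj _ _ _ _ _ = f)//.
    apply/funext => x; rewrite /coef_proj (bigD1_seq [tuple]) ?uniq_mbox//=; last first.
      by rewrite mem_mbox; apply/asboolP => -[].
    rewrite big1 => [|k]; last by case/negP; apply/eqP; exact: tuple0.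
    by rewrite addr0 int0 !cst1 !mulr1 (fE f).
  move=> f mf Nf eps eps0; exists [:: ([tuple], f [tuple])].
  rewrite (_ : _ \- _ = cst 0); last first.
    apply/funext => x /=; rewrite /lincomb big_seq1 cst1 mulr1 (tuple0 x); exact: subrr.
  by rewrite (Lnorm_cst (lebesgue_ocube_mass1 0) q1) normr0 lee_fin ltW.
have cube1 : cube n setT = 1%E by exact: lebesgue_ocube_mass1.
have ih' : good_system (@mbox n) (cube n) q (@prod_system e n) (@prod_system g n) by exact: ih.
pose i (k : mindex n.+1) := (thead k, [tuple of behead k]).
pose j (p : {k : nat | (0 < k)%N} * mindex n) : mindex n.+1 := [tuple of p.1 :: p.2].
have iK : cancel i j by move=> k; rewrite /j /i /= -tuple_eta.
have jK : cancel j i by move=> [a t]; congr pair; apply/val_inj.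
(* Both enumerations are free of repetitions, so equal membership suffices; their orders need not
   agree. *)
have bp (m : mindex n.+1) : perm_eq (map i (mbox m))
    (prod_box pos_iota (@mbox n) (val (thead m), [tuple of behead m])).
  have uP : uniq (prod_box pos_iota (@mbox n) (val (thead m), [tuple of behead m])).
    by apply: allpairs_uniq; rewrite ?uniq_pos_iota ?uniq_mbox// => -[? ?] [? ?].
  apply: uniq_perm => //; first by rewrite map_inj_uniq ?uniq_mbox//; exact: can_inj iK.
  move=> [a t]; apply/mapP/allpairsP => /= [[k + [-> ->]]|[[b u] /= [+ + [-> ->]]]].
    rewrite mem_mbox => /asboolP km; exists (thead k, [tuple of behead k]); split => //=.
      by rewrite mem_pos_iota; exact: km.
    rewrite mem_mbox; apply/asboolP => l; move: (km (lift ord0 l)).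
    by rewrite [in X in X -> _](tuple_eta k) [in X in X -> _](tuple_eta m) !tnthS.
  rewrite mem_pos_iota mem_mbox => bm /asboolP um; exists (j (b, u)); last by rewrite jK.
  rewrite mem_mbox; apply/asboolP => l; rewrite (tuple_eta m).
  by case: (unliftP ord0 l) => [l' ->|->]; rewrite ?tnthS; [exact: um|exact: bm].
have eE (f : {k : nat | (0 < k)%N} -> R -> R) (k : mindex n.+1)
    (x : measurableTypeR R * euclid R n) :
    prod_system f k (tcons x) = tensor f (@prod_system f n) (i k) x.
  by case: x => x0 x; rewrite [in LHS](tuple_eta k) prod_system_cons.
exact: (good_system_transport (@measurable_tcons R n) (@measurable_tuncons R n)
  (@tunconsK R n) (@lebesgue_ocube_succ n) iK jK bp (eE e) (eE g)
  (product_good_system lebesgue_unit_mass1 cube1 q1 good ih')).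
Qed.

End cube_system.

(** * The triangle wave and dilations *)

Section antiderivative.
Context {R : realType}.
Implicit Types f G : R -> R.

Lemma antiderivative_gt f (a : R) : continuous f ->
  exists G : R -> R, forall x : R, a < x -> is_derive x 1 G (f x).
Proof.
move=> cf; exists (fun x => \int[lebesgue_measure]_(t in `[a, x]) f t) => x ax.
have xx1 : x < x + 1 by rewrite ltrDl.
have [dG GE] := continuous_FTC1_closed xx1 (@continuous_integrable_itv R f a (x + 1) cf) ax (cf x).
by apply: (DeriveDef dG); rewrite -derive1E; exact: GE.
Qed.

Lemma is_derive_affine G (a b x df : R) : is_derive (a + b * x) 1 G df ->
  is_derive x 1 (fun y => G (a + b * y)) (b * df).
Proof.
move=> Gd; rewrite mulrC.
have db : is_derive x 1 (fun y : R => a + b * y) b.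
  by apply: is_derive_eq; rewrite /GRing.scale /=; ring.
exact: (@is_derive1_comp R G (fun y => a + b * y) x df b Gd db).
Qed.

Lemma continuous_dilate f (k : R) : continuous f -> continuous (fun x => f (k * x)).
Proof.
move=> cf x; apply: (@continuous_comp R R R (fun x => k * x) f x); last exact: cf.
exact: mulrl_continuous.
Qed.

(** An antiderivative G has the same increment on every interval [j, j + 1]: evenness and the period
    2 relate [1, 2] to [0, 1], and translation by 2 does the rest. Hence G(k) - G(0) = k (G(1) -
    G(0)), and the left side is k times the dilated integral. *)
Lemma Rintegral_dilation f (k : nat) : continuous f ->
  (forall x, f (x + 2) = f x) -> (forall x, f (- x) = f x) -> (0 < k)%N ->
  \int[lebesgue_measure]_(x in `[0, 1]) f (k%:R * x) =
  \int[lebesgue_measure]_(x in `[0, 1]) f x.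
Proof.
(* Starting at -1 makes [G] differentiable on both sides of 0. *)
move=> cf f2 fN k0; have [G Gd] := antiderivative_gt (-1) cf.
have lt1 (j : nat) : (j%:R : R) < j.+1%:R by rewrite ltr_nat.
have stepE (F : R -> R) (j : nat) : (forall x : R, j%:R <= x <= j.+1%:R -> is_derive x 1 F (f x)) ->
    F j.+1%:R - F j%:R = G j.+1%:R - G j%:R.
  move=> Fd; rewrite -(Rintegral_derivative_itv (lt1 j) cf Fd).
  apply: (Rintegral_derivative_itv (lt1 j) cf) => x /andP[jx _]; apply: Gd.
  by apply: (lt_le_trans _ (le_trans (ler0n _ _) jx)); rewrite ltrN10.
have step (j : nat) : G j.+1%:R - G j%:R = G 1 - G 0.
  have [m] := ubnP j; elim: m j => // m IH [|[|j]] jm //.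
    (* The case [j = 1], by the reflection x |-> 2 - x; larger [j] go down by two. *)
    have E : forall x : R, 0%:R <= x <= 0.+1%:R ->
        is_derive x 1 (fun y : R => - G (2 + -1 * y)) (f x).
      move=> x /andP[x0 x1].
      have gt : -1 < 2 + -1 * x by lra.
      have := @is_derive_affine G 2 (-1) x _ (Gd _ gt).
      rewrite (addrC 2 (_ * x)) f2 !mulN1r fN => dG.
      have := @is_deriveN _ _ _ _ x 1 _ dG.
      by rewrite opprK (_ : - (fun y => G _) = (fun y : R => - G (2 + -1 * y))).
    have := @stepE _ 0%N E; rewrite /= mulr0 addr0 mulr1 => <-.
    by rewrite opprK addrC (_ : 2 + -1 = 1 :> R)//; lra.
  rewrite -(IH j); last by rewrite -ltnS (ltn_trans _ jm).
  have E : forall x : R, j%:R <= x <= j.+1%:R ->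
      is_derive x 1 (fun y : R => G (2 + 1 * y)) (f x).
    move=> x /andP[jx _]; have x0 := le_trans (ler0n _ _) jx.
    have gt : -1 < 2 + 1 * x by lra.
    have := @is_derive_affine G 2 1 x _ (Gd _ gt).
    by rewrite (addrC 2 (_ * x)) f2 !mul1r.
  by rewrite -(stepE _ _ E) !mul1r -!natrD !add2n.
have GkE : G k%:R - G 0 = k%:R * (G 1 - G 0).
  elim: (k) => [|j IH]; first by rewrite mul0r subrr.
  by rewrite -(subrK (G j%:R) (G j.+1%:R)) step -addrA IH -natr1; ring.
have gt0 (x : R) : 0 <= x -> -1 < x by move=> x0; lra.
have -> : \int[lebesgue_measure]_(x in `[0, 1]) f x = G 1 - G 0.
  by apply: Rintegral_derivative_itv => // x /andP[x0 _]; apply: Gd; exact: gt0.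
have kn0 : (k%:R : R) != 0 by rewrite pnatr_eq0 -lt0n.
have ck := continuous_dilate (k := k%:R) cf.
apply: (mulfI kn0); rewrite -GkE -(Rintegral_contZ _ _ _ ck).
have kGd : forall x : R, 0 <= x <= 1 ->
    is_derive x 1 (fun y => G (0 + k%:R * y)) (k%:R * f (k%:R * x)).
  move=> x /andP[x0 _]; apply: is_derive_affine.
  by rewrite add0r; apply: Gd; apply: gt0; rewrite mulr_ge0.
have ckk : continuous (fun x : R => k%:R * f (k%:R * x)).
  by apply: continuous_funM => //; exact: continuous_fun_cst.
by rewrite (Rintegral_derivative_itv ltr01 ckk kGd) !add0r mulr1 mulr0.
Qed.

End antiderivative.

Section triangle_wave_theory.
Context {R : realType}.
Implicit Types x t : R.

(* the odd extension of [tent] to [-1, 1] *)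
Definition odd_tent t : R := 2 * `|t + 2^-1| - 2 * `|t - 2^-1| - 2 * t.

Lemma odd_tentE t : 0 <= t <= 1 -> odd_tent t = tent t.
Proof.
move=> /andP[t0 t1]; rewrite /odd_tent /tent (ger0_norm (_ : 0 <= t + 2^-1)); last lra.
by case: leP => ht; [rewrite ler0_norm|rewrite ger0_norm]; lra.
Qed.

Lemma odd_tentN t : odd_tent (- t) = - odd_tent t.
Proof.
rewrite /odd_tent (_ : - t + 2^-1 = - (t - 2^-1)); last lra.
by rewrite (_ : - t - 2^-1 = - (t + 2^-1)) ?normrN; lra.
Qed.

Lemma odd_tentB1 t : 0 <= t <= 1 -> odd_tent (t - 1) = - odd_tent t.
Proof.
move=> t01; rewrite -odd_tentN (_ : t - 1 = - (1 - t)); last lra.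
rewrite !odd_tentN !odd_tentE//; last lra.
by congr (- _); rewrite /tent; do 2 case: leP => ?; lra.
Qed.

Lemma continuous_odd_tent : continuous odd_tent.
Proof.
have cN (a : R) : continuous (fun t : R => 2 * `|t + a|).
  apply: continuous_funM; first exact: continuous_fun_cst.
  move=> x; apply: (@continuous_comp R R R (fun t => t + a) (fun t => `|t|) x).
    by apply: cvgD; [exact: cvg_id|exact: cvg_cst].
  exact: norm_continuous.
rewrite /odd_tent; apply: continuous_funD; first apply: continuous_funD.
- exact: cN.
- by apply: continuous_funN; exact: cN.
- by apply: continuous_funN; exact: mulrl_continuous.
Qed.

(** The windows of radius 1 around the integers overlap, so every point, integers included, is
    interior to one of them. Oddness, period and continuity then need no case split at the jumps of
    [Num.floor]. *)
Lemma triangle_waveE (j : int) x : j%:~R - 1 <= x <= j%:~R + 1 ->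
  triangle_wave x = (-1) ^ j * odd_tent (x - j%:~R).
Proof.
move=> /andP[jx xj]; rewrite /triangle_wave.
have [xlt|xge] := ltP x j%:~R.
  have j1 : (j - 1)%:~R = j%:~R - 1 :> R by rewrite intrB.
  have -> : Num.floor x = j - 1.
    by apply: floor_def; rewrite subrK j1; lra.
  rewrite j1 -odd_tentE; last lra.
  rewrite (_ : x - (j%:~R - 1) = (x - j%:~R) + 1); last lra.
  have -> : odd_tent (x - j%:~R) = - odd_tent (x - j%:~R + 1).
    by rewrite -odd_tentB1 ?addrK//; lra.
  by rewrite expfzDr ?oppr_eq0 ?oner_eq0// exprN1 invrN1; ring.
have [xj1|xj1] := ltP x (j%:~R + 1).
  have -> : Num.floor x = j.
    by apply: floor_def; rewrite intrD rmorph1; lra.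
  by rewrite odd_tentE//; lra.
have -> : x = j%:~R + 1 by lra.
have -> : Num.floor (j%:~R + 1 : R) = j + 1 by rewrite -[j%:~R + 1](intrD R j 1) intrKfloor.
rewrite intrD subrr addrAC subrr add0r odd_tentE ?lexx ?ler01//.
have -> : tent (0 : R) = 0 by rewrite /tent; case: leP => ?; lra.
have -> : tent (1 : R) = 0 by rewrite /tent; case: leP => ?; lra.
by rewrite !mulr0.
Qed.

Lemma triangle_wave_le1 x : `|triangle_wave x| <= 1.
Proof.
have s1 (j : int) : `|(-1) ^ j| = 1 :> R.
  by case: j => m; rewrite /exprz ?normfV normrX normrN1 expr1n ?invr1.
rewrite /triangle_wave normrM s1 mul1r.
have /andP[] := floor_itv x; rewrite intrD rmorph1 => h1 h2.
set t := x - _; have t0 : 0 <= t by rewrite /t; lra.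
have t1 : t < 1 by rewrite /t; lra.
by rewrite ler_norml /tent; have [h|h] := leP t 2^-1; lra.
Qed.

Let floor_itvD1 x : (Num.floor x)%:~R - 1 <= x <= (Num.floor x)%:~R + 1.
Proof.
by have := floor_itv x; rewrite intrD rmorph1 => /andP[? ?]; lra.
Qed.

Lemma triangle_waveN x : triangle_wave (- x) = - triangle_wave x.
Proof.
have fx := floor_itvD1 x.
rewrite (triangle_waveE fx) (@triangle_waveE (- Num.floor x)); last first.
  by rewrite rmorphN; move: fx => /andP[? ?]; lra.
rewrite rmorphN opprK addrC -[_ - x]opprB odd_tentN mulrN; congr (- (_ * _)).
by rewrite -exprz_inv invrN1.
Qed.

Lemma triangle_waveD2 x : triangle_wave (x + 2) = triangle_wave x.
Proof.
have fx := floor_itvD1 x.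
have j2 : (Num.floor x + 2)%:~R = (Num.floor x)%:~R + 2 :> R by rewrite intrD.
rewrite (triangle_waveE fx) (@triangle_waveE (Num.floor x + 2)); last first.
  by rewrite j2; move: fx => /andP[? ?]; lra.
have m2 : (-1) ^ (2 : int) = 1 :> R by rewrite -[LHS]/((-1) ^+ 2) sqrrN expr1n.
rewrite j2 expfzDr ?oppr_eq0 ?oner_eq0// m2 mulr1.
by congr (_ * odd_tent _); ring.
Qed.

Lemma continuous_triangle_wave : continuous (@triangle_wave R).
Proof.
move=> x; have := floor_itv x; rewrite intrD rmorph1; set j := Num.floor x => /andP[jx xj].
have c : {for x, continuous (fun x => (-1) ^ j * odd_tent (x - j%:~R))}.
  apply: continuous_funM; first exact: continuous_fun_cst.
  move=> y; apply: (@continuous_comp R R R (fun t => t - j%:~R) odd_tent y).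
    by apply: cvgD; [exact: cvg_id|exact: cvg_cst].
  exact: continuous_odd_tent.
have xE : \forall y \near x, triangle_wave y = (-1) ^ j * odd_tent (y - j%:~R).
  have x_in : x \in `](j%:~R - 1 : R), (j%:~R + 1)[ by rewrite in_itv/=; lra.
  near=> y; apply: triangle_waveE.
  have /[!in_itv]/= /andP[? ?] : y \in `](j%:~R - 1 : R), (j%:~R + 1)[.
    by near: y; exact: near_in_itvoo.
  by lra.
rewrite /continuous_at (triangle_waveE (_ : j%:~R - 1 <= x <= j%:~R + 1)); last lra.
apply: cvg_trans c; apply: near_eq_cvg.
by apply: filterS xE => y ->.
Unshelve. all: by end_near.
Qed.

End triangle_wave_theory.

(** * Lebesgue measure on the unit interval *)

Section unit_interval.
Context {R : realType}.
Local Notation mu := (@lebesgue_unit R).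

Lemma integral_unit (f : R -> \bar R) : measurable_fun setT f ->
  (\int[mu]_x f x = \int[lebesgue_measure]_(x in `[0%R, 1%R]) f x)%E.
Proof.
have mI : measurable (`]0%R, 1%R[%classic : set (measurableTypeR R)) by exact: measurable_itv.
have ge0 (h : R -> \bar R) : measurable_fun setT h -> (forall x, 0 <= h x)%E ->
    (\int[mu]_x h x = \int[lebesgue_measure]_(x in `[0%R, 1%R]) h x)%E.
  move=> mh h0.
  have muC : mu (~` `]0%R, 1%R[%classic) = 0%E.
    by rewrite /= /mfrestr /mrestr setICl measure0.
  rewrite (ge0_negligible_integral _ _ _ _ muC)//; last exact: measurableC.
  rewrite setTD setCK (@eq_measure_integral _ _ _ _ lebesgue_measure); last first.
    by move=> A mA AI; rewrite /= /mfrestr /mrestr setIidl.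
  rewrite -integral_itv_obnd_cbnd; last exact: measurable_funS mh.
  by rewrite -integral_itv_bndo_bndc//; exact: measurable_funS mh.
move=> mf; rewrite integralE [RHS]integralE.
rewrite ge0//; last exact: measurable_funepos.
by rewrite [X in (_ - X)%E = _]ge0//; exact: measurable_funeneg.
Qed.

Lemma Rintegral_unit (f : R -> R) : measurable_fun setT f ->
  \int[mu]_x f x = \int[lebesgue_measure]_(x in `[0, 1]) f x.
Proof. by move=> mf; congr fine; apply: integral_unit; exact/measurable_EFinP. Qed.

Lemma Lnorm_unit (q : R) (f : R -> R) : 1 < q -> continuous f ->
  'N[mu]_(q%:E)[EFin \o f]%E =
  ((\int[lebesgue_measure]_(x in `[0, 1]) `|f x| `^ q) `^ q^-1)%:E.
Proof.
move=> q1 cf; have q0 : 0 < q by exact: lt_trans q1.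
have mf := continuous_measurable_fun cf.
rewrite LnormEpow integral_unit; last first.
  by apply/measurable_EFinP; exact: measurable_normr_powR.
rewrite -poweR_EFin; congr (_ `^ _)%E.
rewrite /Rintegral fineK//; apply: (@integrable_fin_num _ _ _ lebesgue_measure) => //.
by apply: continuous_integrable_itv; exact: continuous_normr_powR.
Qed.

Lemma Lnorm_dilation (q : R) (f : R -> R) (k : nat) : 1 < q -> continuous f ->
  (forall x, f (x + 2) = f x) -> (forall x, f (- x) = - f x) -> (0 < k)%N ->
  'N[mu]_(q%:E)[EFin \o (fun x => f (k%:R * x))%R]%E = 'N[mu]_(q%:E)[EFin \o f]%E.
Proof.
move=> q1 cf f2 fN k0; have q0 : 0 < q by exact: lt_trans q1.
have ck : continuous (fun x : R => f (k%:R * x)) by exact: continuous_dilate.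
rewrite (Lnorm_unit q1 ck) (Lnorm_unit q1 cf).
have cp : continuous (fun x => `|f x| `^ q) by exact: continuous_normr_powR.
have p2 (x : R) : `|f (x + 2)| `^ q = `|f x| `^ q by rewrite f2.
have pN (x : R) : `|f (- x)| `^ q = `|f x| `^ q by rewrite fN normrN.
by have /= -> := Rintegral_dilation cp p2 pN k0.
Qed.

(** The exceptional point [b] is for the jump of an indicator function. *)
Lemma ae_unit (P : R -> Prop) (b : R) :
  (forall x, 0 < x < 1 -> x != b -> P x) -> {ae mu, forall x, P x}.
Proof.
move=> Pb; exists (~` `]0%R, 1%R[%classic `|` [set b]); split.
- by apply: measurableU => //; apply: measurableC; exact: measurable_itv.
- rewrite /= /mfrestr /mrestr; apply/eqP; rewrite eq_le measure_ge0 andbT.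
  rewrite setIUl setICl set0U (le_trans (le_measure _ _ _ (@subIsetl _ _ _)))//=.
  + by rewrite inE; apply: measurableI => //; exact: measurable_itv.
  + by rewrite inE; exact: measurable_set1.
  + by rewrite lebesgue_measure_set1.
- move=> x /= nPx; apply: contrapT => /not_orP[/contrapT + /eqP xb].
  by rewrite in_itv/= => x01; apply: nPx; exact: Pb.
Qed.

End unit_interval.

(** * Orthogonality of the sines and the sine coefficients of the triangle wave *)

Section sine_coefficients.
Context {R : realType}.
Local Notation int01 f := (\int[lebesgue_measure]_(x in `[0, 1]) f x).

(** Index 0 gives the zero function, so sums may start at 0. *)
Definition sine (i : nat) (x : R) : R := sin (pi * i%:R * x).

Lemma continuous_sine i : continuous (sine i).
Proof. exact: continuous_sinM. Qed.

Lemma sine_dilate i k x : sine i (k%:R * x) = sine (i * k) x.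
Proof. by rewrite /sine natrM; congr sin; ring. Qed.

Lemma sineN i x : sine i (- x) = - sine i x.
Proof. by rewrite /sine mulrN sinN. Qed.

Lemma sineD2 i x : sine i (x + 2) = sine i x.
Proof.
rewrite /sine (_ : pi * _ * (x + 2) = pi * i%:R * x + pi * (2 * i)%:R); last first.
  by rewrite natrM; ring.
rewrite sinD sin_natpi natrM (_ : pi * (2 * i%:R) = pi * i%:R *+ 2); last by rewrite mulr2n; ring.
rewrite cos_mulr2n cos2sin2 sin_natpi expr0n subr0 /= (_ : 1 *+ 2 - 1 = 1); first by ring.
by rewrite mulr2n; ring.
Qed.

Lemma Rintegral_cosM (a : R) : a != 0 -> int01 (fun x => cos (a * x)) = sin a / a.
Proof.
move=> a0.
have dS (x : R) : is_derive x 1 (fun x => sin (a * x) / a) (cos (a * x)).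
  by apply: is_derive_eq; rewrite /GRing.scale /=; field.
rewrite (Rintegral_derivative ltr01 (@continuous_cosM R a) dS).
by rewrite mulr1 mulr0 sin0 mul0r subr0.
Qed.

Lemma sine_orthogonal i j : (0 < i)%N -> (0 < j)%N ->
  int01 (fun x => sine i x * sine j x) = (i == j)%:R / 2.
Proof.
move=> i0 j0; have pi0 : pi != 0 :> R by rewrite gt_eqF ?pi_gt0.
have sB : sin (pi * (i%:R - j%:R)) = 0 :> R by rewrite mulrBr sinB !sin_natpi; ring.
have sD : sin (pi * (i%:R + j%:R)) = 0 :> R by rewrite mulrDr sinD !sin_natpi; ring.
under eq_Rintegral => x _.
  rewrite (_ : _ * _ = 2^-1 * (cos (pi * (i%:R - j%:R) * x) -
      cos (pi * (i%:R + j%:R) * x))); last first.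
    rewrite /sine (_ : pi * (_ - _) * x = pi * i%:R * x - pi * j%:R * x); last ring.
    by rewrite (_ : pi * (_ + _) * x = pi * i%:R * x + pi * j%:R * x) ?cosB ?cosD; [field|ring].
  over.
have cB := @continuous_cosM R (pi * (i%:R - j%:R)).
have cD := @continuous_cosM R (pi * (i%:R + j%:R)).
rewrite (Rintegral_contZ _ _ _ (continuous_funD cB (continuous_funN cD))).
rewrite (Rintegral_contB _ _ cB cD) mulrC.
rewrite [X in _ - X]Rintegral_cosM; last first.
  by rewrite mulf_neq0// -natrD pnatr_eq0 addn_eq0 negb_and -lt0n i0.
rewrite sD mul0r subr0; have [<-|ij] := eqVneq i j.
  under eq_Rintegral do rewrite subrr mulr0 mul0r cos0.
  have d1 (x : R) : is_derive x 1 (fun x : R => x) 1 by exact: is_derive_id.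
  by rewrite (Rintegral_derivative ltr01 (@continuous_fun_cst R 1) d1) subr0.
rewrite Rintegral_cosM ?sB ?mul0r// mulf_neq0// subr_eq0 eqr_nat//.
Qed.

Definition triangle_coef (i : nat) : R := 8 * sin (pi * i%:R / 2) / (pi * i%:R) ^+ 2.

Lemma triangle_wave_coef i : (0 < i)%N ->
  int01 (fun x => triangle_wave x * sine i x) = triangle_coef i / 2.
Proof.
move=> i0; have ai : pi * i%:R != 0 :> R by rewrite mulf_neq0 ?gt_eqF ?pi_gt0// ltr0n.
pose a : R := pi * i%:R; have sa : sin a = 0 by rewrite sin_natpi.
have cf : continuous (fun x : R => triangle_wave x * sine i x).
  by apply: continuous_funM; [exact: continuous_triangle_wave|exact: continuous_sine].
have [G Gd] := antiderivative_gt (-1) cf.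
(* On each half of [0, 1] the integrand agrees with a smooth [F] having an explicit antiderivative
   [H], found by integration by parts; [G] joins the two halves. *)
have GE (b c : R) (F H : R -> R) : 0 <= b -> b < c -> continuous F ->
    (forall x, b <= x <= c -> triangle_wave x * sine i x = F x) ->
    (forall x : R, is_derive x 1 H (F x)) -> G c - G b = H c - H b.
  move=> b0 bc cF FE dH; rewrite -(Rintegral_derivative bc cF dH).
  have Gd' : forall x : R, b <= x <= c -> is_derive x 1 G (triangle_wave x * sine i x).
    by move=> x /andP[bx _]; apply: Gd; lra.
  rewrite -(Rintegral_derivative_itv bc cf Gd').
  by apply: eq_Rintegral => x /[!inE]/=; rewrite in_itv/= => /FE.
have Gd' : forall x : R, 0 <= x <= 1 -> is_derive x 1 G (triangle_wave x * sine i x).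
  by move=> x /andP[bx _]; apply: Gd; lra.
rewrite (Rintegral_derivative_itv ltr01 cf Gd') -(subrK (G 2^-1) (G 1)) -addrA.
have a0 : a != 0 by [].
have tE (x : R) : 0 <= x <= 1 -> triangle_wave x = tent x.
  move=> x01; rewrite (@triangle_waveE R 0) ?expr0z ?mul1r ?subr0 ?odd_tentE//.
  by move: x01 => /andP[? ?]; lra.
have cx (b c : R) : continuous (fun x : R => (b + c * x) * sin (a * x)).
  apply: continuous_funM; last exact: continuous_sinM.
  apply: continuous_funD; first exact: continuous_fun_cst.
  exact: mulrl_continuous.
have d1 (x : R) : is_derive x 1
    (fun x => - (2 * x) * cos (a * x) / a + 2 * sin (a * x) / a ^+ 2)
    ((0 + 2 * x) * sin (a * x)).
  by apply: is_derive_eq; rewrite /GRing.scale /=; field.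
have d2 (x : R) : is_derive x 1
    (fun x => - (2 - 2 * x) * cos (a * x) / a - 2 * sin (a * x) / a ^+ 2)
    ((2 + (- 2) * x) * sin (a * x)).
  by apply: is_derive_eq; rewrite /GRing.scale /=; field.
rewrite (GE 2^-1 1 _ _ _ _ (cx 2 (-2)) _ d2); [|lra|lra|]; last first.
  move=> x /andP[x0 x1]; rewrite tE; last lra.
  by rewrite /sine -/a /tent; case: leP => ?; congr (_ * _); lra.
rewrite (GE 0 2^-1 _ _ _ _ (cx 0 2) _ d1); [|lra|lra|]; last first.
  move=> x /andP[x0 x1]; rewrite tE; last lra.
  by rewrite /sine -/a /tent x1; congr (_ * _); lra.
by rewrite (mulr1 a) (mulr0 a) sin0 sa /triangle_coef -/a; field.
Qed.

End sine_coefficients.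

(** * Density of the sines *)

Section step_approximation.
Context {R : realType}.
Implicit Types t u : R.

(* Brosowski and Deutsch's polynomials: on [0, 1] they tend to the indicator
   function of ]1/2, 1]. *)
Definition step_poly (n : nat) t : R := 1 - (1 - t ^+ n) ^+ (2 ^ n).

Lemma bernoulli_1D n u : 0 <= u -> 1 + n%:R * u <= (1 + u) ^+ n.
Proof.
move=> u0; elim: n => [|n IH]; first by rewrite mul0r addr0 expr0.
rewrite exprS -natr1; apply: (@le_trans _ _ ((1 + u) * (1 + n%:R * u))).
  by have := mulr_ge0 (ler0n R n) (mulr_ge0 u0 u0); nra.
by apply: ler_wpM2l => //; lra.
Qed.

Lemma bernoulli_1B n u : 0 <= u <= 1 -> 1 - n%:R * u <= (1 - u) ^+ n.
Proof.
move=> /andP[u0 u1]; elim: n => [|n IH]; first by rewrite mul0r subr0 expr0.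
rewrite exprS -natr1; apply: (@le_trans _ _ ((1 - u) * (1 - n%:R * u))).
  by have := mulr_ge0 (ler0n R n) (mulr_ge0 u0 u0); nra.
by apply: ler_wpM2l => //; lra.
Qed.

Lemma step_poly_itv n t : 0 <= t <= 1 -> 0 <= step_poly n t <= 1.
Proof.
move=> /andP[t0 t1]; rewrite /step_poly.
have tn : 0 <= t ^+ n by rewrite exprn_ge0.
have tn1 : t ^+ n <= 1 by rewrite exprn_ile1.
have h0 : 0 <= 1 - t ^+ n by lra.
have h1 : 1 - t ^+ n <= 1 by lra.
have := exprn_ge0 (2 ^ n) h0; have := @exprn_ile1 _ (2 ^ n) _ h0 h1; lra.
Qed.

Lemma step_poly_lt n t : 0 <= t <= 1 -> step_poly n t <= (2 * t) ^+ n.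
Proof.
move=> /andP[t0 t1]; rewrite /step_poly exprMn -natrX.
have := @bernoulli_1B (2 ^ n) (t ^+ n) _.
by rewrite exprn_ge0// exprn_ile1// => /(_ isT); lra.
Qed.

(** With u = t^n and K = 2^n: (1 - u)^K (1 + u)^K <= 1, while (1 + u)^K >= K u by Bernoulli. *)
Lemma step_poly_gt n t : 0 < t <= 1 -> 1 - step_poly n t <= ((2 * t)^-1) ^+ n.
Proof.
move=> /andP[t0 t1]; rewrite /step_poly exprVn exprMn -natrX opprB addrC subrK.
have tn : 0 < t ^+ n by rewrite exprn_gt0.
have tn1 : t ^+ n <= 1 by rewrite exprn_ile1// ltW.
have n0 : 0 < (2 ^ n)%:R :> R by rewrite ltr0n expn_gt0.
have B := @bernoulli_1D (2 ^ n) (t ^+ n) (ltW tn).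
rewrite -[leRHS]mul1r ler_pdivlMr ?mulr_gt0//.
apply: (@le_trans _ _ ((1 - t ^+ n) ^+ (2 ^ n) * (1 + t ^+ n) ^+ (2 ^ n))).
  apply: ler_wpM2l; first by rewrite exprn_ge0// subr_ge0.
  by apply: le_trans B; rewrite lerDr.
rewrite -exprMn exprn_ile1//; nra.
Qed.

Lemma step_poly_cvg0 t : 0 <= t < 2^-1 -> step_poly n t @[n --> \oo] --> (0 : R).
Proof.
move=> /andP[t0 t1].
have z1 : `|2 * t| < 1 by rewrite ger0_norm ?mulr_ge0//; lra.
apply: (squeeze_cvgr _ (cvg_cst 0) (cvg_expr z1)).
have t01 : 0 <= t <= 1 by lra.
by apply: nearW => n; rewrite step_poly_lt// andbT; have /andP[] := step_poly_itv n t01.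
Qed.

Lemma step_poly_cvg1 t : 2^-1 < t <= 1 -> step_poly n t @[n --> \oo] --> (1 : R).
Proof.
move=> /andP[t0 t1]; have t2 : 0 < 2 * t by lra.
have z1 : `|(2 * t)^-1| < 1 by rewrite gtr0_norm ?invr_gt0// invf_lt1//; lra.
have c : (fun n => 1 - ((2 * t)^-1) ^+ n) @ \oo --> (1 - 0 : R).
  by apply: cvgB; [exact: cvg_cst|exact: cvg_expr].
rewrite subr0 in c; apply: (squeeze_cvgr (h := cst (1 : R)) _ c); last exact: cvg_cst.
have t01 : 0 <= t <= 1 by lra.
apply: nearW => n; have /andP[_ ->] := step_poly_itv n t01; rewrite andbT.
have : 0 < t <= 1 by lra.
by move=> /(step_poly_gt n); lra.
Qed.

End step_approximation.

Section sine_density.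
Context {R : realType}.
Variable q : R.
Hypothesis q1 : 1 < q.
Local Notation mu := (@lebesgue_unit R).
Let mu1 : mu setT = 1%E. Proof. exact: lebesgue_unit_mass1. Qed.
Local Notation mfun := (measurable_fun (setT : set (measurableTypeR R))).
Let me k : mfun (@sine R k).
Proof. by apply: continuous_measurable_fun; exact: continuous_sine. Qed.
Local Notation approximable := (approximable mu q (@sine R)).

(** Products of sines are not sine sums, but multiplication by cos(pi x) preserves sine sums. The
    multipliers form an algebra, so it contains every polynomial in cos(pi x), in particular the
    step polynomials. *)
Definition multiplier (u : R -> R) := bounded_measurable u /\
  forall f, mfun f -> approximable f -> approximable (fun x => u x * f x).

Let sine_cos_approximable k : approximable (fun x => cos (pi * x) * sine k x).
Proof.
case: k => [|k].
  rewrite (_ : (fun _ => _) = lincomb (@sine R) [::]); first exact: approximable_lincomb.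
  by apply/funext => x; rewrite /lincomb big_nil /sine mulr0 mul0r sin0 mulr0.
rewrite (_ : (fun _ => _) = lincomb (@sine R) [:: (k.+2, 2^-1); (k, 2^-1)]).
  exact: approximable_lincomb.
apply/funext => x; rewrite /lincomb big_cons big_seq1 /= /sine.
rewrite (_ : pi * k.+2%:R * x = pi * k.+1%:R * x + pi * x); last by rewrite -[in LHS]natr1; ring.
rewrite (_ : pi * k%:R * x = pi * k.+1%:R * x - pi * x); last by rewrite -natr1; ring.
by rewrite sinD sinB; field.
Qed.

Lemma multiplier_cos : multiplier (fun x => cos (pi * x)).
Proof.
have mc : mfun (fun x : measurableTypeR R => cos (pi * x)).
  by apply: continuous_measurable_fun; exact: continuous_cosM.
have c1 (x : R) : `|cos (pi * x)| <= 1 by rewrite ler_norml cos_geN1 cos_le1.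
split; first by split => //; exists 1.
move=> f mf af; apply: (approximable_limit q1 me) => [|eps eps0].
  exact: measurable_funM.
have [s Ns] := af _ eps0; exists (fun x => cos (pi * x) * lincomb (@sine R) s x); split.
- by apply: measurable_funM => //; exact: measurable_lincomb.
- rewrite (_ : (fun _ => _) = (fun x => \sum_(p <- s) p.2 * (cos (pi * x) * sine p.1 x))).
    have mF p : mfun (fun x : measurableTypeR R => cos (pi * x) * sine p x).
      exact: measurable_funM.
    apply: (approximable_sum mu1 q1 me) => [p|p]; first exact: measurable_funM.
    exact: (approximableZ q1 me).
  by apply/funext => x; rewrite /lincomb mulr_sumr; apply: eq_bigr => p _; rewrite mulrCA.
- have mfs : mfun (f \- lincomb (@sine R) s).
    by apply: measurable_funB => //; exact: measurable_lincomb.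
  apply: le_trans Ns; apply: le_Lnorm => // [|x].
    apply: measurable_funB; apply: measurable_funM => //; exact: measurable_lincomb.
  by rewrite /= -mulrBr normrM ler_piMl.
Qed.

Lemma multiplier_cst (c : R) : multiplier (cst c).
Proof.
split; first by split => //; exists `|c|.
by move=> f mf af; exact: (approximableZ q1 me).
Qed.

Lemma multiplierD u v : multiplier u -> multiplier v -> multiplier (fun x => u x + v x).
Proof.
move=> [[mu_ [C C0 uC]] um] [[mv [D D0 vD]] vm]; split.
  split; first exact: measurable_funD.
  exists (C + D) => [|x]; first exact: addr_ge0.
  by rewrite (le_trans (ler_normD _ _))// lerD.
move=> f mf af; rewrite (_ : (fun _ => _) = (fun x => u x * f x + v x * f x)).
  apply: (approximableD q1 me); [exact: measurable_funM|exact: measurable_funM|exact: um|exact: vm].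
by apply/funext => x; rewrite mulrDl.
Qed.

Lemma multiplierM u v : multiplier u -> multiplier v -> multiplier (fun x => u x * v x).
Proof.
move=> [[mu_ [C C0 uC]] um] [[mv [D D0 vD]] vm]; split.
  split; first exact: measurable_funM.
  exists (C * D) => [|x]; first exact: mulr_ge0.
  by rewrite normrM ler_pM.
move=> f mf af; rewrite (_ : (fun _ => _) = (fun x => u x * (v x * f x))).
  by apply: um; [exact: measurable_funM|exact: vm].
by apply/funext => x; rewrite mulrA.
Qed.

Lemma multiplierX u n : multiplier u -> multiplier (fun x => u x ^+ n).
Proof.
move=> um; elim: n => [|n IH]; first exact: multiplier_cst.
by under eq_fun do rewrite exprS; exact: multiplierM.
Qed.

Lemma multiplier_step n u : multiplier u -> multiplier (fun x => step_poly n (u x)).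
Proof.
move=> um; have oneB v : multiplier v -> multiplier (fun x => 1 - v x).
  move=> vm; under eq_fun do rewrite -mulN1r.
  by apply: multiplierD; [exact: multiplier_cst|apply: multiplierM => //; exact: multiplier_cst].
exact: (oneB _ (multiplierX (2 ^ n) (oneB _ (multiplierX n um)))).
Qed.

Let sine1_approximable : approximable (sine 1).
Proof.
rewrite (_ : sine 1 = lincomb (@sine R) [:: (1%N, 1)]); first exact: approximable_lincomb.
by apply/funext => x; rewrite /lincomb big_seq1 mul1r.
Qed.

Lemma approximable_sine_ray (b : R) : approximable (fun x => sine 1 x * \1_(`]-oo, b[%classic) x).
Proof.
have mI : mfun (fun x : measurableTypeR R => sine 1 x * \1_(`]-oo, b[%classic) x).
  by apply: measurable_funM => //; apply: measurable_indic; exact: measurable_itv.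
have s1 x : `|sine 1 x| <= 1 :> R by rewrite ler_norml sin_geN1 sin_le1.
have I1 (x : R) : `|sine 1 x * \1_(`]-oo, b[%classic) x| <= 1 :> R.
  by rewrite normrM indicE; case: (_ \in _); rewrite ?normr1 ?mulr1 ?normr0 ?mulr0.
(* Cosine decreases on [0, pi], so for [x] and [b] in ]0, 1[, [t x] exceeds 1/2 exactly when
   [x < b]. The factor 1/4 keeps [t] in [0, 1]. *)
pose a : R := cos (pi * b); pose t (x : R) := 2^-1 + 4^-1 * (cos (pi * x) + - a).
have a1 : -1 <= a <= 1 by rewrite cos_geN1 cos_le1.
have t01 x : 0 <= t x <= 1.
  have := cos_geN1 (pi * x); have := cos_le1 (pi * x).
  by move: a1 => /andP[? ?] ? ?; rewrite /t; lra.
have tm : multiplier t.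
  apply: multiplierD; first exact: multiplier_cst.
  apply: multiplierM; first exact: multiplier_cst.
  by apply: multiplierD; [exact: multiplier_cos|exact: multiplier_cst].
(* For [b] outside ]0, 1[ the comparison of cosines says nothing, but the indicator is then constant
   on ]0, 1[. *)
pose F (n : nat) x : R := if b <= 0 then 0 * sine 1 x else
  if 1 <= b then 1 * sine 1 x else step_poly n (t x) * sine 1 x.
have Fm n : exists2 u, F n = (fun x => u x * sine 1 x) &
    multiplier u /\ forall x, `|u x| <= 1.
  rewrite /F; case: (b <= 0).
    by exists (cst 0) => //; split; [exact: multiplier_cst|move=> x; rewrite normr0].
  case: (1 <= b).
    by exists (cst 1) => //; split; [exact: multiplier_cst|move=> x; rewrite normr1].
  exists (fun x => step_poly n (t x)) => //; split; first exact: multiplier_step.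
  by move=> x; have /andP[s0 ?] := step_poly_itv n (t01 x); rewrite ger0_norm.
apply: (approximable_bounded_cvg mu1 q1 me (F := F) (C := 1)) => //.
- by move=> n; have [u -> [[[mu_ _] _] _]] := Fm n; exact: measurable_funM.
- by move=> n; have [u -> [[_ um] _]] := Fm n; exact: um.
- by move=> n x; have [u -> [_ u1]] := Fm n; rewrite normrM mulr_ile1.
apply: (ae_unit (b := b)) => x /andP[x0 x1] xb; rewrite /F indicE.
case: (leP b 0) => b0.
  rewrite memNset ?mulr0 ?mul0r; first exact: cvg_cst.
  by rewrite /= in_itv/=; apply/negP; rewrite -leNgt (le_trans b0)// ltW.
case: (leP 1 b) => b1.
  rewrite mem_set ?mulr1 ?mul1r; first exact: cvg_cst.
  by rewrite /= in_itv/= (lt_le_trans x1).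
have inpi (y : R) : 0 < y -> y < 1 -> pi * y \in `[0, pi].
  move=> y0 y1; rewrite in_itv/= mulr_ge0 ?pi_ge0 ?(ltW y0)//=.
  by rewrite ler_piMr ?pi_ge0// ltW.
have cosE (y z : R) : 0 < y -> y < 1 -> 0 < z -> z < 1 -> y < z -> cos (pi * z) < cos (pi * y).
  by move=> y0 y1 z0 z1 yz; rewrite ltr_cos ?inpi// ltr_pM2l ?pi_gt0.
have [xltb|] := ltP x b.
  rewrite mem_set ?mulr1; last by rewrite /= in_itv/=.
  rewrite -[X in _ --> X]mul1r; apply: cvgMl; apply: step_poly_cvg1.
  have /andP[_ ->] := t01 x; rewrite andbT.
  by have := cosE _ _ x0 x1 b0 b1 xltb; rewrite /t /a; lra.
rewrite le_eqVlt eq_sym (negbTE xb) /= => bx.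
rewrite memNset ?mulr0; last by rewrite /= in_itv/=; apply/negP; rewrite -leNgt ltW.
rewrite -[X in _ --> X](mul0r (sine 1 x)); apply: cvgMl; apply: step_poly_cvg0.
have /andP[-> _] := t01 x; rewrite /=.
by have := cosE _ _ b0 b1 x0 x1 bx; rewrite /t /a; lra.
Qed.

Theorem sine_dense f : mfun f -> ('N[mu]_(q%:E)[EFin \o f] < +oo)%E ->
  approximable f.
Proof.
apply: (approximable_Lq mu1 q1 me (w := sine 1) (W := 1) (G := @RGenInftyO.G R)).
- exact: me.
- by move=> x; rewrite ler_norml sin_geN1 sin_le1.
- apply: (ae_unit (b := 0)) => x /andP[x0 x1] _; apply: sin_gt0_pi.
  by rewrite mulr1 mulr_gt0 ?pi_gt0//= gtr_pMr ?pi_gt0.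
- move=> _ _ [x ->] [y ->]; exists (Num.min x y).
  by apply/seteqP; split => z /=; rewrite !in_itv/= lt_min => /andP.
- exact: RGenInftyO.measurableE.
- exact: sine1_approximable.
- by move=> _ [b ->]; exact: approximable_sine_ray.
Qed.

End sine_density.

(** * M. Riesz's theorem for all exponents *)

Section sine_sums.
Context {R : realType}.
Implicit Types (a b : nat -> R) (M L : nat).
Local Notation int01 f := (\int[lebesgue_measure]_(x in `[0, 1]) f x).
Local Notation mu := (@lebesgue_unit R).

Definition sine_sum M b (x : R) := \sum_(i < M) b i * sine i x.

(** The bound is strict: the sine partial sum with frequencies up to N is [truncate N.+1]. *)
Definition truncate L b i : R := (i < L)%:R * b i.

Lemma continuous_sine_sum M b : continuous (sine_sum M b).
Proof.
apply: (continuous_sum_fun (h := fun k x => b k * sine k x)) => k.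
by apply: continuous_funM; [exact: continuous_fun_cst|exact: continuous_sine].
Qed.

Lemma sine_sum0 b x : sine_sum 0 b x = 0.
Proof. by rewrite /sine_sum big_ord0. Qed.

Lemma sine_sum_le M b x : `|sine_sum M b x| <= \sum_(i < M) `|b i|.
Proof.
rewrite (le_trans (ler_norm_sum _ _ _))//; apply: ler_sum => i _.
by rewrite normrM ler_piMr// ler_norml sin_geN1 sin_le1.
Qed.

Lemma sine_sum_freq M b x : sine_sum M.+1 b x = sin_sum M (fun k => b k.+1) natfreq x.
Proof. by rewrite /sine_sum big_ord_recl /sine mulr0 mul0r sin0 mulr0 add0r. Qed.

Lemma sine_sum_widen M M' b x : (M <= M')%N ->
  sine_sum M b x = sine_sum M' (truncate M b) x.
Proof.
move=> MM'; rewrite /sine_sum (big_ord_widen M' (fun i => b i * sine i x))// big_mkcond /=.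
by apply: eq_bigr => i _; rewrite /truncate; case: ifP; rewrite ?mul1r ?mul0r.
Qed.

(** Merges repeated indices and puts a list into the form on which truncation acts. *)
Lemma lincomb_sine (s : seq (nat * R)) : exists M b, lincomb (@sine R) s = sine_sum M b.
Proof.
elim: s => [|[i c] s [M [b IH]]].
  by exists 0%N, (fun=> 0); apply/funext => x; rewrite /lincomb big_nil sine_sum0.
exists (maxn M i.+1), (fun k => truncate M b k + (k == i)%:R * c); apply/funext => x.
rewrite /lincomb big_cons -/(lincomb (@sine R) s x) IH /=.
rewrite (@sine_sum_widen M (maxn M i.+1)) ?leq_maxl//.
have iM : (i < maxn M i.+1)%N by rewrite leq_maxr.
rewrite /sine_sum; under [in RHS]eq_bigr do rewrite mulrDl.
rewrite big_split /= addrC; congr (_ + _).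
rewrite (bigD1 (Ordinal iM))//= eqxx mul1r big1 ?addr0// => k ki.
by rewrite (_ : (val k == i) = false) ?mul0r//; apply: contraNF ki => /eqP ki; apply/eqP/val_inj.
Qed.

Lemma Rintegral_zero : int01 (fun _ : R => 0 : R) = 0.
Proof.
by have := @Rintegral_contZ R (cst 1) 0 0 1 (@continuous_fun_cst R 1); rewrite /= !mul0r.
Qed.

Lemma Rintegral_sum_cont n (h : nat -> R -> R) : (forall k, continuous (h k)) ->
  int01 (fun x => \sum_(k < n) h k x) = \sum_(k < n) int01 (h k).
Proof.
move=> ch; elim: n => [|n IH].
  rewrite big_ord0; under eq_Rintegral do rewrite big_ord0.
  exact: Rintegral_zero.
rewrite big_ord_recr /= -IH; under [LHS]eq_Rintegral do rewrite big_ord_recr /=.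
by apply: Rintegral_contD => //; exact: continuous_sum_fun.
Qed.

Lemma sine_sum_coef M b j : (0 < j)%N ->
  int01 (fun x => sine_sum M b x * sine j x) = truncate M b j / 2.
Proof.
move=> j0; under eq_Rintegral do rewrite mulr_suml.
rewrite (Rintegral_sum_cont M (h := fun k x => b k * sine k x * sine j x)); last first.
  move=> k; do 2 (apply: continuous_funM; last exact: continuous_sine).
  exact: continuous_fun_cst.
have term k : int01 (fun x => b k * sine k x * sine j x) = (k == j)%:R * (b j / 2).
  under eq_Rintegral do rewrite -mulrA.
  rewrite Rintegral_contZ; last by apply: continuous_funM; exact: continuous_sine.
  have [->|k0] := posnP k.
    under eq_Rintegral do rewrite /sine mulr0 mul0r sin0 mul0r.
    by rewrite Rintegral_zero mulr0 eq_sym (negbTE (lt0n_neq0 j0)) mul0r.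
  by rewrite sine_orthogonal//; case: eqVneq => [->|_]; rewrite ?mul1r ?mul0r ?mulr0.
under eq_bigr do rewrite term.
rewrite /truncate; have [jM|Mj] := ltnP j M.
  rewrite (bigD1 (Ordinal jM))//= eqxx !mul1r big1 ?addr0// => k kj.
  by rewrite (_ : (val k == j) = false) ?mul0r//; apply: contraNF kj => /eqP kj; apply/eqP/val_inj.
rewrite mul0r mul0r big1// => k _; rewrite (_ : (val k == j) = false) ?mul0r//.
by apply/negP => /eqP kj; have := ltn_ord k; rewrite kj ltnNge Mj.
Qed.

(** Truncation is self-adjoint by orthogonality; the duality argument for exponents above 2 rests on
    this. *)
Lemma sine_sum_truncate_sym M L a b :
  int01 (fun x => sine_sum M (truncate L a) x * sine_sum M b x) =
  int01 (fun x => sine_sum M a x * sine_sum M (truncate L b) x).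
Proof.
have E (a' b' : nat -> R) : int01 (fun x => sine_sum M a' x * sine_sum M b' x) =
    \sum_(j < M) b' j * ((0 < j)%:R * (a' j / 2)).
  under eq_Rintegral do rewrite mulr_sumr.
  rewrite (Rintegral_sum_cont M (h := fun k x => sine_sum M a' x * (b' k * sine k x))); last first.
    move=> k; apply: continuous_funM; first exact: continuous_sine_sum.
    by apply: continuous_funM; [exact: continuous_fun_cst|exact: continuous_sine].
  apply: eq_bigr => k _; under eq_Rintegral do rewrite mulrCA.
  rewrite Rintegral_contZ; last first.
    by apply: continuous_funM; [exact: continuous_sine_sum|exact: continuous_sine].
  congr (_ * _); have [->|k0] := posnP k.
    under eq_Rintegral do rewrite [sine 0 _]/sine mulr0 mul0r sin0 mulr0.
    by rewrite Rintegral_zero mul0r.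
  by rewrite sine_sum_coef// /truncate ltn_ord !mul1r.
by rewrite !E; apply: eq_bigr => k _; rewrite /truncate; ring.
Qed.

End sine_sums.

Section riesz_theorem.
Context {R : realType}.
Local Notation mu := (@lebesgue_unit R).
Local Notation int01 f := (\int[lebesgue_measure]_(x in `[0, 1]) f x).
Implicit Types (f g : R -> R) (q p : R) (b : nat -> R).

(* Locked, since unification would otherwise unfold two norms to the underlying
   Lebesgue integrals. *)
Definition unit_norm q f : R := locked ((int01 (fun x => `|f x| `^ q)) `^ q^-1).

Lemma unit_normE q f : unit_norm q f = (int01 (fun x => `|f x| `^ q)) `^ q^-1.
Proof. by rewrite /unit_norm -lock. Qed.

Lemma Lnorm_unit_norm q f : 1 < q -> continuous f ->
  'N[mu]_(q%:E)[EFin \o f]%E = (unit_norm q f)%:E.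
Proof. by move=> q1 cf; rewrite unit_normE; exact: Lnorm_unit. Qed.

Lemma unit_norm_ge0 q f : 0 <= unit_norm q f.
Proof. by rewrite unit_normE powR_ge0. Qed.

Lemma Rintegral_hoelder p q f g : 1 < p -> 1 < q -> p^-1 + q^-1 = 1 ->
  continuous f -> continuous g ->
  `|int01 (fun x => f x * g x)| <= unit_norm p f * unit_norm q g.
Proof.
move=> p1 q1 pq cf cg.
have mf : measurable_fun (setT : set (measurableTypeR R)) f by exact: continuous_measurable_fun.
have mg : measurable_fun (setT : set (measurableTypeR R)) g by exact: continuous_measurable_fun.
have cfg : continuous (fun x => f x * g x) by exact: continuous_funM.
have := hoelder mu mf mg (lt_trans ltr01 p1) (lt_trans ltr01 q1) pq.
rewrite (Lnorm_unit_norm p1 cf) (Lnorm_unit_norm q1 cg) -EFinM => H.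
rewrite -lee_fin; apply: le_trans H.
rewrite Lnorm1 integral_unit; last first.
  by do 2 apply: measurableT_comp => //; exact: measurable_funM.
have icfg := @continuous_integrable_itv R _ 0 1 cfg.
apply: le_trans (_ : (int01 (fun x => `|f x * g x|))%:E <= _)%E.
  by rewrite lee_fin; apply: le_normr_Rintegral => //; exact: measurable_itv.
rewrite /Rintegral fineK//; apply: (@integrable_fin_num _ _ _ lebesgue_measure) => //.
apply: continuous_integrable_itv => x.
exact: (@continuous_comp R R R _ (fun t => `|t|) x (cfg x) (@norm_continuous _ _ _)).
Qed.

Lemma riesz_le2 p : 1 < p -> p <= 2 -> exists2 C : R, 0 <= C & forall M L b,
  unit_norm p (sine_sum M (truncate L b)) <= C * unit_norm p (sine_sum M b).
Proof.
move=> p1 p2; have p0 : 0 < p by exact: lt_trans p1.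
pose K := 2 * (2 / (p - 1)) ^+ 2; have K0 : 0 <= K by rewrite mulr_ge0// sqr_ge0.
exists (K `^ p^-1) => [|M L b]; first exact: powR_ge0.
have int_ge0 N a : 0 <= int01 (fun x => `|sine_sum N a x| `^ p).
  by apply: Rintegral_ge0 => x _; exact: powR_ge0.
rewrite !unit_normE -powRM//; apply: ge0_ler_powR.
- by rewrite invr_ge0 ltW.
- by rewrite nnegrE.
- by rewrite nnegrE mulr_ge0.
case: M => [|M].
  under eq_Rintegral do rewrite sine_sum0.
  under [X in _ <= _ * X]eq_Rintegral do rewrite sine_sum0.
  by rewrite normr0 powR0 ?gt_eqF// Rintegral_zero mulr0.
(* [sin_sum] counts frequencies from 1, which shifts the cut by one; for [L = 0] both cuts are
   empty. *)
have := @riesz_sine_sum R p M L.-1 (fun k => b k.+1) p1 p2.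
under [X in _ -> _ <= _ * X]eq_Rintegral do rewrite sine_sum_freq.
under [X in _ -> X <= _]eq_Rintegral do rewrite sine_sum_freq.
rewrite (_ : (fun k => (k < L.-1)%:R * b k.+1) = (fun k => truncate L b k.+1)); first exact.
by apply/funext => k; rewrite /truncate; case: L.
Qed.

(** Duality. The function h = |T|^(q-2) T is extremal in Hölder's inequality: T h = |T|^q = |h|^p
    for the conjugate exponent p. Replace h by a sine sum close to it in L_p and move the truncation
    onto that sum, where the case p <= 2 applies. With I the integral of |T|^q this yields I <= C
    |G|_q I^(1/p), and dividing by I^(1/p) leaves |T|_q. *)
Lemma riesz_gt2 q : 2 < q -> exists2 C : R, 0 <= C & forall M L b,
  unit_norm q (sine_sum M (truncate L b)) <= C * unit_norm q (sine_sum M b).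
Proof.
move=> q2; have q1 : 1 < q by lra.
have q0 : 0 < q by lra.
pose p := q / (q - 1); have qB : 0 < q - 1 by lra.
have p1 : 1 < p by rewrite /p ltr_pdivlMr//; lra.
have p2 : p <= 2 by rewrite /p ler_pdivrMr//; lra.
have pq : q^-1 + p^-1 = 1 by rewrite /p; field; lra.
have [C C0 TC] := riesz_le2 p1 p2.
exists C; first exact: C0.
move=> M L b; set T := sine_sum M (truncate L b); set G := sine_sum M b.
have cT : continuous T by exact: continuous_sine_sum.
have cG : continuous G by exact: continuous_sine_sum.
pose h x := `|T x| `^ (q - 2) * T x.
have ch : continuous h.
  by apply: continuous_funM => //; apply: continuous_normr_powR => //; lra.
pose I := int01 (fun x => `|T x| `^ q).
have I0 : 0 <= I by apply: Rintegral_ge0 => x _; exact: powR_ge0.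
have Th x : T x * h x = `|T x| `^ q.
  have [Tx0|Tx0] := eqVneq (T x) 0; first by rewrite /h Tx0 mul0r normr0 powR0 ?gt_eqF.
  rewrite /h mulrCA -expr2 -[T x ^+ 2]real_normK ?num_real// -powR_mulrn//.
  by rewrite -powRD ?subrK// normr_eq0 Tx0 implybT.
have hp x : `|h x| `^ p = `|T x| `^ q.
  have [Tx0|Tx0] := eqVneq (T x) 0.
    by rewrite /h Tx0 mulr0 normr0 !powR0 ?gt_eqF// (lt_trans _ p1).
  rewrite /h normrM (ger0_norm (powR_ge0 _ _)) -[X in _ * X]powRr1//.
  rewrite -powRD; last by rewrite normr_eq0 Tx0 implybT.
  by rewrite -powRrM; congr (_ `^ _); rewrite /p; field; lra.
have Nh : unit_norm p h = I `^ p^-1.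
  by rewrite unit_normE; under eq_Rintegral do rewrite hp.
have key (eps : R) : 0 < eps -> I <= C * unit_norm q G * (I `^ p^-1 + eps) + unit_norm q T * eps.
  move=> eps0.
  have mh : measurable_fun (setT : set (measurableTypeR R)) h by exact: continuous_measurable_fun.
  have Nhfin : ('N[mu]_(p%:E)[EFin \o h] < +oo)%E by rewrite (Lnorm_unit_norm p1 ch) ltry.
  have [s Ns] := sine_dense p1 mh Nhfin eps0.
  have [M' [b' E]] := lincomb_sine s.
  rewrite (_ : h \- lincomb _ s = h \- sine_sum M' b') in Ns; last by rewrite -E.
  (* Symmetry of truncation is stated for sums of equal length, so both are padded to a common
     one. *)
  pose D := maxn M M'.
  have HE x : sine_sum M' b' x = sine_sum D (truncate M' b') x.
    by apply: sine_sum_widen; exact: leq_maxr.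
  rewrite (funext HE) in Ns; set a := truncate M' b' in Ns.
  set H := sine_sum D a in Ns.
  have cH : continuous H by exact: continuous_sine_sum.
  have chH : continuous (h \- H).
    by have := @continuous_funD R h (fun x => - H x) ch (@continuous_funN R H cH).
  have NhH : unit_norm p (h \- H) <= eps.
    by move: Ns; rewrite (Lnorm_unit_norm p1 chH) lee_fin.
  have NH : unit_norm p H <= I `^ p^-1 + eps.
    have mH : measurable_fun (setT : set (measurableTypeR R)) H by exact: continuous_measurable_fun.
    have m0 : measurable_fun (setT : set (measurableTypeR R)) (cst 0 : R -> R) by [].
    have := Lnorm_dist mu p1 mH mh m0.
    have s0 (f : R -> R) : f \- cst 0 = f by apply/funext => x /=; rewrite subr0.
    rewrite !s0 [X in (_ <= X + _)%E]Lnorm_subC (Lnorm_unit_norm p1 cH) (Lnorm_unit_norm p1 ch).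
    rewrite (Lnorm_unit_norm p1 chH) -EFinD lee_fin Nh addrC => /le_trans; apply.
    by rewrite lerD2l.
  have TE x : T x = sine_sum D (truncate L (truncate M b)) x.
    rewrite /T (@sine_sum_widen _ M D) ?leq_maxl//.
    by apply: eq_bigr => i _; rewrite /truncate; ring.
  have GE x : G x = sine_sum D (truncate M b) x by apply: sine_sum_widen; exact: leq_maxl.
  have cHL : continuous (sine_sum D (truncate L a)) by exact: continuous_sine_sum.
  have IE : I = int01 (fun x => G x * sine_sum D (truncate L a) x) +
      int01 (fun x => T x * (h \- H) x).
    under [X in _ = X + _]eq_Rintegral do rewrite GE.
    rewrite -sine_sum_truncate_sym; under [X in _ = X + _]eq_Rintegral do rewrite -TE.
    rewrite -(Rintegral_contD _ _ (continuous_funM cT cH) (continuous_funM cT chH)).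
    by apply: eq_Rintegral => x _; rewrite -Th /H /=; ring.
  rewrite {1}IE; apply: lerD.
    rewrite (le_trans (ler_norm _))//.
    rewrite (le_trans (Rintegral_hoelder q1 p1 pq cG cHL))//.
    rewrite (mulrC C) -mulrA; apply: ler_wpM2l; first exact: unit_norm_ge0.
    by rewrite (le_trans (TC _ _ _))// ler_wpM2l.
  rewrite (le_trans (ler_norm _))// (le_trans (Rintegral_hoelder q1 p1 pq cT chH))//.
  by apply: ler_wpM2l => //; exact: unit_norm_ge0.
have {}key : I <= C * unit_norm q G * I `^ p^-1.
  apply/ler_addgt0Pr => eps eps0.
  have w0 : 0 < C * unit_norm q G + unit_norm q T + 1.
    by rewrite ltr_wpDl// addr_ge0 ?mulr_ge0 ?unit_norm_ge0.
  have := key _ (divr_gt0 eps0 w0); rewrite mulrDr -addrA -mulrDl => /le_trans; apply.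
  by rewrite lerD2l mulrA ler_pdivrMr// mulrC ler_pM2l// lerDl.
have G0 := unit_norm_ge0 q G; rewrite [unit_norm q T]unit_normE -/I.
move: I0; rewrite le_eqVlt => /predU1P[I0|I0].
  by rewrite -I0 powR0 ?invr_eq0 ?gt_eqF// mulr_ge0.
have Ip : 0 < I `^ p^-1 by rewrite powR_gt0.
rewrite -(ler_pM2r Ip) -powRD; last by rewrite (gt_eqF I0) implybT.
by rewrite pq powRr1 ?(ltW I0).
Qed.

Theorem riesz q : 1 < q -> exists2 C : R, 0 <= C & forall M L b,
  unit_norm q (sine_sum M (truncate L b)) <= C * unit_norm q (sine_sum M b).
Proof. by move=> q1; have [q2|q2] := leP q 2; [exact: riesz_le2|exact: riesz_gt2]. Qed.

End riesz_theorem.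

(** * The Dirichlet inverse of the sine coefficients *)

Section dirichlet_inverse.
Context {R : realType}.
Implicit Types (a b f : nat -> R) (n m N i j : nat).

Lemma sum_ord_widen n N f : (n <= N)%N -> (forall i, (n <= i)%N -> f i = 0) ->
  \sum_(i < N) f i = \sum_(i < n) f i.
Proof.
move=> nN f0; rewrite -(big_mkord xpredT) (big_cat_nat _ nN)//= big_mkord.
by rewrite [X in _ + X]big_nat_cond [X in _ + X]big1 ?addr0// => i /andP[/andP[/f0]].
Qed.

Lemma sum_ord_delta N m (f : nat -> R) :
  \sum_(i < N) (m == i)%:R * f i = (m < N)%:R * f m.
Proof.
have [mN|Nm] := ltnP m N.
  rewrite (bigD1 (Ordinal mN))//= eqxx big1 ?addr0// => i im.
  by rewrite (_ : (m == i) = false) ?mul0r//; apply: contraNF im => /eqP im; apply/eqP/val_inj.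
rewrite mul0r big1// => i _; rewrite (_ : (m == i) = false) ?mul0r//.
by apply/negP => /eqP im; have := ltn_ord i; rewrite -im ltnNge Nm.
Qed.

Lemma sum_divisor_pairs_widen n N (h : nat -> nat -> R) : (0 < n)%N -> (n < N)%N ->
  \sum_(j < N) \sum_(i < N) (j * i == n)%N%:R * h j i =
  \sum_(j < n.+1) \sum_(i < n.+1) (j * i == n)%N%:R * h j i.
Proof.
move=> n0 nN; have neq0 j i : (n < j)%N || (n < i)%N -> (j * i == n)%N%:R * h j i = 0.
  move=> ji; rewrite (_ : (_ == _) = false) ?mul0r//; apply/negP => /eqP jiE.
  have : (0 < j * i)%N by rewrite jiE.
  by rewrite muln_gt0 => /andP[j0 i0]; move: ji; rewrite -jiE; case/orP; nia.
rewrite (sum_ord_widen (f := fun j => \sum_(i < N) (j * i == n)%N%:R * h j i) nN); last first.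
  by move=> j nj; apply: big1 => i _; rewrite neq0 ?nj.
apply: eq_bigr => j _.
rewrite (sum_ord_widen (f := fun i => (j * i == n)%N%:R * h j i) nN)// => i ni.
by rewrite neq0 ?ni ?orbT.
Qed.

Lemma strong_recursion (F : nat -> (nat -> R) -> R) :
  (forall n a b, (forall j, (j < n)%N -> a j = b j) -> F n a = F n b) ->
  exists d, forall n, d n = F n d.
Proof.
move=> Fext; pose dl := fix dl n := if n is n'.+1
  then rcons (dl n') (F n' (nth 0 (dl n'))) else [::].
have size_dl n : size (dl n) = n by elim: n => //= n IH; rewrite size_rcons IH.
pose d n := nth 0 (dl n.+1) n.
have dlE n j : (j < n)%N -> nth 0 (dl n) j = d j.
  elim: n => // n IH; rewrite ltnS leq_eqVlt => /predU1P[->//|jn].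
  by rewrite /= nth_rcons size_dl jn IH.
exists d => n; rewrite /d /= nth_rcons size_dl ltnn eqxx.
by apply: Fext => j jn; rewrite dlE.
Qed.

Variable c : nat -> R.
Hypothesis c1_gt0 : 0 < c 1.
Variable theta : R.
Hypothesis theta_lt1 : theta < 1.
Hypothesis c_tail : forall N, \sum_(i < N) (1 < i)%N%:R * `|c i| <= theta * c 1.

(* The Dirichlet inverse of [c] is absolutely summable because [c 1] dominates
   the other coefficients. *)
Lemma dirichlet_inverse : exists d : nat -> R,
  [/\ d 0%N = 0,
      forall n, (0 < n)%N -> \sum_(j < n.+1) \sum_(i < n.+1) (j * i == n)%N%:R * (d j * c i) =
        (n == 1)%N%:R &
      forall N, \sum_(j < N) `|d j| <= ((1 - theta) * c 1)^-1].
Proof.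
(* The Dirichlet convolution equation at [n], solved for its term [j = n], [i = 1]; the factor
   [1 < i] marks the remaining terms. *)
pose F n (d : nat -> R) : R := ((n == 1)%N%:R -
  \sum_(j < n) \sum_(i < n.+1) (j * i == n)%N%:R * ((1 < i)%N%:R * (d j * c i))) / c 1.
have [d dE] : exists d, forall n, d n = F n d.
  apply: strong_recursion => n a b ab; rewrite /F; congr ((_ - _) / _).
  by apply: eq_bigr => j _; apply: eq_bigr => i _; rewrite ab.
have d0 : d 0%N = 0 by rewrite dE /F big_ord0 subr0 mul0r.
have tailE n : (0 < n)%N ->
    \sum_(j < n) \sum_(i < n.+1) (j * i == n)%N%:R * ((1 < i)%N%:R * (d j * c i)) =
    \sum_(j < n.+1) \sum_(i < n.+1) (j * i == n)%N%:R * ((1 < i)%N%:R * (d j * c i)).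
  move=> n0; rewrite [RHS]big_ord_recr /= [X in _ = _ + X]big1 ?addr0// => i _.
  case: eqP; rewrite ?mul0r// => niE; rewrite (_ : (1 < i)%N = false) ?mul0r ?mulr0//.
  by apply/negP; move: (nat_of_ord i) niE => k; nia.
have dc n : (0 < n)%N -> d n * c 1 = (n == 1)%N%:R -
    \sum_(j < n.+1) \sum_(i < n.+1) (j * i == n)%N%:R * ((1 < i)%N%:R * (d j * c i)).
  move=> n0; rewrite -tailE// [d n]dE divfK; last by rewrite gt_eqF.
  by [].
exists d; split => //.
- move=> n n0; apply/eqP; rewrite -subr_eq0; apply/eqP.
  transitivity (d n * c 1 + \sum_(j < n.+1) \sum_(i < n.+1)
      (j * i == n)%N%:R * ((1 < i)%N%:R * (d j * c i)) - (n == 1)%N%:R); last first.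
    by rewrite dc//; ring.
  congr (_ - _).
  have -> : d n * c 1 = \sum_(j < n.+1) \sum_(i < n.+1) (n == j)%:R * ((1%N == i)%:R * (d j * c i)).
    under eq_bigr do rewrite -mulr_sumr.
    rewrite (sum_ord_delta _ _ (fun j => \sum_(i < n.+1) (1%N == i)%:R * (d j * c i))) ltnSn mul1r.
    by rewrite (sum_ord_delta _ _ (fun i => d n * c i)) ltnS n0 mul1r.
  rewrite -big_split /=; apply: eq_bigr => j _; rewrite -big_split /=; apply: eq_bigr => i _.
  case: i => -[|[|i]] ? /=; rewrite ?muln0 ?muln1.
  + by rewrite (ltn_eqF n0) !mul0r mulr0 addr0.
  + by rewrite (eq_sym (nat_of_ord j)); ring.
  + by ring.
move=> N; have c1n : c 1 != 0 by rewrite gt_eqF.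
rewrite -[leRHS]mul1r ler_pdivlMr ?mulr_gt0 ?subr_gt0//.
set D := \sum_(j < N) _.
have D0 : 0 <= D by apply: sumr_ge0.
(* Sum the recursion in absolute value over [n < N]: each pair (j, i) has one product, so it is
   counted at most once and the tail contributes at most D times the tail of [c]. Since [theta < 1],
   D can be absorbed. *)
suff : D * c 1 <= 1 + D * (theta * c 1) by nra.
have -> : D * c 1 = \sum_(n < N) `|d n * c 1|.
  by rewrite mulr_suml; apply: eq_bigr => n _; rewrite normrM (gtr0_norm c1_gt0).
apply: (@le_trans _ _ (\sum_(n < N) ((1%N == n)%:R +
    \sum_(j < N) \sum_(i < N) (j * i == n)%N%:R * (`|d j| * ((1 < i)%N%:R * `|c i|))))).
  apply: ler_sum => n _; have [n0|n0] := posnP n.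
    rewrite n0 d0 mul0r normr0 addr_ge0//; apply: sumr_ge0 => j _; apply: sumr_ge0 => i _.
    by rewrite !mulr_ge0.
  rewrite dc// (le_trans (ler_normB _ _))// eq_sym; apply: lerD.
    by rewrite ger0_norm.
  rewrite (sum_divisor_pairs_widen (fun j i => `|d j| * ((1 < i)%N%:R * `|c i|)) n0 (ltn_ord n)).
  rewrite (le_trans (ler_norm_sum _ _ _))//; apply: ler_sum => j _.
  rewrite (le_trans (ler_norm_sum _ _ _))//; apply: ler_sum => i _.
  by rewrite !normrM !normr_nat (mulrCA `|d j|).
rewrite big_split /=; apply: lerD.
  have := sum_ord_delta N 1 (fun=> 1).
  rewrite mulr1 (eq_bigr (fun i : 'I_N => (1%N == i)%:R)) => [->|i _].
    by case: (_ < _)%N.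
  by rewrite mulr1.
rewrite exchange_big mulr_suml /=; apply: ler_sum => j _.
rewrite exchange_big /=; apply: (@le_trans _ _ (\sum_(i < N) `|d j| * ((1 < i)%N%:R * `|c i|))).
  apply: ler_sum => i _.
  rewrite (sum_ord_delta _ _ (fun=> `|d j| * ((1 < i)%N%:R * `|c i|))).
  by rewrite ler_piMl ?mulr_ge0//; case: (_ < _)%N.
by rewrite -mulr_sumr ler_wpM2l.
Qed.

End dirichlet_inverse.

Section triangle_coefficients.
Context {R : realType}.
Local Notation c := (@triangle_coef R).

Lemma triangle_coef0 : c 0 = 0.
Proof. by rewrite /triangle_coef mulr0 mul0r sin0 mulr0 mul0r. Qed.

Lemma triangle_coef1_gt0 : 0 < c 1.
Proof.
by rewrite /triangle_coef mulr1 sin_pihalf mulr1 divr_gt0// exprn_gt0// pi_gt0.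
Qed.

Lemma triangle_coef_le i : `|c i.+1| <= c 1 / i.+1%:R ^+ 2.
Proof.
rewrite /triangle_coef mulr1 sin_pihalf mulr1 exprMn invfM mulrA normrM.
rewrite (ger0_norm (_ : 0 <= (i.+1%:R ^+ 2)^-1)) ?invr_ge0 ?sqr_ge0//.
apply: ler_wpM2r; first by rewrite invr_ge0 sqr_ge0.
rewrite normrM (ger0_norm (_ : 0 <= (pi ^+ 2)^-1)) ?invr_ge0 ?sqr_ge0//.
apply: ler_wpM2r; first by rewrite invr_ge0 sqr_ge0.
by rewrite normrM ger0_norm// ler_piMr// ler_norml sin_geN1 sin_le1.
Qed.

(** The subtracted term makes the induction telescope: 1/(x+1)^2 <= 1/x - 1/(x+1). The first sum,
    1/4 = 3/4 - 1/2, fixes the constant. *)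
Lemma inverse_squares_le n : \sum_(i < n.+1) (i.+2%:R ^+ 2)^-1 <= 3 / 4 - n.+2%:R^-1 :> R.
Proof.
elim: n => [|n IH]; first by rewrite big_ord1 /= (_ : (2 ^+ 2)^-1 = 4^-1 :> R); [lra|field].
rewrite big_ord_recr /=; apply: le_trans (lerD IH (lexx _)) _.
have n2 : 0 < n.+2%:R :> R by [].
rewrite -[n.+3%:R]natr1; move: n2; set x := n.+2%:R => x0.
have x1 : 0 < x + 1 by lra.
have -> : 3 / 4 - (x + 1)^-1 = 3 / 4 - x^-1 + (x * (x + 1))^-1.
  by field; rewrite !gt_eqF.
rewrite lerD2l lef_pV2 ?posrE ?exprn_gt0 ?mulr_gt0// expr2; nra.
Qed.

Lemma triangle_coef_tail N : \sum_(i < N) (1 < i)%N%:R * `|c i| <= 3 / 4 * c 1.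
Proof.
have tail n : \sum_(i < n) (i.+2%:R ^+ 2)^-1 <= 3 / 4 :> R.
  case: n => [|n]; first by rewrite big_ord0; lra.
  by rewrite (le_trans (inverse_squares_le n))// gerBl invr_ge0.
have c0 := triangle_coef1_gt0.
case: N => [|[|N]]; first by rewrite big_ord0; lra.
  by rewrite big_ord1 mul0r; lra.
rewrite !big_ord_recl !mul0r !add0r.
apply: (@le_trans _ _ (\sum_(i < N) (i.+2%:R ^+ 2)^-1 * c 1)).
  by apply: ler_sum => i _; rewrite mul1r mulrC; exact: triangle_coef_le.
by rewrite -mulr_suml ler_pM2r.
Qed.

Lemma triangle_coef_sum N : \sum_(i < N) `|c i| <= 2 * c 1.
Proof.
have c0 := triangle_coef1_gt0.
case: N => [|[|N]]; first by rewrite big_ord0; lra.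
  by rewrite big_ord1 triangle_coef0 normr0; lra.
have := triangle_coef_tail N.+2; rewrite !big_ord_recl !mul0r !add0r triangle_coef0 normr0 add0r.
under eq_bigr do rewrite mul1r.
by rewrite (gtr0_norm c0); lra.
Qed.

End triangle_coefficients.

(** * Dilates of the triangle wave *)

Section unit_norm_theory.
Context {R : realType}.
Variable q : R.
Hypothesis q1 : 1 < q.
Local Notation mu := (@lebesgue_unit R).
Local Notation mfun := (measurable_fun (setT : set (measurableTypeR R))).
Implicit Types f g : R -> R.

Lemma unit_normD f g : continuous f -> continuous g ->
  unit_norm q (fun x => f x + g x) <= unit_norm q f + unit_norm q g.
Proof.
move=> cf cg; have cfg : continuous (fun x => f x + g x) by exact: continuous_funD.
have mf : mfun f by exact: continuous_measurable_fun.
have mg : mfun g by exact: continuous_measurable_fun.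
have := minkowski_EFin mu mf mg (ltW q1).
by rewrite (Lnorm_unit_norm q1 cf) (Lnorm_unit_norm q1 cg) (Lnorm_unit_norm q1 cfg) -EFinD lee_fin.
Qed.

Lemma unit_normZ f (k : R) : continuous f ->
  unit_norm q (fun x => k * f x) = `|k| * unit_norm q f.
Proof.
move=> cf; have ckf : continuous (fun x => k * f x).
  by apply: continuous_funM => //; exact: continuous_fun_cst.
have mf : mfun f by exact: continuous_measurable_fun.
have := Lnorm_scale mu q1 k mf.
by rewrite (Lnorm_unit_norm q1 cf) (Lnorm_unit_norm q1 ckf) -EFinM => H; exact: EFin_inj H.
Qed.

Lemma unit_norm_le_sup f (K : R) : continuous f -> (forall x, `|f x| <= K) ->
  unit_norm q f <= K.
Proof.
move=> cf fK; have mf : mfun f by exact: continuous_measurable_fun.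
have := Lnorm_le_sup (mu := mu) lebesgue_unit_mass1 q1 mf fK.
by rewrite (Lnorm_unit_norm q1 cf) lee_fin.
Qed.

Lemma unit_norm_sum n (h : nat -> R -> R) : (forall k, continuous (h k)) ->
  unit_norm q (fun x => \sum_(k < n) h k x) <= \sum_(k < n) unit_norm q (h k).
Proof.
move=> ch; elim: n => [|n IH].
  rewrite big_ord0; apply: unit_norm_le_sup => [|x].
    by under eq_fun do rewrite big_ord0; exact: continuous_fun_cst.
  by rewrite big_ord0 normr0.
rewrite big_ord_recr /=; under eq_fun do rewrite big_ord_recr /=.
apply: le_trans (unit_normD _ _) _ => //; first exact: continuous_sum_fun.
by rewrite lerD2r.
Qed.

(** An inequality, in order to include [k = 0], where oddness gives f(0) = 0. *)
Lemma unit_norm_dilation f (k : nat) : continuous f ->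
  (forall x, f (x + 2) = f x) -> (forall x, f (- x) = - f x) ->
  unit_norm q (fun x => f (k%:R * x)) <= unit_norm q f.
Proof.
move=> cf f2 fN; have ck : continuous (fun x : R => f (k%:R * x)) by exact: continuous_dilate.
have [k0|k0] := posnP k.
  apply: le_trans (unit_norm_ge0 _ _); apply: unit_norm_le_sup => // x.
  have f0 : f 0 = 0 by have := fN 0; rewrite oppr0; lra.
  by rewrite k0 mul0r f0 normr0.
have := Lnorm_dilation q1 cf f2 fN k0.
rewrite (Lnorm_unit_norm q1 ck).
rewrite (Lnorm_unit_norm q1 cf).
by move=> H; rewrite le_eqVlt (EFin_inj H) eqxx.
Qed.

End unit_norm_theory.

Section triangle_wave_series.
Context {R : realType}.
Local Notation mu := (@lebesgue_unit R).
Local Notation int01 f := (\int[lebesgue_measure]_(x in `[0, 1]) f x).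
Local Notation mfun := (measurable_fun (setT : set (measurableTypeR R))).
Local Notation c := (@triangle_coef R).
Local Notation S := (@triangle_wave R).
Local Notation F I := (sine_sum I c).

Let cS : continuous S. Proof. exact: continuous_triangle_wave. Qed.
Let cSF I : continuous (fun x => S x - F I x).
Proof.
have cF : continuous (F I) by exact: continuous_sine_sum.
exact: (continuous_funD cS (continuous_funN cF)).
Qed.

Let SF_le I x : `|S x - F I x| <= 1 + 2 * c 1.
Proof.
rewrite (le_trans (ler_normB _ _))//; apply: lerD; first exact: triangle_wave_le1.
by rewrite (le_trans (sine_sum_le _ _ _))//; exact: triangle_coef_sum.
Qed.

Lemma remainder_orthogonal I M b : (M <= I)%N ->
  int01 (fun x => (S x - F I x) * sine_sum M b x) = 0.
Proof.
move=> MI; under eq_Rintegral do rewrite mulr_sumr.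
have cM k : continuous (fun x => (S x - F I x) * (b k * sine k x)).
  apply: continuous_funM; first exact: cSF.
  by apply: continuous_funM; [exact: continuous_fun_cst|exact: continuous_sine].
rewrite (Rintegral_sum_cont M cM) big1// => k _.
have [k0|k0] := posnP k.
  under eq_Rintegral do rewrite k0 [sine 0 _]/sine mulr0 mul0r sin0 !mulr0.
  exact: Rintegral_zero.
have cSs : continuous (fun x => S x * sine k x).
  by apply: continuous_funM => //; exact: continuous_sine.
have cFs : continuous (fun x => F I x * sine k x).
  by apply: continuous_funM; [exact: continuous_sine_sum|exact: continuous_sine].
under eq_Rintegral do rewrite mulrCA mulrBl.
rewrite (Rintegral_contZ (b k) _ _ (continuous_funD cSs (continuous_funN cFs))).
rewrite (Rintegral_contB _ _ cSs cFs) triangle_wave_coef// sine_sum_coef//.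
by rewrite /truncate (leq_trans (ltn_ord k) MI) mul1r subrr mulr0.
Qed.

(** Let u = S - F_I. By orthogonality the integral of u^2 is that of (S - H) u for any shorter sine
    sum H, so density of the sines and the bound |u| <= B make it small. To pass from L_2 to L_q use
    |u|^q <= B^(q-1) |u| and |u| <= t + u^2 / t. *)
Lemma triangle_wave_series (q eps : R) : 1 < q -> 0 < eps ->
  exists M, forall I, (M <= I)%N -> unit_norm q (fun x => S x - F I x) <= eps.
Proof.
move=> q1 eps0; have q0 : 0 < q by exact: lt_trans q1.
have c0 := @triangle_coef1_gt0 R.
pose B := 1 + 2 * c 1; have B0 : 0 < B by rewrite /B; lra.
have Bq : 0 < B `^ (q - 1) by rewrite powR_gt0.
(* Both [K * t] and [K / t * t ^+ 2] are then half of [eps ^ q]. *)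
pose t := eps `^ q / (2 * B `^ (q - 1)).
have t0 : 0 < t by rewrite divr_gt0 ?mulr_gt0 ?powR_gt0.
have lt12 : 1 < 2 :> R by lra.
have mS : mfun S by exact: continuous_measurable_fun.
have NS : ('N[mu]_(2%:E)[EFin \o S] < +oo)%E by rewrite (Lnorm_unit_norm lt12 cS) ltry.
have d0 : 0 < t ^+ 2 / B by rewrite divr_gt0 ?exprn_gt0.
have [s Ns] := sine_dense lt12 mS NS d0.
have [M [b E]] := lincomb_sine s.
rewrite (_ : S \- lincomb _ s = (fun x => S x - sine_sum M b x)) in Ns; last by rewrite -E.
exists M => I MI.
set u := fun x => S x - F I x; have cu : continuous u by exact: cSF.
have cH : continuous (sine_sum M b) by exact: continuous_sine_sum.
have cF : continuous (F I) by exact: continuous_sine_sum.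
have cSH : continuous (fun x => S x - sine_sum M b x).
  exact: (continuous_funD cS (continuous_funN cH)).
have cuu : continuous (fun x => u x * u x) by exact: continuous_funM.
have uu : int01 (fun x => u x * u x) <= t ^+ 2.
  have -> : int01 (fun x => u x * u x) = int01 (fun x => (S x - sine_sum M b x) * u x).
    have cuH := continuous_funM cu cH; have cuF := continuous_funM cu cF.
    have cSHu := continuous_funM cSH cu.
    transitivity (int01 (fun x => (S x - sine_sum M b x) * u x +
        (u x * sine_sum M b x - u x * F I x))).
      by apply: eq_Rintegral => x _; rewrite /u; ring.
    rewrite (Rintegral_contD _ _ cSHu (continuous_funD cuH (continuous_funN cuF))).
    rewrite (Rintegral_contB _ _ cuH cuF) !remainder_orthogonal ?subrr ?addr0//.
  have mSH : mfun (fun x => S x - sine_sum M b x) by exact: continuous_measurable_fun.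
  have mu_ : mfun u by exact: continuous_measurable_fun.
  have NSH : ('N[mu]_(2%:E)[EFin \o (fun x => S x - sine_sum M b x)%R] < +oo)%E.
    by rewrite (le_lt_trans Ns)// ltry.
  have := Lnorm_pairing (mu := mu) lebesgue_unit_mass1 lt12 (ltW B0) mSH NSH mu_ (@SF_le I).
  rewrite Rintegral_unit; last exact: measurable_funM.
  move=> /le_trans/(_ (lee_wpmul2l _ Ns)); rewrite -EFinM !lee_fin => /(_ (ltW B0)).
  by rewrite mulrCA divff ?gt_eqF// mulr1; apply: le_trans; exact: ler_norm.
rewrite unit_normE.
have -> : eps = (eps `^ q) `^ q^-1.
  by rewrite -powRrM divff ?gt_eqF// powRr1// ltW.
apply: ge0_ler_powR; first by rewrite invr_ge0 ltW.
- by rewrite nnegrE; apply: Rintegral_ge0 => x _; exact: powR_ge0.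
- by rewrite nnegrE powR_ge0.
pose K := B `^ (q - 1).
have cK : continuous (fun x => K * t + K / t * (u x * u x)).
  apply: continuous_funD; first exact: continuous_fun_cst.
  by apply: continuous_funM => //; exact: continuous_fun_cst.
apply: le_trans (_ : int01 (fun x => K * t + K / t * (u x * u x)) <= _).
  apply: le_Rintegral_cont => // [|x _]; first exact: continuous_normr_powR.
  have uB : `|u x| <= B by exact: SF_le.
  have -> : `|u x| `^ q = `|u x| `^ (q - 1) * `|u x|.
    have [->|ux] := eqVneq (u x) 0; first by rewrite normr0 mulr0 powR0 ?gt_eqF.
    by rewrite -[X in _ * X]powRr1// -powRD ?subrK// normr_eq0 ux implybT.
  rewrite -mulrA -mulrDr; apply: ler_pM => //.
    by apply: ge0_ler_powR => //; rewrite ?nnegrE ?(ltW B0)//; lra.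
  have [ut|tu] := leP `|u x| t.
    by rewrite (le_trans ut)// lerDl mulr_ge0 ?invr_ge0 ?(ltW t0)// -expr2 sqr_ge0.
  rewrite -[leLHS]add0r lerD ?(ltW t0)// mulrC ler_pdivlMr// -[u x * u x]expr2.
  by rewrite -[u x ^+ 2]real_normK ?num_real// expr2 ler_wpM2l// ltW.
have cKu : continuous (fun x => K / t * (u x * u x)).
  by apply: continuous_funM => //; exact: continuous_fun_cst.
rewrite (Rintegral_contD _ _ (@continuous_fun_cst R (K * t)) cKu) (Rintegral_contZ _ _ _ cuu).
have -> : int01 (fun=> K * t) = K * t.
  have := Rintegral_contZ (K * t) 0 1 (@continuous_fun_cst R 1).
  have d1 (x : R) : is_derive x 1 (fun x : R => x) 1 by exact: is_derive_id.
  by rewrite (Rintegral_derivative ltr01 (@continuous_fun_cst R 1) d1) subr0 mulr1.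
apply: (@le_trans _ _ (K * t + K / t * t ^+ 2)).
  by rewrite lerD2l ler_wpM2l// divr_ge0 ?ltW// powR_gt0.
have tn0 : t != 0 by rewrite gt_eqF.
have Kn0 : K != 0 by rewrite gt_eqF.
rewrite (_ : K * t + K / t * t ^+ 2 = 2 * K * t); last by field.
by rewrite /t -/K mulrC divfK// mulf_neq0.
Qed.

End triangle_wave_series.

Section wave_sums.
Context {R : realType}.
Local Notation int01 f := (\int[lebesgue_measure]_(x in `[0, 1]) f x).
Local Notation c := (@triangle_coef R).
Local Notation S := (@triangle_wave R).
Local Notation F I := (sine_sum I c).
Implicit Types (b : nat -> R) (M I : nat).

Definition wave (k : nat) (x : R) : R := S (k%:R * x).

Definition wave_sum M b (x : R) : R := \sum_(k < M) b k * wave k x.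

Lemma continuous_wave k : continuous (wave k).
Proof. by apply: continuous_dilate; exact: continuous_triangle_wave. Qed.

Lemma wave_le1 k x : `|wave k x| <= 1.
Proof. exact: triangle_wave_le1. Qed.

Lemma wave0 x : wave 0 x = 0.
Proof. by rewrite /wave mul0r; have := triangle_waveN (0 : R); rewrite oppr0; lra. Qed.

Lemma wave_dilate k j x : wave k (j%:R * x) = wave (j * k) x.
Proof. by rewrite /wave mulrA -natrM mulnC. Qed.

Lemma waveN k x : wave k (- x) = - wave k x.
Proof. by rewrite /wave mulrN triangle_waveN. Qed.

Lemma waveD2 k x : wave k (x + 2) = wave k x.
Proof.
rewrite /wave mulrDr; elim: k => [|k IH]; first by rewrite !mul0r addr0.
have shift (n : nat) (y : R) : S (y + n%:R * 2) = S y.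
  elim: n => [|n IHn]; first by rewrite mul0r addr0.
  by rewrite -natr1 mulrDl mul1r addrA triangle_waveD2.
exact: shift.
Qed.

Lemma continuous_wave_sum M b : continuous (wave_sum M b).
Proof.
apply: (continuous_sum_fun (h := fun k x => b k * wave k x)) => k.
by apply: continuous_funM; [exact: continuous_fun_cst|exact: continuous_wave].
Qed.

Lemma wave_sumN M b x : wave_sum M b (- x) = - wave_sum M b x.
Proof. by rewrite /wave_sum -sumrN; apply: eq_bigr => k _; rewrite waveN mulrN. Qed.

Lemma wave_sumD2 M b x : wave_sum M b (x + 2) = wave_sum M b x.
Proof. by apply: eq_bigr => k _; rewrite waveD2. Qed.

Lemma sine_sumN M b x : sine_sum M b (- x) = - sine_sum M b x.
Proof. by rewrite /sine_sum -sumrN; apply: eq_bigr => k _; rewrite sineN mulrN. Qed.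

Lemma sine_sumD2 M b x : sine_sum M b (x + 2) = sine_sum M b x.
Proof. by apply: eq_bigr => k _; rewrite sineD2. Qed.

Let continuous_remainder I k : continuous (fun x : R => wave k x - F I (k%:R * x)).
Proof.
apply: continuous_funD; first exact: continuous_wave.
by apply: continuous_funN; apply: continuous_dilate; exact: continuous_sine_sum.
Qed.

Lemma wave_remainder_le (q : R) I k : 1 < q ->
  unit_norm q (fun x => wave k x - F I (k%:R * x)) <= unit_norm q (fun x => S x - F I x).
Proof.
move=> q1; apply: (@unit_norm_dilation R q q1 (fun x => S x - F I x) k).
- have cF : continuous (F I) by exact: continuous_sine_sum.
  exact: (continuous_funD (@continuous_triangle_wave R) (continuous_funN cF)).
- by move=> x; rewrite triangle_waveD2 sine_sumD2.
- by move=> x; rewrite triangle_waveN sine_sumN opprD.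
Qed.

(** Expanding S in its sine series turns a wave sum into sum_i c_i h(i x), where h is the sine sum
    with the same coefficients. Dilations do not increase the norm of h and the |c_i| add up to at
    most 2 c_1; the error of a finite expansion is absorbed in [eps]. *)
Lemma wave_sum_le (q : R) M b : 1 < q ->
  unit_norm q (wave_sum M b) <= 2 * c 1 * unit_norm q (sine_sum M b).
Proof.
move=> q1; apply/ler_addgt0Pr => eps eps0.
set Bb := \sum_(i < M) `|b i|; have Bb0 : 0 <= Bb by apply: sumr_ge0.
have e0 : 0 < eps / (Bb + 1) by rewrite divr_gt0// ltr_wpDl.
have [I /(_ I (leqnn I)) SI] := triangle_wave_series q1 e0.
have cD k : continuous (fun x : R => c k * sine_sum M b (k%:R * x)).
  apply: continuous_funM; first exact: continuous_fun_cst.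
  by apply: continuous_dilate; exact: continuous_sine_sum.
have cE k : continuous (fun x : R => b k * (wave k x - F I (k%:R * x))).
  by apply: continuous_funM; [exact: continuous_fun_cst|exact: continuous_remainder].
have -> : wave_sum M b = (fun x => \sum_(k < I) c k * sine_sum M b (k%:R * x) +
    \sum_(k < M) b k * (wave k x - F I (k%:R * x))).
  apply/funext => x; under eq_bigr do rewrite mulr_sumr.
  rewrite exchange_big /= -big_split /=; apply: eq_bigr => i _.
  rewrite -[LHS](subrK (b i * F I (i%:R * x))) -mulrBr addrC; congr (_ + _).
  rewrite mulr_sumr; apply: eq_bigr => k _.
  by rewrite !sine_dilate mulnC; ring.
have cDs := continuous_sum_fun (n := I) cD; have cEs := continuous_sum_fun (n := M) cE.
apply: le_trans (unit_normD q1 cDs cEs) _; apply: lerD.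
  apply: le_trans (unit_norm_sum q1 I cD) _.
  apply: (@le_trans _ _ (\sum_(k < I) `|c k| * unit_norm q (sine_sum M b))).
    apply: ler_sum => k _.
    have ck : continuous (fun x : R => sine_sum M b (k%:R * x)).
      by apply: continuous_dilate; exact: continuous_sine_sum.
    rewrite (unit_normZ q1 (c k) ck).
    apply: ler_wpM2l; first exact: normr_ge0.
    apply: (unit_norm_dilation q1).
    - exact: continuous_sine_sum.
    - exact: sine_sumD2.
    - exact: sine_sumN.
  by rewrite -mulr_suml ler_wpM2r ?unit_norm_ge0// triangle_coef_sum.
apply: le_trans (unit_norm_sum q1 M cE) _.
apply: (@le_trans _ _ (\sum_(k < M) `|b k| * (eps / (Bb + 1)))).
  apply: ler_sum => k _; rewrite (unit_normZ q1 (b k) (@continuous_remainder I k)).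
  apply: ler_wpM2l; first exact: normr_ge0.
  exact: le_trans (wave_remainder_le I k q1) SI.
by rewrite -mulr_suml -/Bb mulrCA ger_pMr// ler_pdivrMr ?mul1r ?ltr_wpDl// lerDl.
Qed.

(** At most one term of the sum is nonzero, that of i = j / k; the form as a sum fits the Dirichlet
    convolution. *)
Lemma wave_coef k j I : (0 < k)%N -> (0 < j)%N -> (j < I)%N ->
  int01 (fun x => wave k x * sine j x) = (\sum_(i < I) (k * i == j)%N%:R * c i) / 2.
Proof.
move=> k0 j0 jI.
have lt12 : 1 < 2 :> R by lra.
have inv2 : 2^-1 + 2^-1 = 1 :> R by lra.
apply/eqP; rewrite -subr_eq0 -normr_le0; apply/ler_addgt0Pr => eps eps0; rewrite add0r.
pose K := unit_norm 2 (@sine R j); have K0 : 0 <= K by exact: unit_norm_ge0.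
have e0 : 0 < eps / (K + 1) by rewrite divr_gt0// ltr_wpDl.
have [I' SI] := triangle_wave_series lt12 e0.
pose D := maxn I I'; have {}SI := SI D (leq_maxr _ _).
have cF : continuous (fun x : R => F D (k%:R * x)).
  by apply: continuous_dilate; exact: continuous_sine_sum.
have cW := @continuous_wave k; have cs := @continuous_sine R j.
have cWs := continuous_funM cW cs; have cFs := continuous_funM cF cs.
have FE : int01 (fun x => F D (k%:R * x) * sine j x) = (\sum_(i < I) (k * i == j)%N%:R * c i) / 2.
  have -> : \sum_(i < I) (k * i == j)%N%:R * c i = \sum_(i < D) (k * i == j)%N%:R * c i.
    symmetry; apply: (sum_ord_widen (f := fun i => (k * i == j)%N%:R * c i)); first exact: leq_maxl.
    move=> i Ii; rewrite (_ : (_ == _) = false) ?mul0r//; apply/negP => /eqP kij.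
    by have := leq_trans jI Ii; rewrite -kij ltnNge leq_pmull.
  under eq_Rintegral do rewrite mulr_suml.
  rewrite (Rintegral_sum_cont D (h := fun i x => c i * sine i (k%:R * x) * sine j x)); last first.
    move=> i; apply: continuous_funM => //; apply: continuous_funM; first exact: continuous_fun_cst.
    by apply: continuous_dilate; exact: continuous_sine.
  rewrite mulr_suml; apply: eq_bigr => i _.
  under eq_Rintegral do rewrite sine_dilate -mulrA.
  rewrite Rintegral_contZ; last by apply: continuous_funM; exact: continuous_sine.
  have [i0|i0] := posnP i.
    by rewrite i0 triangle_coef0 mul0r mulr0 mul0r.
  by rewrite sine_orthogonal ?muln_gt0 ?i0// mulnC; ring.
rewrite -FE -(Rintegral_contB _ _ cWs cFs).
under eq_Rintegral do rewrite -mulrBl.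
apply: le_trans (Rintegral_hoelder lt12 lt12 inv2 (@continuous_remainder D k) cs) _.
apply: (@le_trans _ _ (eps / (K + 1) * K)).
  rewrite -/K; apply: (ler_wpM2r K0); exact: le_trans (wave_remainder_le D k lt12) SI.
by rewrite -mulrA ger_pMr// mulrC ler_pdivrMr ?mul1r ?ltr_wpDl// lerDl.
Qed.

End wave_sums.

Section dual_functions.
Context {R : realType}.
Local Notation int01 f := (\int[lebesgue_measure]_(x in `[0, 1]) f x).
Local Notation c := (@triangle_coef R).
Variables (d : nat -> R) (Dd : R).
Hypothesis d0 : d 0%N = 0.
Hypothesis dc : forall n, (0 < n)%N ->
  \sum_(j < n.+1) \sum_(i < n.+1) (j * i == n)%N%:R * (d j * c i) = (n == 1)%N%:R.
Hypothesis d_sum : forall N, \sum_(j < N) `|d j| <= Dd.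
Implicit Types (k l m : nat) (b : nat -> R).

Definition dual k (x : R) : R :=
  \sum_(j < k.+1) \sum_(i < k.+1) (j * i == k)%N%:R * (d j * (2 * sine i x)).

Lemma continuous_dual k : continuous (dual k).
Proof.
apply: (continuous_sum_fun (h := fun j x =>
  \sum_(i < k.+1) (j * i == k)%N%:R * (d j * (2 * sine i x)))) => j.
apply: (continuous_sum_fun (h := fun i x => (j * i == k)%N%:R * (d j * (2 * sine i x)))) => i.
do 3 (apply: continuous_funM; first exact: continuous_fun_cst).
exact: continuous_sine.
Qed.

Lemma dual_pairing k (f : R -> R) : continuous f ->
  int01 (fun x => f x * dual k x) =
  \sum_(j < k.+1) \sum_(i < k.+1)
    (j * i == k)%N%:R * (d j * (2 * int01 (fun x => f x * sine i x))).
Proof.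
move=> cf; have cfs i : continuous (fun x => f x * sine i x).
  by apply: continuous_funM => //; exact: continuous_sine.
have cji (j i : nat) : continuous (fun x => (j * i == k)%N%:R * d j * 2 * (f x * sine i x)).
  by apply: continuous_funM => //; exact: continuous_fun_cst.
transitivity (int01 (fun x => \sum_(j < k.+1) \sum_(i < k.+1)
    (j * i == k)%N%:R * d j * 2 * (f x * sine i x))).
  apply: eq_Rintegral => x _; rewrite mulr_sumr; apply: eq_bigr => j _.
  by rewrite mulr_sumr; apply: eq_bigr => i _; ring.
rewrite (Rintegral_sum_cont k.+1 (h := fun j x => \sum_(i < k.+1)
    (j * i == k)%N%:R * d j * 2 * (f x * sine i x))); last first.
  by move=> j; exact: (continuous_sum_fun (n := k.+1) (cji j)).
apply: eq_bigr => j _; rewrite (Rintegral_sum_cont k.+1 (cji j)).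
by apply: eq_bigr => i _; rewrite (Rintegral_contZ _ _ _ (cfs i)); ring.
Qed.

(** The pairing is the sum of d_j c_r over j k r = l. It is empty unless k divides l, and otherwise
    it is the Dirichlet convolution of d and c at l / k. *)
Lemma wave_dual_biorthogonal k l : (0 < k)%N -> (0 < l)%N ->
  int01 (fun x => wave k x * dual l x) = (k == l)%:R.
Proof.
move=> k0 l0; rewrite dual_pairing; last exact: continuous_wave.
transitivity (\sum_(j < l.+1) \sum_(r < l.+1) (j * (k * r) == l)%N%:R * (d j * c r)).
  apply: eq_bigr => j _.
  transitivity (\sum_(i < l.+1) \sum_(r < l.+1)
      (k * r == i)%N%:R * ((j * i == l)%N%:R * (d j * c r))).
    apply: eq_bigr => i _; have [jil|] := eqVneq (j * i)%N l; last first.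
      by rewrite mul0r => _; rewrite big1// => r _; rewrite mul0r mulr0.
    have /andP[_ i0] : (0 < j)%N && (0 < i)%N by rewrite -muln_gt0 jil.
    rewrite mul1r (@wave_coef R k i l.+1 k0 i0 (ltn_ord i)) (mulrCA 2) divff// mulr1.
    by rewrite mulr_sumr; apply: eq_bigr => r _; rewrite mul1r; ring.
  rewrite exchange_big /=; apply: eq_bigr => r _.
  rewrite (sum_ord_delta _ _ (fun i => (j * i == l)%N%:R * (d j * c r))).
  have [|krl] := ltnP (k * r) l.+1; first by rewrite mul1r.
  rewrite (_ : (j * (k * r) == l)%N = false) ?mul0r ?mulr0//.
  case: (nat_of_ord j) => [|j']; first by rewrite mul0n (ltn_eqF l0).
  by apply: gtn_eqF; rewrite (leq_trans krl)// leq_pmull.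
have [/dvdnP[n lE]|kl] := boolP (k %| l)%N; last first.
  rewrite (_ : (k == l) = false); last by apply: contraNF kl => /eqP ->.
  rewrite big1// => j _; rewrite big1// => r _.
  rewrite (_ : (_ == _) = false) ?mul0r//; apply: contraNF kl => /eqP <-.
  by rewrite mulnCA dvdn_mulr.
have n0 : (0 < n)%N by move: l0; rewrite lE muln_gt0 => /andP[].
have nl : (n < l.+1)%N by rewrite lE ltnS leq_pmulr.
have -> : (k == l) = (n == 1)%N by rewrite lE -[X in X == _]mul1n eqn_pmul2r// eq_sym.
rewrite -(dc n0) -(sum_divisor_pairs_widen (fun j i => d j * c i) n0 nl).
apply: eq_bigr => j _; apply: eq_bigr => r _; congr (_%:R * _).
by move: (nat_of_ord j) (nat_of_ord r) => j' r'; rewrite lE mulnCA mulnC eqn_pmul2r.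
Qed.

(** Group the pairs with j i <= m by [j]: then [i] runs up to [m %/ j], and the wave of index j i at
    x is the wave of index i at j x. *)
Lemma partial_sum_sine_sum m M b x :
  \sum_(k < m.+1) int01 (fun y => sine_sum M b y * dual k y) * wave k x =
  \sum_(j < m.+1) d j * wave_sum m.+1 (truncate (m %/ j).+1 (truncate M b)) (j%:R * x).
Proof.
transitivity (\sum_(k < m.+1) \sum_(j < m.+1) \sum_(i < m.+1)
    (j * i == k)%N%:R * (d j * truncate M b i * wave k x)).
  apply: eq_bigr => k _; have [k0|k0] := posnP k.
    rewrite k0 wave0 mulr0 big1// => j _; rewrite big1// => i _.
    by rewrite mulr0 mulr0.
  rewrite dual_pairing; last exact: continuous_sine_sum.
  rewrite mulr_suml.
  transitivity (\sum_(j < k.+1) \sum_(i < k.+1)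
      (j * i == k)%N%:R * (d j * truncate M b i * wave k x)).
    apply: eq_bigr => j _; rewrite mulr_suml; apply: eq_bigr => i _.
    have [jik|] := eqVneq (j * i)%N k; last by rewrite !mul0r.
    have /andP[_ i0] : (0 < j)%N && (0 < i)%N by rewrite -muln_gt0 jik.
    by rewrite sine_sum_coef// (mulrCA 2) divff// mulr1 !mul1r.
  by rewrite (sum_divisor_pairs_widen (fun j i => d j * truncate M b i * wave k x) k0 (ltn_ord k)).
rewrite exchange_big /=; apply: eq_bigr => j _; rewrite exchange_big /= mulr_sumr.
apply: eq_bigr => i _.
rewrite (sum_ord_delta _ _ (fun k => d j * truncate M b i * wave k x)) wave_dilate.
(* Division by 0 gives 0 here; the term is harmless because [d 0 = 0]. *)
have [j0|j0] := posnP j; first by rewrite j0 d0 !mul0r mulr0.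
rewrite [in RHS]/truncate !ltnS leq_divRL// mulnC -/(truncate M b i); ring.
Qed.

Theorem partial_sum_bounded (q : R) : 1 < q -> exists2 C : R, 0 <= C & forall m M b,
  unit_norm q (fun x => \sum_(k < m.+1) int01 (fun y => sine_sum M b y * dual k y) * wave k x)
    <= C * unit_norm q (sine_sum M b).
Proof.
move=> q1; have [C C0 TC] := riesz q1; have c1 := @triangle_coef1_gt0 R.
have D0 : 0 <= Dd by apply: le_trans (d_sum 0); rewrite big_ord0.
have A0 : 0 <= 2 * c 1 * (C * C) by apply: mulr_ge0; apply: mulr_ge0 => //; exact: ltW.
exists (Dd * (2 * c 1 * (C * C))) => [|m M b]; first exact: mulr_ge0.
under eq_fun do rewrite partial_sum_sine_sum.
pose w j := wave_sum m.+1 (truncate (m %/ j).+1 (truncate M b)).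
have cw j : continuous (fun x : R => w j (j%:R * x)).
  by apply: continuous_dilate; exact: continuous_wave_sum.
have cdw j : continuous (fun x : R => d j * w j (j%:R * x)).
  by apply: continuous_funM => //; exact: continuous_fun_cst.
apply: le_trans (unit_norm_sum q1 m.+1 cdw) _.
set G := unit_norm q (sine_sum M b); have G0 : 0 <= G by exact: unit_norm_ge0.
apply: (@le_trans _ _ (\sum_(j < m.+1) `|d j| * (2 * c 1 * (C * C) * G))); last first.
  rewrite -mulr_suml -[leRHS]mulrA; apply: ler_wpM2r (d_sum _).
  exact: mulr_ge0.
apply: ler_sum => j _; rewrite (unit_normZ q1 (d j) (@cw j)).
apply: ler_wpM2l; first exact: normr_ge0.
have cws : continuous (w j) by exact: continuous_wave_sum.
apply: le_trans (unit_norm_dilation q1 j cws (@wave_sumD2 R _ _) (@wave_sumN R _ _)) _.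
apply: le_trans (wave_sum_le _ _ q1) _.
rewrite -[leRHS]mulrA; apply: ler_wpM2l; first by rewrite mulr_ge0// ltW.
(* The length [m.+1] is itself a truncation, so Riesz's bound is applied twice, whence [C * C]. *)
pose D := maxn m.+1 M.
rewrite (_ : sine_sum m.+1 _ = sine_sum D
  (truncate m.+1 (truncate (m %/ j).+1 (truncate M b)))); last first.
  by apply/funext => x; apply: sine_sum_widen; exact: leq_maxl.
apply: le_trans (TC _ _ _) _; rewrite -mulrA; apply: (ler_wpM2l C0).
apply: le_trans (TC _ _ _) _; apply: (ler_wpM2l C0).
rewrite le_eqVlt; apply/orP; left; apply/eqP; congr (unit_norm q _).
by apply/funext => x; rewrite (@sine_sum_widen R M D)// leq_maxr.
Qed.

End dual_functions.

Section triangle_system.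
Context {R : realType}.
Variable q : R.
Hypothesis q1 : 1 < q.
Local Notation mu := (@lebesgue_unit R).
Local Notation int01 f := (\int[lebesgue_measure]_(x in `[0, 1]) f x).
Local Notation mfun := (measurable_fun (setT : set (measurableTypeR R))).
Local Notation c := (@triangle_coef R).
Local Notation N f := (Lnorm mu q%:E (EFin \o f%R)).
Let mu1 : mu setT = 1%E. Proof. exact: lebesgue_unit_mass1. Qed.

Definition pos_wave (k : {k : nat | (0 < k)%N}) : measurableTypeR R -> R := wave (val k).

Let mw k : mfun (wave k).
Proof. by apply: continuous_measurable_fun; exact: continuous_wave. Qed.

Let me k : mfun (pos_wave k). Proof. exact: mw. Qed.

Lemma Lnorm_le_add (f g : R -> R) : mfun f -> mfun g -> (N f <= N g + N (f \- g))%E.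
Proof.
move=> mf mg; have m0 : mfun (cst 0 : R -> R) by [].
have s0 (h : R -> R) : h \- cst 0 = h by apply/funext => x /=; rewrite subr0.
by have := Lnorm_dist mu q1 mf mg m0; rewrite !s0 addeC.
Qed.

Section density.

Local Notation within := (within mu q pos_wave).

Let within_norm r f : (N f <= r%:E)%E -> within r f.
Proof.
move=> Nf eps eps0; exists [::].
rewrite (_ : f \- _ = f); last by apply/funext => x; rewrite /= /lincomb big_nil subr0.
by rewrite (le_trans Nf)// lee_fin lerDl ltW.
Qed.

Let within_le r r' f : r <= r' -> within r f -> within r' f.
Proof.
move=> rr' wf eps eps0; have [s Ns] := wf _ eps0; exists s.
by rewrite (le_trans Ns)// lee_fin lerD2r.
Qed.

Let within_sum r n (a : nat -> R) (f : nat -> R -> R) : 0 <= r -> (forall i, mfun (f i)) ->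
  (forall i, (i < n)%N -> a i != 0 -> within r (f i)) ->
  within ((\sum_(i < n) `|a i|) * r) (fun x => \sum_(i < n) a i * f i x).
Proof.
move=> r0 mf; elim: n => [|n IH] wf.
  apply: within_norm; under eq_fun do rewrite big_ord0; rewrite big_ord0 mul0r.
  by rewrite (Lnorm_cst mu1 q1 0) normr0.
rewrite big_ord_recr mulrDl (_ : (fun x : R => _) =
  (fun x => \sum_(i < n) a i * f i x + a n * f n x)); last first.
  by apply/funext => x; rewrite big_ord_recr.
apply: (withinD q1 me).
- by apply: measurable_sum => i; exact: measurable_funM.
- exact: measurable_funM.
- by apply: IH => i iN; apply: wf; rewrite ltnW.
have [->|an] := eqVneq (a n) 0; last by apply: (withinZ q1 me) => //; exact: wf.
rewrite normr0 mul0r; apply: within_norm.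
rewrite (_ : (fun x : R => _) = cst 0); last by apply/funext => x; rewrite mul0r.
by rewrite (Lnorm_cst mu1 q1 0) normr0.
Qed.

Let msine i : mfun (@sine R i).
Proof. by apply: continuous_measurable_fun; exact: continuous_sine. Qed.

(* Solve [S(l x) = sum_i c_i sin(i l pi x)] for the term [i = 1]: every round
   multiplies the distance of the sines to the span by 3/4. *)
Let sine_within n l : (0 < l)%N -> within ((3 / 4) ^+ n) (sine l).
Proof.
have c1 := @triangle_coef1_gt0 R.
elim: n l => [|n IH] l l0.
  apply: within_norm; rewrite expr0; apply: (Lnorm_le_sup mu1 q1) => // x.
  by rewrite ler_norml sin_geN1 sin_le1.
pose r : R := (3 / 4) ^+ n; have r0 : 0 <= r by apply: exprn_ge0; lra.
move=> eps eps0.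
have e2 : 0 < eps / 2 by rewrite divr_gt0.
have e0 : 0 < c 1 * (eps / 2) by rewrite mulr_gt0.
have [M SM] := triangle_wave_series q1 e0.
(* At least 2, so that the term [i = 1] to be solved for is present. *)
pose I := maxn M 2; have SI := SM I (leq_maxl _ _).
pose rem x : R := wave l x - sine_sum I c (l%:R * x).
have crem : continuous rem.
  apply: continuous_funD; first exact: continuous_wave.
  by apply: continuous_funN; apply: continuous_dilate; exact: continuous_sine_sum.
have mrem : mfun rem by exact: continuous_measurable_fun.
(* The coefficients left after moving the terms [i >= 2] to the other side and dividing by [c 1];
   their absolute values sum to at most 3/4. *)
pose a (i : nat) : R := - ((1 < i)%N%:R * c i / c 1).
have E : sine l = (fun x => (c 1)^-1 * wave l x + (\sum_(i < I) a i * sine (i * l) x +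
    - (c 1)^-1 * rem x)).
  apply/funext => x.
  have -> : rem x = wave l x - \sum_(i < I) c i * sine (i * l) x.
    by congr (_ - _); apply: eq_bigr => i _; rewrite sine_dilate.
  have c1n : c 1 != 0 by rewrite gt_eqF.
  have -> : \sum_(i < I) c i * sine (i * l) x =
      c 1 * sine l x - c 1 * \sum_(i < I) a i * sine (i * l) x.
    rewrite mulr_sumr -sumrN.
    have -> : c 1 * sine l x = \sum_(i < I) (1%N == i)%:R * (c i * sine (i * l) x).
      rewrite (sum_ord_delta _ _ (fun i => c i * sine (i * l) x)) (_ : (1 < I)%N) ?mul1r ?mul1n//.
      by rewrite leq_max leqnn orbT.
    rewrite -big_split /=; apply: eq_bigr => -[[|[|i]] iI] _ /=; rewrite /a /=.
    + by rewrite triangle_coef0 !mul0r; ring.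
    + by rewrite !mul0r oppr0 mul0r mulr0 subr0 mul1r.
    + by rewrite mul0r add0r mul1r; field.
  by field.
have w1 : within 0 (fun x => (c 1)^-1 * wave l x).
  apply: within_le (_ : `|(c 1)^-1| * 0 <= 0) _; first by rewrite mulr0.
  apply: (withinZ q1 me) => // d d0; exists [:: (exist _ l l0, 1)].
  rewrite (_ : _ \- _ = cst 0).
    by rewrite (Lnorm_cst mu1 q1 0) normr0 lee_fin add0r ltW.
  by apply/funext => x; rewrite /= /lincomb big_seq1 mul1r subrr.
have w2 : within ((\sum_(i < I) `|a i|) * r) (fun x => \sum_(i < I) a i * sine (i * l) x).
  apply: (within_sum (f := fun i x => sine (i * l) x)) => // i _ ai; apply: IH.
  rewrite muln_gt0 l0 andbT lt0n; apply: contraNneq ai => ->.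
  by rewrite /a !mul0r oppr0.
have w3 : within (eps / 2) (fun x => - (c 1)^-1 * rem x).
  apply: within_norm; rewrite (Lnorm_scale mu q1 _ mrem) (Lnorm_unit_norm q1 crem) -EFinM lee_fin.
  rewrite normrN (gtr0_norm (_ : 0 < (c 1)^-1)) ?invr_gt0// mulrC ler_pdivrMr// mulrC.
  exact: le_trans (wave_remainder_le _ _ q1) SI.
have asum : \sum_(i < I) `|a i| <= 3 / 4.
  rewrite -(ler_pM2r c1) mulr_suml; apply: le_trans (triangle_coef_tail I).
  apply: ler_sum => i _; rewrite /a normrN !normrM normr_nat.
  rewrite (gtr0_norm (_ : 0 < (c 1)^-1)) ?invr_gt0//.
  by rewrite divfK// gt_eqF.
have msum : mfun (fun x => \sum_(i < I) a i * sine (i * l) x).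
  by apply: measurable_sum => i; exact: measurable_funM.
have mr : mfun (fun x => - (c 1)^-1 * rem x) by exact: measurable_funM.
have mw1 : mfun (fun x => (c 1)^-1 * wave l x) by exact: measurable_funM.
have [s Ns] := withinD q1 me mw1 (measurable_funD msum mr) w1 (withinD q1 me msum mr w2 w3) e2.
exists s; rewrite E (le_trans Ns)// lee_fin exprS -/r.
have := ler_wpM2r r0 asum; lra.
Qed.

Lemma pos_wave_dense f : mfun f -> (N f < +oo)%E -> approximable mu q pos_wave f.
Proof.
have asine l : approximable mu q pos_wave (@sine R l).
  move=> eps eps0; have e2 : 0 < eps / 2 by rewrite divr_gt0.
  have [l0|l0] := posnP l.
    exists [::]; rewrite (_ : _ \- _ = cst 0); last first.
      by apply/funext => x; rewrite /= l0 /sine mulr0 mul0r sin0 /lincomb big_nil subrr.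
    by rewrite (Lnorm_cst mu1 q1 0) normr0 lee_fin ltW.
  have z1 : `|3 / 4| < 1 :> R by rewrite ger0_norm; lra.
  have /cvgrPdist_lt/(_ _ e2)[n _ /(_ n (leqnn n))] := cvg_expr z1.
  rewrite /= sub0r normrN ger0_norm; last by apply: exprn_ge0; lra.
  move=> rn; have [s Ns] := sine_within n l0 e2.
  by exists s; rewrite (le_trans Ns)// lee_fin; lra.
move=> mf Nf; apply: (approximable_limit q1 me) => // eps eps0.
have [s Ns] := sine_dense q1 mf Nf eps0; exists (lincomb (@sine R) s); split => //.
- exact: measurable_lincomb.
- apply: (@approximable_sum _ _ _ _ mu q mu1 q1 _ me _ s (fun p x => p.2 * sine p.1 x)) => p.
    exact: measurable_funM.
  exact: (approximableZ q1 me).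
Qed.

End density.

Section uniform_bound.
Variables (d : nat -> R) (Dd : R).
Hypothesis d0 : d 0%N = 0.
Hypothesis dc : forall n, (0 < n)%N ->
  \sum_(j < n.+1) \sum_(i < n.+1) (j * i == n)%N%:R * (d j * c i) = (n == 1)%N%:R.
Hypothesis d_sum : forall N, \sum_(j < N) `|d j| <= Dd.

Let pos_dual (k : {k : nat | (0 < k)%N}) : measurableTypeR R -> R := dual d (val k).

Let mdual k : mfun (dual d k).
Proof. by apply: continuous_measurable_fun; exact: continuous_dual. Qed.

Let dual_bound k : R := \sum_(j < k.+1) \sum_(i < k.+1) `|d j| * 2.

Let dual_bound_ge0 k : 0 <= dual_bound k.
Proof. by apply: sumr_ge0 => j _; apply: sumr_ge0 => i _; exact: mulr_ge0. Qed.

Let dual_le k x : `|dual d k x| <= dual_bound k.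
Proof.
rewrite (le_trans (ler_norm_sum _ _ _))//; apply: ler_sum => j _.
rewrite (le_trans (ler_norm_sum _ _ _))//; apply: ler_sum => i _.
rewrite !normrM normr_nat; apply: (@le_trans _ _ (1 * (`|d j| * (`|2| * 1)))).
  apply: ler_pM => //; first by case: (_ == _).
  apply: ler_wpM2l => //; apply: ler_wpM2l => //.
  by rewrite ler_norml sin_geN1 sin_le1.
by rewrite mul1r mulr1 normr_nat.
Qed.

Let coef_projE m f x : coef_proj mu pos_wave pos_dual (pos_iota m) f x =
  \sum_(k < m.+1) (\int[mu]_y (f y * dual d k y)) * wave k x.
Proof.
rewrite /coef_proj big_map -[iota 0 m](_ : index_iota 0 m = _); last by rewrite /index_iota subn0.
rewrite big_mkord big_ord_recl wave0 mulr0 add0r.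
exact: eq_bigr.
Qed.

Let mproj m f : mfun (coef_proj mu pos_wave pos_dual (pos_iota m) f).
Proof. by apply: measurable_sum => k; exact: measurable_funM. Qed.

(** The bound known for sine sums extends by density. On the error f - H the projection is estimated
    crudely, with a constant [K] that depends on [m]; this is harmless, since [delta] is chosen
    after [m]. *)
Lemma pos_wave_uniformly_bounded : uniformly_bounded pos_iota mu q pos_wave pos_dual.
Proof.
have [C C0 PC] := partial_sum_bounded d0 d_sum q1.
exists C => // m f mf Nf; set P := coef_proj _ _ _ _.
have NfE : (N f = (fine (N f))%:E)%E by rewrite fineK// ge0_fin_numE// Lnorm_ge0.
set r := fine (N f) in NfE.
pose K := \sum_(k < m.+1) dual_bound k.
have K0 : 0 <= K by apply: sumr_ge0 => k _.
apply/lee_addgt0Pr => eps eps0.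
have CK0 : 0 < C + K + 1 by rewrite ltr_wpDl// addr_ge0.
pose delta := eps / (C + K + 1); have delta0 : 0 < delta by rewrite divr_gt0.
have [s Ns] := sine_dense q1 mf Nf delta0.
have [M [b E]] := lincomb_sine s.
rewrite (_ : f \- lincomb _ s = f \- sine_sum M b) in Ns; last by rewrite -E.
set H := sine_sum M b in Ns.
have cH : continuous H by exact: continuous_sine_sum.
have mH : mfun H by exact: continuous_measurable_fun.
have NH : (N H <= (r + delta)%:E)%E.
  apply: le_trans (Lnorm_le_add mH mf) _; rewrite Lnorm_subC EFinD NfE.
  exact: leeD2l.
have NHfin : (N H < +oo)%E by rewrite (le_lt_trans NH)// ltry.
have NPH : (N (P H) <= (C * (r + delta))%:E)%E.
  have PHE : P H = (fun x : R => \sum_(k < m.+1) int01 (fun y => H y * dual d k y) * wave k x).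
    apply/funext => x; rewrite /P coef_projE; apply: eq_bigr => k _.
    by rewrite Rintegral_unit//; exact: (measurable_funM mH (mdual k)).
  have cPH : continuous (P H).
    rewrite PHE; apply: (continuous_sum_fun (n := m.+1)
      (h := fun k x => int01 (fun y => H y * dual d k y) * wave k x)) => k.
    by apply: continuous_funM; [exact: continuous_fun_cst|exact: continuous_wave].
  rewrite (Lnorm_unit_norm q1 cPH) lee_fin PHE; apply: le_trans (PC m M b) _.
  by move: NH; rewrite (Lnorm_unit_norm q1 cH) lee_fin => NH; exact: ler_wpM2l.
have mfH : mfun (f \- H) by exact: measurable_funB.
have NfH : (N (f \- H) < +oo)%E by rewrite (le_lt_trans Ns)// ltry.
have NPd : (N (P f \- P H) <= (K * delta)%:E)%E.
  apply: (Lnorm_le_sup mu1 q1) => [|x]; first exact: (measurable_funB (mproj m f) (mproj m H)).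
  rewrite /= /P !coef_projE -sumrB (le_trans (ler_norm_sum _ _ _))// mulr_suml.
  apply: ler_sum => k _; rewrite -mulrBl normrM.
  rewrite -[leRHS]mulr1; apply: ler_pM => //; last exact: wave_le1.
  rewrite -RintegralB//; last 2 first.
    exact: (integrable_mul_bounded mu1 q1 mf Nf (mdual k) (dual_le k)).
    exact: (integrable_mul_bounded mu1 q1 mH NHfin (mdual k) (dual_le k)).
  under eq_Rintegral do rewrite -mulrBl.
  have := Lnorm_pairing mu1 q1 (dual_bound_ge0 k) mfH NfH (mdual k) (dual_le k).
  move=> /le_trans/(_ (lee_wpmul2l _ Ns)); rewrite -EFinM !lee_fin.
  by apply; exact: dual_bound_ge0.
apply: le_trans (Lnorm_le_add (mproj m f) (mproj m H)) _.
apply: le_trans (leeD NPH NPd) _; rewrite NfE -EFinM -!EFinD lee_fin.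
have : (C + K) * delta <= eps.
  by rewrite /delta mulrCA ger_pMr// ler_pdivrMr// mul1r lerDl.
lra.
Qed.

Lemma pos_wave_good_system : good_system pos_iota mu q pos_wave pos_dual.
Proof.
split.
- split=> k; first by split; [exact: me|exists 1 => // x; exact: wave_le1].
  by split; [exact: mdual|exists (dual_bound (val k)) => // x; exact: dual_le].
- move=> k l; rewrite Rintegral_unit; last exact: (measurable_funM (me k) (mdual (val l))).
  by rewrite (wave_dual_biorthogonal dc (valP k) (valP l)) val_eqE.
- exact: pos_wave_uniformly_bounded.
- exact: pos_wave_dense.
Qed.

End uniform_bound.
End triangle_system.

Theorem theorem3p4 (R : realType) (n : nat) (hn : (1 <= n <= 3)%N)
  (q : R) (hq : 1 < q) :
  pringsheim_schauder_basis (lebesgue_ocube n) q (@triangle_wave_prod R n).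
Proof.
have theta1 : 3 / 4 < 1 :> R by lra.
have [d [d0 dc d_sum]] :=
  dirichlet_inverse (@triangle_coef1_gt0 R) theta1 (@triangle_coef_tail R).
have [[be bg] biorth unif dense] := cube_good_system hq n (pos_wave_good_system hq d0 dc d_sum).
exact: (basis_criterion (lebesgue_ocube_mass1 n) hq be bg biorth unif dense).
Qed.
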